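(* Let $\mathbb{G}$ be a stratified Lie group, let $1<p<\infty$, and let $\Omega\subset\mathbb{G}$ be an admissible domain. Let $g_1,g_2:\Omega\times\mathbb{R}\to\mathbb{R}$ be positive, bounded and measurable functions such that, for some constant $C$, $g_i(x,\rho)\leq C(\rho^{p-1}+1)$ for all $\rho>0$, $i=1,2$. If functions $u_1,u_2\in\overset{\circ}{S}{}^{1,p}(\Omega)$, with $u_1,u_2\not\equiv 0$ and $u_1,u_2\geq 0$ a.e. in $\Omega$, are such that $-\mathcal{L}_{p}u_{1}=g_{1}(x,u_{1})$ and $-\mathcal{L}_{p}u_{2}=g_{2}(x,u_{2})$, then $$0\leq\int_{\Omega}\left(\frac{-\mathcal{L}_{p}u_{1}}{u_{1}^{p-1}}+\frac{\mathcal{L}_{p}u_{2}}{u_{2}^{p-1}}\right)(u_{1}^{p}-u_{2}^{p})\,dx .$$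
   Context: Stratified Lie group: a Lie group $\mathbb{G}=(\mathbb{R}^{N},\circ)$ such that (i) for some natural numbers $N_{1}+\dots+N_{r}=N$, writing $\mathbb{R}^{N}=\mathbb{R}^{N_1}\times\dots\times\mathbb{R}^{N_r}$, $x=(x^{(1)},\dots,x^{(r)})$, for every $\lambda>0$ the dilation $\delta_\lambda(x)=(\lambda x^{(1)},\dots,\lambda^{r}x^{(r)})$ is an automorphism of $\mathbb{G}$; (ii) if $X_1,\dots,X_{N_1}$ are the left invariant vector fields with $X_k(0)=\frac{\partial}{\partial x_k}|_0$, $k=1,\dots,N_1$, then the iterated commutators of $X_1,\dots,X_{N_1}$ span the Lie algebra of $\mathbb{G}$, i.e. $\operatorname{rank}(\operatorname{Lie}\{X_1,\dots,X_{N_1}\})=N$ at every point. The horizontal gradient is $\nabla_{\mathbb{G}}=(X_1,\dots,X_{N_1})$; $dx$ is Lebesgue measure on $\mathbb{R}^N$ (the Haar measure of $\mathbb{G}$). $u\in C^1(\Omega)$ means $\nabla_{\mathbb{G}}u\in C(\Omega)$. Admissible domain: an open set $\Omega\subset\mathbb{G}$ which is bounded and whose boundary $\partial\Omega$ is piecewise smooth and simple (no self-intersections). $\overset{\circ}{S}{}^{1,p}(\Omega)$ is the completion of $C^1_0(\Omega)$ (real-valued, compactly supported) in the norm $J_p(u)=\left(\int_\Omega|\nabla_{\mathbb{G}}u|^p\,dx\right)^{1/p}$. The $p$-sub-Laplacian is $\mathcal{L}_{p}f=\nabla_{\mathbb{G}}\cdot(|\nabla_{\mathbb{G}}f|^{p-2}\nabla_{\mathbb{G}}f)$,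 understood in the weak sense: $-\mathcal{L}_pu=g(x,u)$ means $\int_\Omega|\nabla_{\mathbb{G}}u|^{p-2}\nabla_{\mathbb{G}}u\cdot\nabla_{\mathbb{G}}\phi\,dx=\int_\Omega g(x,u)\phi\,dx$ for all $\phi\in C_0^\infty(\Omega)$. *)

(* Defs.v *)
From HB Require Import structures.
From mathcomp Require Import all_boot all_order all_algebra.
From mathcomp Require Import all_classical all_reals all_analysis.

Set Implicit Arguments.
Unset Strict Implicit.
Unset Printing Implicit Defensive.

Import Order.TTheory GRing.Theory Num.Theory.
Import numFieldNormedType.Exports.

Local Open Scope classical_set_scope.
Local Open Scope ring_scope.

Definition rV_display : measure_display. Proof. exact: default_measure_display. Qed.

(* The product of the Borel sigma-algebras of the coordinates, i.e. the Borel
   sigma-algebra of R^n. *)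
Section rV_measurable.
Variables (R : realType) (n : nat).

Let coords : 'I_n -> 'rV[R]_n -> measurableTypeR R := fun i v => v ord0 i.

Let rV_set0 : g_sigma_preimage coords set0.
Proof. exact: sigma_algebra0. Qed.

Let rV_setC A : g_sigma_preimage coords A -> g_sigma_preimage coords (~` A).
Proof. exact: sigma_algebraC. Qed.

Let rV_bigcup (F : _^nat) : (forall i, g_sigma_preimage coords (F i)) ->
  g_sigma_preimage coords (\bigcup_i (F i)).
Proof. exact: sigma_algebra_bigcup. Qed.

HB.instance Definition _ := @isMeasurable.Build rV_display
  'rV[R]_n (g_sigma_preimage coords) rV_set0 rV_setC rV_bigcup.

Lemma measurable_coord_rV (i : 'I_n) :
  measurable_fun [set: 'rV[R]_n] (fun v : 'rV[R]_n => v ord0 i : measurableTypeR R).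
Proof.
move=> _ Y mY; rewrite setTI; apply: sub_sigma_algebra => /=.
rewrite -bigcup_seq/=; exists i => /=; first by rewrite mem_index_enum.
by exists Y => //; rewrite setTI.
Qed.

Lemma measurable_fun_rV d (T : measurableType d) (f : T -> 'rV[R]_n) :
  (forall i, measurable_fun setT (fun x => f x ord0 i : measurableTypeR R)) ->
  measurable_fun setT f.
Proof.
move=> mf _ Y mY; rewrite setTI.
pose S : set_system 'rV[R]_n := [set A | measurable (f @^-1` A)].
suff : g_sigma_preimage coords `<=` S by apply.
apply: smallest_sub.
  split => [|A|F] /=; rewrite /S /=.
  - by rewrite preimage_set0.
  - by move=> mA; rewrite setTD preimage_setC; exact: measurableC.
  - by move=> mF; rewrite preimage_bigcup; exact: bigcup_measurable.
rewrite -bigcup_seq => A [i _ [B mB <-]]; rewrite /S /= setTI.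
by have := mf i measurableT B mB; rewrite setTI.
Qed.

End rV_measurable.

Definition cons_rV (R : realType) (n : nat) (z : measurableTypeR R * 'rV[R]_n) :
  'rV[R]_n.+1 := row_mx (const_mx z.1 : 'rV[R]_1) z.2.

Section lebesgue_measure_step.
Variables (R : realType) (n : nat).
Variable mu : {sigma_finite_measure set 'rV[R]_n -> \bar R}.

Lemma measurable_cons_rV : measurable_fun setT (@cons_rV R n).
Proof.
apply: measurable_fun_rV => i; rewrite /cons_rV.
case: (split_ordP (i : 'I_(1 + n))) => j ->.
  rewrite (_ : (fun _ => _) = fst); first exact: measurable_fst.
  apply/funext => z /=.
  by rewrite (row_mxEl (const_mx z.1 : 'rV[R]_1) z.2) mxE.
rewrite (_ : (fun _ => _) = (fun v : 'rV[R]_n => v ord0 j) \o snd); last first.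
  by apply/funext => z /=; exact: (row_mxEr (const_mx z.1 : 'rV[R]_1) z.2).
by apply: measurableT_comp => //; exact: measurable_coord_rV.
Qed.

Definition lebesgue_measure_step : set 'rV[R]_n.+1 -> \bar R :=
  pushforward ((@lebesgue_measure R) \x mu)%E (@cons_rV R n).

Let step0 : lebesgue_measure_step set0 = 0%E.
Proof. by rewrite /lebesgue_measure_step /pushforward preimage_set0 measure0. Qed.

Let step_ge0 A : (0%E <= lebesgue_measure_step A)%E.
Proof. by rewrite /lebesgue_measure_step /pushforward measure_ge0. Qed.

Let step_sigma_additive : semi_sigma_additive lebesgue_measure_step.
Proof.
have mc := measurable_cons_rV.
move=> F mF tF mUF; rewrite /lebesgue_measure_step /pushforward preimage_bigcup.
apply: measure_semi_sigma_additive.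
- by move=> k; rewrite -[X in measurable X]setTI; exact: mc.
- apply/trivIsetP => /= i j _ _ ij; rewrite -preimage_setI.
  by move/trivIsetP : tF => /(_ _ _ _ _ ij) ->//; rewrite preimage_set0.
- by rewrite -preimage_bigcup -[X in measurable X]setTI; exact: mc.
Qed.

HB.instance Definition _ := isMeasure.Build _ _ _ lebesgue_measure_step
  step0 step_ge0 step_sigma_additive.

Let uncons (v : 'rV[R]_n.+1) : measurableTypeR R * 'rV[R]_n :=
  ((v : 'rV[R]_(1 + n)) ord0 (lshift n ord0), rsubmx (v : 'rV[R]_(1 + n))).

Let measurable_uncons : measurable_fun setT uncons.
Proof.
have m1 := @measurable_coord_rV R n.+1 (lshift n ord0 : 'I_(1 + n)).
apply: (measurable_fun_pair m1); apply: measurable_fun_rV => i.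
rewrite (_ : (fun _ => _) =
  fun v : 'rV[R]_n.+1 => v ord0 (rshift 1 i : 'I_n.+1)).
  exact: measurable_coord_rV.
by apply/funext => v /=; rewrite mxE.
Qed.

Let uncons_cons z : uncons (cons_rV z) = z.
Proof.
case: z => x v; rewrite /uncons /cons_rV /= row_mxEl mxE; congr pair.
exact: row_mxKr.
Qed.

Let step_sigma_finite : sigma_finite setT lebesgue_measure_step.
Proof.
have /sigma_finiteP[F [TF ndF Foo]] := sigma_finiteT (@lebesgue_measure R).
have /sigma_finiteP[G [TG ndG Goo]] := sigma_finiteT mu.
exists (fun k => uncons @^-1` (F k `*` G k)).
  rewrite -preimage_bigcup -(preimage_setT uncons); congr (_ @^-1` _).
  apply/esym; rewrite -subTset => -[x v] _.
  have [k _ Fx] : (\bigcup_k F k) x by rewrite -TF.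
  have [l _ Gv] : (\bigcup_k G k) v by rewrite -TG.
  exists (maxn k l) => //; split => /=.
    by move: x Fx; exact/subsetPset/ndF/leq_maxl.
  by move: v Gv; exact/subsetPset/ndG/leq_maxr.
move=> k; have [mF Fk] := Foo k; have [mG Gk] := Goo k.
split.
  rewrite -[X in measurable X]setTI; apply: measurable_uncons => //.
  exact: measurableX.
rewrite /lebesgue_measure_step /pushforward -comp_preimage.
rewrite (_ : uncons \o _ = id); last by rewrite funeqE => z; exact: uncons_cons.
by rewrite preimage_id product_measure1E// lte_mul_pinfty// ge0_fin_numE.
Qed.

HB.instance Definition _ := Measure_isSigmaFinite.Build _ _ _
  lebesgue_measure_step step_sigma_finite.

End lebesgue_measure_step.

Fixpoint lebesgue_measure_rV (R : realType) (n : nat) :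
    {sigma_finite_measure set 'rV[R]_n -> \bar R} :=
  if n is k.+1 then lebesgue_measure_step (lebesgue_measure_rV R k)
  else (dirac (0 : 'rV[R]_0) : probability _ R).

(* The library norm of 'rV[R]_m is the sup norm. *)
Definition dotp (R : realType) (m : nat) (v w : 'rV[R]_m) : R :=
  \sum_i v ord0 i * w ord0 i.

Definition enorm (R : realType) (m : nat) (v : 'rV[R]_m) : R :=
  Num.sqrt (dotp v v).

Definition evec (R : realType) (m : nat) (i : 'I_m) : 'rV[R]_m :=
  delta_mx ord0 i.

Fixpoint Ck (R : realType) (m : nat) (k : nat) (U : set 'rV[R]_m)
    (f : 'rV[R]_m -> R) : Prop :=
  (forall x, U x -> {for x, continuous f}) /\
  if k is j.+1 then
    forall i : 'I_m, (forall x, U x -> derivable f x (evec R i)) /\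
      Ck j U (fun x => 'D_(evec R i) f x)
  else True.

(* Meant for open U. *)
Definition smooth_on (R : realType) (m : nat) (U : set 'rV[R]_m)
    (f : 'rV[R]_m -> R) : Prop :=
  forall k, Ck k U f.

(* A vector field is given by its coefficient vector. The flow of a left
   invariant vector field on a Lie group is complete and unique, so that the
   integral curve below exists for every starting point x and is the only one. *)
Definition integral_curve (R : realType) (m : nat)
    (X : 'rV[R]_m -> 'rV[R]_m) (c : R -> 'rV[R]_m) : Prop :=
  forall t : R, is_derive t 1 c (X (c t)).

Definition is_lie_derive (R : realType) (m : nat) (X : 'rV[R]_m -> 'rV[R]_m)
    (f : 'rV[R]_m -> R) (x : 'rV[R]_m) (l : R) : Prop :=
  exists c : R -> 'rV[R]_m,
    [/\ integral_curve X c, c 0 = x & is_derive (0 : R) 1 (f \o c) l].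

Definition lie_derive (R : realType) (m : nat) (X : 'rV[R]_m -> 'rV[R]_m)
    (f : 'rV[R]_m -> R) (x : 'rV[R]_m) : R :=
  xget 0 [set l | is_lie_derive X f x l].

Definition lie_bracket (R : realType) (m : nat)
    (X Y : 'rV[R]_m -> 'rV[R]_m) : 'rV[R]_m -> 'rV[R]_m :=
  fun x => 'D_(X x) Y x - 'D_(Y x) X x.

Inductive lie_generated (R : realType) (m : nat) (I : Type)
    (Z : I -> 'rV[R]_m -> 'rV[R]_m) : ('rV[R]_m -> 'rV[R]_m) -> Prop :=
| lie_generator k : lie_generated Z (Z k)
| lie_lincomb (a : R) X Y : lie_generated Z X -> lie_generated Z Y ->
    lie_generated Z (fun x => a *: X x + Y x)
| lie_commutator X Y : lie_generated Z X -> lie_generated Z Y ->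
    lie_generated Z (lie_bracket X Y).

(* For a list s of block sizes, coordinate i lies in block number
   reshape_index s i, counted from 0, and is dilated by the exponent
   (reshape_index s i).+1. *)
Definition dilation (R : realType) (n : nat) (s : seq nat) (lam : R)
    (x : 'rV[R]_n) : 'rV[R]_n :=
  \row_i (lam ^+ (reshape_index s i).+1 * x ord0 i).

(* X_k(x) = d(tau_x)_0 (e_k) for the left translation tau_x = op x: the left
   invariant vector field whose value at 0 is the k-th coordinate vector. *)
Definition left_invariant_field (R : realType) (n : nat)
    (op : 'rV[R]_n -> 'rV[R]_n -> 'rV[R]_n) (k : 'I_n) : 'rV[R]_n -> 'rV[R]_n :=
  fun x => 'D_(evec R k) (op x) 0.

(* The group law lives on R^N with N = n.+1. Compatibility with the dilations
   forces the identity to be 0. As the first block has size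
   head 0 strata <= n.+1, inord does not alter the indices k below. *)
Record stratified_group (R : realType) (n : nat) := StratifiedGroup {
  sg_op : 'rV[R]_n.+1 -> 'rV[R]_n.+1 -> 'rV[R]_n.+1 ;
  sg_inv : 'rV[R]_n.+1 -> 'rV[R]_n.+1 ;
  sg_strata : seq nat ;
  sg_opA : forall x y z, sg_op x (sg_op y z) = sg_op (sg_op x y) z ;
  sg_op0x : forall x, sg_op 0 x = x ;
  sg_opx0 : forall x, sg_op x 0 = x ;
  sg_opVx : forall x, sg_op (sg_inv x) x = 0 ;
  sg_opxV : forall x, sg_op x (sg_inv x) = 0 ;
  sg_op_smooth : forall i : 'I_n.+1,
    smooth_on setT (fun z : 'rV[R]_(n.+1 + n.+1) =>
      sg_op (lsubmx z) (rsubmx z) ord0 i) ;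
  sg_inv_smooth : forall i : 'I_n.+1,
    smooth_on setT (fun x => sg_inv x ord0 i) ;
  sg_strata_gt0 : all (fun k => 0 < k)%N sg_strata ;
  sg_strata_sum : sumn sg_strata = n.+1 ;
  sg_dilation : forall (lam : R) x y, 0 < lam ->
    dilation sg_strata lam (sg_op x y) =
    sg_op (dilation sg_strata lam x) (dilation sg_strata lam y) ;
  sg_rank : forall x : 'rV[R]_n.+1,
    exists Y : 'I_n.+1 -> 'rV[R]_n.+1 -> 'rV[R]_n.+1,
      (forall i, lie_generated (fun k : 'I_(head 0%N sg_strata) =>
         left_invariant_field sg_op (inord k)) (Y i)) /\
      \rank (\matrix_i Y i x) = n.+1
}.

Section horizontal_calculus.
Variables (R : realType) (n : nat) (G : stratified_group R n).
Local Notation V := 'rV[R]_n.+1.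
Local Notation N1 := (head 0%N (sg_strata G)).
Local Notation mu := (lebesgue_measure_rV R n.+1).
Implicit Types (Omega : set V) (p : R) (u f phi : V -> R) (Du : V -> 'rV[R]_N1).

Definition hfield (k : 'I_N1) : V -> V :=
  left_invariant_field (sg_op G) (inord k).

Definition hgrad f (x : V) : 'rV[R]_N1 := \row_k lie_derive (hfield k) f x.

Definition compact_support_in Omega f : Prop :=
  exists K : set V, [/\ compact K, K `<=` Omega & forall x, ~ K x -> f x = 0].

Definition C1c Omega f : Prop :=
  [/\ compact_support_in Omega f,
      forall x, Omega x -> {for x, continuous f},
      forall k x, Omega x -> exists l, is_lie_derive (hfield k) f x l
    & forall k x, Omega x -> {for x, continuous (fun y => hgrad f y ord0 k)}].

Definition Cooc Omega f : Prop :=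
  compact_support_in Omega f /\ smooth_on setT f.

Definition Jp p Omega u : \bar R :=
  poweR (\int[mu]_(x in Omega) (enorm (hgrad u x) `^ p)%:E)%E p^-1.

(* The completion of (C1c, Jp), realised as a space of functions: by the
   Poincare inequality a Jp-Cauchy sequence converges in L^p(Omega), and its
   class is identified with its limit u. Du is the L^p limit of the gradients. *)
Definition sobolev0_grad p Omega u Du : Prop :=
  [/\ measurable_fun Omega u,
      forall k, measurable_fun Omega (fun x => Du x ord0 k)
    & exists phi : nat -> V -> R,
      [/\ forall j, C1c Omega (phi j),
          forall e : R, 0 < e -> exists j0, forall i j, (j0 <= i)%N -> (j0 <= j)%N ->
            (Jp p Omega (fun x => phi i x - phi j x)%R < e%:E)%E,
          (fun j => \int[mu]_(x in Omega) (`|phi j x - u x| `^ p)%:E)%E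
            @ \oo --> 0%E
        & (fun j => \int[mu]_(x in Omega)
             (enorm (hgrad (phi j) x - Du x) `^ p)%:E)%E @ \oo --> 0%E]].

Definition sobolev0 p Omega u : Prop := exists Du, sobolev0_grad p Omega u Du.

(* Unique almost everywhere. *)
Definition sobolev_grad p Omega u : V -> 'rV[R]_N1 :=
  xget (fun=> 0) [set Du | sobolev0_grad p Omega u Du].

Definition locally_integrable_rV Omega f : Prop :=
  measurable_fun Omega f /\
  forall K : set V, compact K -> K `<=` Omega ->
    (\int[mu]_(x in K) `|f x|%:E < +oo)%E.

(* The function Lu represents the distribution div_G (|grad u|^(p-2) grad u).
   Where Du vanishes so does dotp, whatever the value of 0 `^ (p - 2). *)
Definition weak_psublaplacian p Omega u (Lu : V -> R) : Prop :=
  locally_integrable_rV Omega Lu /\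
  forall phi, Cooc Omega phi ->
    let Du := sobolev_grad p Omega u in
    (\int[mu]_(x in Omega)
       (enorm (Du x) `^ (p - 2) * dotp (Du x) (hgrad phi x))%:E =
     \int[mu]_(x in Omega) (- Lu x * phi x)%:E)%E.

End horizontal_calculus.

Section admissible_domain.
Variables (R : realType) (n : nat).
Implicit Types (Omega S : set 'rV[R]_n.+1).

Definition boundary Omega : set 'rV[R]_n.+1 := closure Omega `\` interior Omega.

Definition cube : set 'rV[R]_n := [set y | forall i, 0 <= y ord0 i <= 1].

Definition open_cube : set 'rV[R]_n := [set y | forall i, 0 < y ord0 i < 1].

Definition smooth_patch (F : 'rV[R]_n -> 'rV[R]_n.+1) : Prop :=
  [/\ exists U : set 'rV[R]_n, [/\ open U, cube `<=` U
        & forall i, smooth_on U (fun y => F y ord0 i)],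
      forall y z, cube y -> cube z -> F y = F z -> y = z
    & forall y, cube y -> \rank ('J F y) = n].

(* Finitely many embedded smooth patches, overlapping only along their edges. *)
Definition piecewise_smooth S : Prop :=
  exists (m : nat) (F : 'I_m -> 'rV[R]_n -> 'rV[R]_n.+1),
    [/\ forall j, smooth_patch (F j),
        S = \bigcup_(j in [set: 'I_m]) (F j @` cube)
      & forall i j, i != j -> (F i @` open_cube) `&` (F j @` cube) = set0].

(* No self-intersections: S is locally homeomorphic to R^(N-1). *)
Definition simple_hypersurface S : Prop :=
  forall x, S x -> exists (W : set 'rV[R]_n.+1)
    (f : 'rV[R]_n -> 'rV[R]_n.+1) (g : 'rV[R]_n.+1 -> 'rV[R]_n),
    [/\ open_nbhs x W, continuous f, {within S `&` W, continuous g},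
        range f = S `&` W & forall y, g (f y) = y].

Definition admissible_domain Omega : Prop :=
  [/\ open Omega, bounded_set Omega, piecewise_smooth (boundary Omega)
    & simple_hypersurface (boundary Omega)].

End admissible_domain.

(* Main.v *)
(* Write f_i = - L u_i >= 0. The integrand is
     f_1 u_1 + f_2 u_2 - f_1 u_2^p / u_1^(p-1) - f_2 u_1^p / u_2^(p-1),
   so it is enough to show, for a solution u of - L u = f and for v >= 0 in the
   Sobolev space,
     int f v^p / u^(p-1) <= int |grad v|^p,
   since int |grad u_i|^p = int f_i u_i on testing each equation with its solution.
   This is Picone's inequality: test the equation of u with |psi|^p (u + e)^(1-p),
   psi in C^1_0, apply Young's inequality pointwise, then let psi tend to v and e
   to 0. A test function that is merely horizontally C^1 is admissible because it
   can be mollified: the average of f (y o x) over small y converges to f together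
   with its horizontal gradient, and equals the integral of f (z) against a smooth
   kernel in z o x^-1. The latter change of variables uses that right translations
   preserve Lebesgue measure: by homogeneity the i-th coordinate of x o y is x_i
   plus a function of y and of the coordinates of x before i. *)
Require Import Defs.
From mathcomp Require Import all_boot all_order all_algebra.
From mathcomp Require Import all_classical all_reals all_analysis.
From mathcomp Require Import measurable_realfun ring lra.
From HB Require Import structures.

Import Order.TTheory GRing.Theory Num.Theory.
Import numFieldNormedType.Exports.

Local Open Scope classical_set_scope.
Local Open Scope ring_scope.

(** * Calculus on row vectors *)

Section calculus.
Context {R : realType}.
Implicit Types (m k : nat).

(** Two obstacles shape the proof. Horizontal derivatives are defined along integral curves, and
    these are not a field of [stratified_group]. Their existence is read off the data: a function of
    class [C1c] carries, by definition of its Lie derivatives, an integral curve through every point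
    of Omega, and left translation moves one to the origin. Their uniqueness follows from the
    triangular form of the group law, the fact that also makes right translations measure
    preserving. The other obstacle is that u is only a limit of functions phi_j that may be negative
    and whose gradients converge in L^p. So the singular power t^(1-p) is composed with a C^1
    function bounded away from 0 ([ramp]), and L^p convergence is traded, along a subsequence, for
    almost everywhere convergence under one integrable majorant ([dominated_approx]). Boundedness of
    g_i then enters as |f_i| <= M, and all limits for fixed e are dominated convergence. The limit
    in e is monotone, and it yields the integrability of f v^p / u^(p-1) together with its bound.
    Where u = 0 this quotient is 0 by the convention on inverses, and so is the limit of its
    truncations. *)

Lemma norm_coord_le {m} (x : 'rV[R]_m) i : `|x ord0 i| <= `|x|.
Proof.
rewrite [leRHS]/Num.Def.normr/= mx_normrE.
by apply: (le_bigmax _ (fun ij => `|x ij.1 ij.2|) (ord0, i)).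
Qed.

Lemma norm_rV_le {m} (x : 'rV[R]_m) (r : R) : 0 <= r ->
  (forall i, `|x ord0 i| <= r) -> `|x| <= r.
Proof.
move=> r0 H; rewrite [leLHS]/Num.Def.normr/= mx_normrE.
by apply: bigmax_le => // -[i j] _ /=; rewrite ord1.
Qed.

Lemma cvg_rVP {m} {T : Type} {F : set_system T} {FF : Filter F}
    (f : T -> 'rV[R]_m) (l : 'rV[R]_m) :
  (f x @[x --> F] --> l) <-> forall i, f x ord0 i @[x --> F] --> l ord0 i.
Proof.
split=> [fl i|H].
  by apply: (cvg_comp _ (fun v : 'rV[R]_m => v ord0 i) fl); exact: coord_continuous.
apply/cvgrPdist_le => e e0.
have : \forall x \near F, forall i, `|l ord0 i - f x ord0 i| <= e.
  by apply: filter_forall => i; move/cvgrPdist_le : (H i); exact.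
apply: filterS => x Hx; apply: norm_rV_le; first exact: ltW.
by move=> i; rewrite !mxE.
Qed.

Lemma is_derive_rVP {m} (c : R -> 'rV[R]_m) (t : R) (l : 'rV[R]_m) :
  is_derive t 1 c l <-> forall i, is_derive t 1 (fun s => c s ord0 i) (l ord0 i).
Proof.
split=> [[dc dl] i|H].
  have dci := (derivable_mxP c t 1).1 dc ord0 i.
  by split=> //; rewrite -dl derive_mx// mxE.
have dc : derivable c t 1.
  by apply/derivable_mxP => i j; rewrite (ord1 i); case: (H j).
split=> //; rewrite derive_mx//; apply/rowP => j; rewrite mxE.
by case: (H j).
Qed.

Lemma cvg_sumR {I : Type} {T : Type} {F : set_system T} {FF : Filter F} (r : seq I)
    (f : I -> T -> R) (l : I -> R) :
  (forall i, f i x @[x --> F] --> l i) ->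
  \sum_(i <- r) f i x @[x --> F] --> \sum_(i <- r) l i.
Proof.
by move=> H; apply: cvg_big => //; exact: add_continuous.
Qed.

Lemma continuous_at_add {T : topologicalType} (f g : T -> R) x :
  {for x, continuous f} -> {for x, continuous g} ->
  {for x, continuous (fun y => f y + g y)}.
Proof. by move=> cf cg; exact: (@cvgD _ _ _ (nbhs x) _ f g). Qed.

Lemma continuous_at_mul {T : topologicalType} (f g : T -> R) x :
  {for x, continuous f} -> {for x, continuous g} ->
  {for x, continuous (fun y => f y * g y)}.
Proof. by move=> cf cg; exact: (@cvgM _ _ (nbhs x) _ f g). Qed.

(** The segment is parametrised by s in [0, 1] and not by its endpoints, so that d may have either
    sign or vanish. *)
Lemma MVT_coord {m} (f : 'rV[R]_m -> R) i :
  (forall x, derivable f x (evec R i)) ->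
  forall z d, exists2 s : R, 0 <= s <= 1 &
    f (z + d *: evec R i) - f z = d * 'D_(evec R i) f (z + (s * d) *: evec R i).
Proof.
move=> df z d.
pose g s := f (z + (s * d) *: evec R i).
have dg (s : R) : is_derive s 1 g (d * 'D_(evec R i) f (z + (s * d) *: evec R i)).
  have H : is_derive s 1 (fun s => (s * d) *: evec R i + z) (d *: evec R i).
    apply/is_derive_rVP => j.
    rewrite (_ : (fun _ => _) = fun s => s * (d * evec R i ord0 j) + z ord0 j); last first.
      by apply/funext => r; rewrite !mxE mulrA.
    by apply: is_derive_eq; rewrite scaler0 add0r addr0 [_%:A]mulr1 !mxE.
  set x0 := z + (s * d) *: evec R i.
  have K : is_derive (0:R) 1 (fun h => f (h *: evec R i + x0)) ('D_(evec R i) f x0).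
    apply: DeriveDef; first exact: (derivable1P _ _ _).1 (df x0).
    rewrite /derive; set a := (X in lim (X @ _)); set b := (X in _ = lim (X @ _)).
    suff -> : a = b by [].
    rewrite /a /b.
    by apply/funext => h /=; rewrite addr0 scale0r add0r [_%:A]mulr1.
  have -> : g = (fun h => f (h *: evec R i + x0)) \o (fun r => (r - s) * d).
    apply/funext => r; rewrite /g /= /x0; congr f.
    by rewrite addrCA -scalerDl; congr (_ + _ *: _); lra.
  have I : is_derive s 1 (fun r => (r - s) * d) d.
    by apply: is_derive_eq; rewrite /GRing.scale /=; lra.
  apply: is_derive_eq.
    apply: is_derive1_comp => //.
    by rewrite subrr mul0r; exact: K.
  exact: mulrC.
have [|s s01] := @MVT_segment R g _ 0 1 ler01 (fun x _ => dg x).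
  apply: derivable_within_continuous => x _; by case: (dg x).
rewrite /g mul1r mul0r scale0r addr0 subr0 mulr1 => E.
exists s; first by move: s01; rewrite in_itv.
exact: E.
Qed.

Definition truncv {m} (k : nat) (h : 'rV[R]_m) : 'rV[R]_m :=
  \row_i (if (i < k)%N then h ord0 i else 0).

Lemma truncvS {m} (h : 'rV[R]_m) (k : 'I_m) :
  truncv k.+1 h = truncv k h + h ord0 k *: evec R k.
Proof.
apply/rowP => j; rewrite !mxE eqxx /= ltnS.
have [-> | jk] := eqVneq j k; first by rewrite leqnn ltnn mulr1 add0r.
have {}jk : (j == k :> nat) = false by apply/negbTE; rewrite val_eqE.
by rewrite mulr0 addr0 leq_eqVlt jk.
Qed.

(** The increment telescopes over the path with vertices [x + truncv k h], whose edges are parallel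
    to the axes. [MVT_coord] treats each edge, and its intermediate points stay within |h| of x in
    the sup norm, where the partial derivatives are close to those at x. *)
Lemma C1_differentiable {m} (f : 'rV[R]_m -> R) :
  (forall i x, derivable f x (evec R i)) ->
  (forall i, continuous (fun x => 'D_(evec R i) f x)) ->
  forall x, differentiable f x.
Proof.
move=> df cf x.
pose L (h : 'rV[R]_m) : R := \sum_i h ord0 i * 'D_(evec R i) f x.
have linL : linear L.
  move=> a u v; rewrite /L scaler_sumr -big_split /=; apply: eq_bigr => i _.
  by rewrite !mxE mulrDl -mulrA.
pose LL : {linear 'rV[R]_m -> R} := HB.pack L (GRing.isLinear.Build _ _ _ _ _ linL).
have cL : continuous LL.
  move=> v; rewrite /LL /= /L; apply: (@cvg_sumR _ _ (nbhs v)) => i.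
  by apply: cvgMr_tmp; exact: coord_continuous.
suff E : f \o shift x = cst (f x) + LL +o_ 0 id.
  have d0 := diff_unique cL E.
  by apply/diff_locallyP; rewrite d0; split.
apply/eqaddoP => e e0.
(* Each of the m edges may cost this much; m + 1 instead of m avoids a division by zero in dimension
   0. *)
have e1 : 0 < e / m.+1%:R by rewrite divr_gt0.
have N : \forall y \near x, forall i, `|'D_(evec R i) f x - 'D_(evec R i) f y| <= e / m.+1%:R.
  apply: (@filter_forall _ _ _ (nbhs x)) => i.
  by move/cvgrPdist_le : (cf i x); exact.
have [r /= r0 Hr] := (nbhs_ballP _ _).1 N.
apply/nbhs_ballP; exists r => //= h; rewrite -ball_normE /= sub0r normrN => hr.
rewrite !fctE /shift /= [X in `|X|](_ : _ = \sum_(k < m)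
    (f (x + truncv k.+1 h) - f (x + truncv k h) - h ord0 k * 'D_(evec R k) f x)); last first.
  rewrite sumrB -/(L h) -(big_mkord xpredT (fun k => f (x + truncv k.+1 h) - f (x + truncv k h))).
  rewrite telescope_sumr //.
  have -> : truncv m h = h by apply/rowP => j; rewrite mxE ltn_ord.
  have -> : truncv 0 h = 0 by apply/rowP => j; rewrite !mxE.
  by rewrite addr0 (addrC h) opprD addrA.
apply: le_trans (ler_norm_sum _ _ _) _.
apply: (@le_trans _ _ (\sum_(k < m) e / m.+1%:R * `|h|)); last first.
  rewrite sumr_const card_ord -[leLHS]mulr_natl mulrA ler_wpM2r//.
  by rewrite mulrCA; apply: ler_piMr; rewrite ?(ltW e0)// ler_pdivrMr// mul1r ler_nat.
apply: ler_sum => k _; rewrite truncvS addrA.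
have [s /andP[s0 s1] ->] := MVT_coord f k (df k) (x + truncv k h) (h ord0 k).
rewrite -mulrBr normrM mulrC ler_pM// ?norm_coord_le// distrC.
apply: Hr; rewrite -ball_normE /= -addrA opprD addNKr normrN.
apply: le_lt_trans hr; apply: norm_rV_le => // j; rewrite !mxE eqxx /=.
have [->|jk] := eqVneq j k.
  rewrite ltnn add0r mulr1 normrM (ger0_norm s0).
  by apply: le_trans (norm_coord_le h k); rewrite ler_piMl.
rewrite mulr0 addr0; case: ifP => _; first exact: norm_coord_le.
by rewrite normr0.
Qed.

End calculus.

(** * Functions of class C^k: chain rules and closure properties *)

Section smooth.
Context {R : realType}.

(** Both difference quotients are the same function of h. Through this bridge the one-variable rules
    apply to directional derivatives. *)
Lemma is_derive_line {V W : normedModType R} (f : V -> W) x v l :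
  is_derive x v f l <-> is_derive (0 : R) 1 (fun h => f (h *: v + x)) l.
Proof.
have E : 'D_v f x = 'D_1 (fun h : R => f (h *: v + x)) 0.
  rewrite /derive; set a := (X in lim (X @ _)); set b := (X in _ = lim (X @ _)).
  suff -> : a = b by [].
  by rewrite /a /b; apply/funext => h /=; rewrite addr0 scale0r add0r [_%:A]mulr1.
split=> -[d e].
  by apply: DeriveDef; [exact: (derivable1P _ _ _).1 d | rewrite -E].
by apply: DeriveDef; [exact: (derivable1P _ _ _).2 d | rewrite E].
Qed.

Lemma is_derive_comp_curve {m} (f : 'rV[R]_m -> R) (c : R -> 'rV[R]_m) (t : R) dc :
  (forall i x, derivable f x (evec R i)) ->
  (forall i, continuous (fun x => 'D_(evec R i) f x)) ->
  is_derive t 1 c dc ->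
  is_derive t 1 (f \o c) (\sum_i dc ord0 i * 'D_(evec R i) f (c t)).
Proof.
move=> df cf [c1 c2].
have dfc := C1_differentiable f df cf (c t).
have /derivable1_diffP dct := c1.
have dd : differentiable (f \o c) t by exact: differentiable_comp.
apply: DeriveDef; first exact: diff_derivable.
have E : 'd c t 1 = dc by rewrite -deriveE.
rewrite deriveE// diff_comp//= E.
rewrite [in LHS](row_sum_delta dc) linear_sum; apply: eq_bigr => i _ /=.
by rewrite linearZ /= -deriveE.
Qed.

Lemma Ck_continuous {m} k (f : 'rV[R]_m -> R) : Ck k setT f -> continuous f.
Proof. by case: k => [|k] [H _] x; exact: H. Qed.

Lemma Ck_derivable {m} k (f : 'rV[R]_m -> R) i x : Ck k.+1 setT f ->
  derivable f x (evec R i).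
Proof. by case=> _ /(_ i)[+ _]; exact. Qed.

Lemma Ck_derive {m} k (f : 'rV[R]_m -> R) i : Ck k.+1 setT f ->
  Ck k setT (fun x => 'D_(evec R i) f x).
Proof. by case=> _ /(_ i)[]. Qed.

(** Introduction rule for explicit partial derivatives: [Ck] itself mentions ['D], which would have
    to be identified as a function each time. *)
Lemma CkSP {m} k (f : 'rV[R]_m -> R) (df : 'I_m -> 'rV[R]_m -> R) :
  continuous f -> (forall i x, is_derive x (evec R i) f (df i x)) ->
  (forall i, Ck k setT (df i)) -> Ck k.+1 setT f.
Proof.
move=> cf Df Cdf; split=> [x _|i]; first exact: cf.
split=> [x _|]; first by case: (Df i x).
rewrite (_ : (fun _ => _) = df i)//.
by apply/funext => x; case: (Df i x).
Qed.

Lemma CkS {m} k (f : 'rV[R]_m -> R) : Ck k.+1 setT f -> Ck k setT f.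
Proof.
elim: k f => [|k IH] f Cf.
  by split=> // x _; exact: (Ck_continuous _ _ Cf).
split=> [x _|i]; first exact: (Ck_continuous _ _ Cf).
split=> [x _|]; first exact: (Ck_derivable _ _ _ _ Cf).
by apply: IH; exact: (Ck_derive _ _ _ Cf).
Qed.

Lemma Ck_cst {m} k (a : R) : Ck k setT (fun _ : 'rV[R]_m => a).
Proof.
elim: k a => [|k IH] a; first by split=> // x _; exact: cst_continuous.
apply: (@CkSP _ _ _ (fun _ _ => 0)).
- exact: cst_continuous.
- by move=> i; exact: IH.
Qed.

Lemma Ck_add {m} k (f g : 'rV[R]_m -> R) : Ck k setT f -> Ck k setT g ->
  Ck k setT (fun x => f x + g x).
Proof.
elim: k f g => [|k IH] f g Cf Cg.
  split=> // x _; apply: continuous_at_add.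
    exact: (Ck_continuous _ _ Cf).
  exact: (Ck_continuous _ _ Cg).
refine (@CkSP _ _ _ (fun i x => 'D_(evec R i) f x + 'D_(evec R i) g x) _ _ _).
- move=> x; apply: continuous_at_add; first exact: (Ck_continuous _ _ Cf).
  exact: (Ck_continuous _ _ Cg).
- move=> i x; apply: is_deriveD; apply: derivableP.
    exact: (Ck_derivable _ _ _ _ Cf).
  exact: (Ck_derivable _ _ _ _ Cg).
- by move=> i; apply: IH; [exact: (Ck_derive _ _ _ Cf)|exact: (Ck_derive _ _ _ Cg)].
Qed.

Lemma Ck_mul {m} k (f g : 'rV[R]_m -> R) : Ck k setT f -> Ck k setT g ->
  Ck k setT (fun x => f x * g x).
Proof.
elim: k f g => [|k IH] f g Cf Cg.
  split=> // x _; apply: continuous_at_mul.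
    exact: (Ck_continuous _ _ Cf).
  exact: (Ck_continuous _ _ Cg).
refine (@CkSP _ _ _ (fun i x => f x * 'D_(evec R i) g x + g x * 'D_(evec R i) f x) _ _ _).
- move=> x; apply: continuous_at_mul; first exact: (Ck_continuous _ _ Cf).
  exact: (Ck_continuous _ _ Cg).
- move=> i x; apply: is_deriveM; apply: derivableP.
    exact: (Ck_derivable _ _ _ _ Cf).
  exact: (Ck_derivable _ _ _ _ Cg).
- move=> i; apply: Ck_add; apply: IH.
  + exact: CkS.
  + exact: (Ck_derive _ _ _ Cg).
  + exact: CkS.
  + exact: (Ck_derive _ _ _ Cf).
Qed.

Lemma Ck_sum {m} {I : Type} k (r : seq I) (f : I -> 'rV[R]_m -> R) :
  (forall i, Ck k setT (f i)) -> Ck k setT (fun x => \sum_(i <- r) f i x).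
Proof.
move=> Cf; elim: r => [|i r IH].
  rewrite (_ : (fun _ => _) = fun=> 0); first exact: Ck_cst.
  by apply/funext => x; rewrite big_nil.
rewrite (_ : (fun _ => _) = fun x => f i x + \sum_(i <- r) f i x).
  exact: Ck_add.
by apply/funext => x; rewrite big_cons.
Qed.

Lemma is_derive_coord {m} (i : 'I_m) (x v : 'rV[R]_m) :
  is_derive x v (fun y : 'rV[R]_m => y ord0 i) (v ord0 i).
Proof.
have D : derivable (id : 'rV[R]_m -> 'rV[R]_m) x v by exact: derivable_id.
apply: DeriveDef; first exact: (derivable_mxP _ _ _).1 D ord0 i.
have := derive_mx D; rewrite derive_id => /rowP/(_ i).
by rewrite mxE => ->.
Qed.

Lemma Ck_coord {m} k (i : 'I_m) : Ck k setT (fun x : 'rV[R]_m => x ord0 i).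
Proof.
case: k => [|k]; first by split=> // x _; exact: coord_continuous.
refine (@CkSP _ _ _ (fun j _ => evec R j ord0 i) _ _ _).
- exact: coord_continuous.
- by move=> j x; exact: is_derive_coord.
- by move=> j; exact: Ck_cst.
Qed.

Lemma is_derive_comp_rV {l m} (f : 'rV[R]_m -> R) (phi : 'rV[R]_l -> 'rV[R]_m) x v
    (dphi : 'I_m -> R) :
  (forall i x, derivable f x (evec R i)) ->
  (forall i, continuous (fun x => 'D_(evec R i) f x)) ->
  (forall i, is_derive x v (fun y => phi y ord0 i) (dphi i)) ->
  is_derive x v (f \o phi) (\sum_i dphi i * 'D_(evec R i) f (phi x)).
Proof.
move=> df cf dp; apply/is_derive_line.
have : is_derive (0 : R) 1 (fun h => phi (h *: v + x)) (\row_i dphi i).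
  apply/is_derive_rVP => i; rewrite mxE.
  by have := dp i => /is_derive_line.
move=> /(is_derive_comp_curve f _ _ _ df cf).
rewrite scale0r add0r; congr (is_derive _ _ _ _).
by apply: eq_bigr => i _; rewrite mxE.
Qed.

Lemma continuous_comp_rV {l m} (f : 'rV[R]_m -> R) (phi : 'rV[R]_l -> 'rV[R]_m) :
  continuous f -> (forall i, continuous (fun x => phi x ord0 i)) ->
  continuous (f \o phi).
Proof.
move=> cf cp x; apply: (@continuous_comp _ _ _ phi f); last exact: cf.
by apply/(@cvg_rVP _ _ _ (nbhs x)) => i; exact: cp.
Qed.

Lemma Ck_comp {l m} k (f : 'rV[R]_m -> R) (phi : 'rV[R]_l -> 'rV[R]_m) :
  Ck k setT f -> (forall i, Ck k setT (fun x => phi x ord0 i)) ->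
  Ck k setT (f \o phi).
Proof.
elim: k f phi => [|k IH] f phi Cf Cp.
  split=> // x _; apply: continuous_comp_rV.
    exact: (Ck_continuous _ _ Cf).
  by move=> i; exact: (Ck_continuous _ _ (Cp i)).
refine (@CkSP _ _ _ (fun j x =>
  \sum_i 'D_(evec R j) (fun y => phi y ord0 i) x * 'D_(evec R i) f (phi x)) _ _ _).
- apply: continuous_comp_rV; first exact: (Ck_continuous _ _ Cf).
  by move=> i; exact: (Ck_continuous _ _ (Cp i)).
- move=> i x; apply: is_derive_comp_rV.
  + by move=> j y; exact: (Ck_derivable _ _ _ _ Cf).
  + by move=> j; exact: (Ck_continuous _ _ (Ck_derive _ _ _ Cf)).
  + by move=> j; apply: derivableP; exact: (Ck_derivable _ _ _ _ (Cp j)).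
- move=> j; apply: Ck_sum => i; apply: Ck_mul.
    exact: (Ck_derive _ _ _ (Cp i)).
  apply: (IH (fun x => 'D_(evec R i) f x)); first exact: (Ck_derive _ _ _ Cf).
  by move=> h; apply: CkS.
Qed.

(** The sequence [g] packages a function with all its derivatives; the induction on k replaces j by
    j + 1, so the claim has to be made for all j at once. *)
Lemma Ck_comp1 {m} k (g : nat -> R -> R) (phi : 'rV[R]_m -> R) :
  (forall j (x : R), is_derive x (1 : R) (g j) (g j.+1 x)) ->
  Ck k setT phi -> forall j, Ck k setT (fun x => g j (phi x)).
Proof.
move=> dg; have cg j : continuous (g j).
  by move=> x; apply/differentiable_continuous/derivable1_diffP; case: (dg j x).
elim: k phi => [|k IH] phi Cp j.
  split=> // x _; apply: (@continuous_comp _ _ _ phi (g j)); last exact: cg.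
  exact: (Ck_continuous _ _ Cp).
refine (@CkSP _ _ _ (fun i x => g j.+1 (phi x) * 'D_(evec R i) phi x) _ _ _).
- move=> x; apply: (@continuous_comp _ _ _ phi (g j)); last exact: cg.
  exact: (Ck_continuous _ _ Cp).
- move=> i x; have /is_derive_line H := derivableP (Ck_derivable _ _ i x Cp).
  apply/is_derive_line; rewrite -[X in phi X](add0r x) -(scale0r (evec R i)).
  by apply: is_derive1_comp => //; rewrite scale0r add0r; exact: dg.
- move=> i; apply: Ck_mul; last exact: (Ck_derive _ _ _ Cp).
  by apply: IH; exact: CkS.
Qed.

End smooth.

(** * Lebesgue measure on row vectors *)

Section rV_measure.
Context {R : realType}.
Local Notation leb := (@lebesgue_measure R).

Lemma measurable_rV_box {n} (F : 'I_n -> set R) : (forall i, measurable (F i)) ->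
  measurable [set x : 'rV[R]_n | forall i, F i (x ord0 i)].
Proof.
move=> mF.
rewrite (_ : mkset _ = \bigcap_(i in [set: 'I_n]) (fun x : 'rV[R]_n => x ord0 i) @^-1` F i).
  apply: fin_bigcap_measurable => [|i _]; first exact: finite_finset.
  by have := @measurable_coord_rV R n i measurableT _ (mF i); rewrite setTI.
by apply/seteqP; split=> [x H i _ | x H i]; exact: H.
Qed.

(** The sigma-algebra is generated by coordinates, so the open set is written as the countable union
    of those boxes with rational centre and radius 1/(k+1) that it contains. *)
Lemma open_measurable_rV {n} (A : set 'rV[R]_n) : open A -> measurable A.
Proof.
move=> oA.
pose box (q : 'rV[rat]_n * nat) : set 'rV[R]_n :=
  [set x | forall i, ball (ratr (q.1 ord0 i) : R) (q.2.+1%:R^-1) (x ord0 i)].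
have mbox q : measurable (box q).
  apply: (@measurable_rV_box n (fun i => ball (ratr (q.1 ord0 i) : R) (q.2.+1%:R^-1))) => i.
  by apply: measurable_realfun.open_measurable; apply: ball_open; rewrite invr_gt0.
rewrite (_ : A = \bigcup_(q : 'rV[rat]_n * nat) (if `[< box q `<=` A >] then box q else set0)).
  apply: countable_bigcupT_measurable => [|q]; last by case: ifP => _.
  exact: countableP.
apply/seteqP; split=> [x Ax|x [q _]]; last by case: ifP => // /asboolP; exact.
have /nbhs_ballP[e /= e0 xA] := open_nbhs_nbhs (conj oA Ax).
(* Any two points of a box of radius 1/(k+1) are then less than e apart. *)
have [k ke] : exists k, k.+1%:R^-1 < e / 2 :> R.
  have e20 : 0 < e / 2 by rewrite divr_gt0.
  by have [k _ Hk] := near_infty_natSinv_lt (PosNum e20); exists k; exact: (Hk k (leqnn k)).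
have H i : exists q : rat, ball (ratr q : R) (k.+1%:R^-1) (x ord0 i).
  have k0 : 0 < k.+1%:R^-1 :> R by rewrite invr_gt0.
  have xk : x ord0 i < x ord0 i + k.+1%:R^-1 by rewrite ltrDl.
  have [q] := rat_in_itvoo xk.
  rewrite in_itv /= => /andP[q1 q2]; exists q.
  by rewrite -ball_normE /= ltr_distlC; apply/andP; split; move: q1 q2 k0;
     set d := _^-1; set a := x ord0 i; move=> *; lra.
have [q Hq] := choice H.
exists (\row_i q i, k) => //.
case: ifPn => [_|/asboolPn bA]; first by move=> i /=; rewrite mxE.
exfalso; apply: bA => y Hy; apply: xA; split=> // i j.
rewrite (ord1 i); have := Hy j; have := Hq j.
rewrite /= mxE -!ball_normE /= => h1 h2.
rewrite (le_lt_trans (ler_distD (ratr (q j)) _ _))//.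
by rewrite (splitr e) ltrD // (lt_trans _ ke)// distrC.
Qed.

Lemma continuous_measurable_rV {n} (f : 'rV[R]_n -> R) : continuous f ->
  measurable_fun setT f.
Proof.
move=> /continuousP cf; apply: (measurability _ (RGenOpens.measurableE R)).
move=> _ [_ [a [b ->] <-]]; rewrite setTI; apply: open_measurable_rV.
exact/cf/interval_open.
Qed.

Lemma lebesgue_measure_translation (c : R) (A : set (measurableTypeR R)) : measurable A ->
  leb ((fun x => x + c) @^-1` A) = leb A.
Proof.
move=> mA.
have mf : measurable_fun setT ((fun x => x + c) : measurableTypeR R -> measurableTypeR R).
  by apply: measurable_funD => //; exact: measurable_cst.
pose f : {mfun measurableTypeR R >-> measurableTypeR R} :=
  HB.pack ((fun x => x + c) : measurableTypeR R -> measurableTypeR R)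
    (isMeasurableFun.Build _ _ _ _ _ mf).
apply: esym; apply: (@lebesgue_measure_unique R (pushforward leb f)) => // _ [[a b] _ <-].
transitivity (leb `]a - c, b - c]%classic); last first.
  by congr (leb _); apply/seteqP; split=> x /=; rewrite !in_itv /= ltrBlDr lerBrDr.
rewrite !lebesgue_measure_itv /= !lte_fin ltrD2r; case: ifP => // _.
by rewrite -!EFinD; congr (_%:E); lra.
Qed.

Lemma lebesgue_measure_rVS {n} (B : set 'rV[R]_n.+1) : measurable B ->
  lebesgue_measure_rV R n.+1 B =
  (\int[leb]_a lebesgue_measure_rV R n [set v | B (cons_rV (a, v))])%E.
Proof.
move=> mB; rewrite /= /lebesgue_measure_step /pushforward /product_measure1.
apply: eq_integral => a _ /=; congr (lebesgue_measure_rV R n _).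
by apply/seteqP; split=> v /=; rewrite /xsection /= inE.
Qed.

Lemma measurable_lebesgue_slice {n} (B : set 'rV[R]_n.+1) : measurable B ->
  measurable_fun [set: measurableTypeR R]
    (fun a => lebesgue_measure_rV R n [set v | B (cons_rV (a, v))]).
Proof.
move=> mB; rewrite (_ : (fun _ => _) =
   lebesgue_measure_rV R n \o xsection (@cons_rV R n @^-1` B)).
  apply: measurable_fun_xsection; rewrite -[X in measurable X]setTI.
  exact: measurable_cons_rV.
apply/funext => a /=; congr (lebesgue_measure_rV R n _).
by apply/seteqP; split=> v /=; rewrite /xsection /= inE.
Qed.

Lemma cons_rVK {n} (x : 'rV[R]_n.+1) :
  cons_rV (x ord0 ord0, rsubmx (x : 'rV[R]_(1 + n))) = x.
Proof.
apply/rowP => i; rewrite /cons_rV /=.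
case: (split_ordP (i : 'I_(1 + n))) => k ->.
  rewrite [LHS](row_mxEl (const_mx _ : 'rV[R]_1) _) mxE (ord1 k).
  by congr (x _ _); exact: val_inj.
by rewrite [LHS](row_mxEr (const_mx _ : 'rV[R]_1) _) mxE.
Qed.

Lemma cons_rV0 {n} (a : R) (v : 'rV[R]_n) : cons_rV (a, v) ord0 ord0 = a.
Proof.
rewrite /cons_rV /= (_ : ord0 = lshift n ord0 :> 'I_(1 + n)); last exact: val_inj.
by rewrite [LHS](row_mxEl (const_mx a : 'rV[R]_1) v) mxE.
Qed.

Lemma cons_rVS {n} (a : R) (v : 'rV[R]_n) (i : 'I_n) :
  cons_rV (a, v) ord0 (rshift 1 i : 'I_(1 + n)) = v ord0 i.
Proof. exact: (row_mxEr (const_mx a : 'rV[R]_1) v). Qed.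

(** Unipotent triangular maps: coordinate i is shifted by a function of the earlier coordinates
    alone. *)
Definition shear {n} (T : 'rV[R]_n -> 'rV[R]_n) :=
  forall (i : 'I_n) (x x' : 'rV[R]_n), (forall j : 'I_n, (j < i)%N -> x ord0 j = x' ord0 j) ->
    T x ord0 i - x ord0 i = T x' ord0 i - x' ord0 i.

(** Induction on the dimension by slicing along the first coordinate. That coordinate has no
    predecessor, so it is translated by a constant c; on each slice the other coordinates undergo a
    shear again. Invariance follows from the slice formula and translation invariance on the line,
    for shears that are merely measurable. *)
Lemma measure_shear {n} (T : 'rV[R]_n -> 'rV[R]_n) (A : set 'rV[R]_n) :
  measurable_fun setT T -> shear T -> measurable A ->
  lebesgue_measure_rV R n (T @^-1` A) = lebesgue_measure_rV R n A.
Proof.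
elim: n T A => [|n IH] T A mT sT mA.
  by congr (lebesgue_measure_rV R 0 _); apply/seteqP; split=> x /=; rewrite !thinmx0.
have mTA : measurable (T @^-1` A) by rewrite -[X in measurable X]setTI; exact: mT.
rewrite !lebesgue_measure_rVS//.
pose G a := lebesgue_measure_rV R n [set v | A (cons_rV (a, v))].
have mG : measurable_fun setT G by exact: measurable_lebesgue_slice.
pose c := T 0 ord0 ord0.
have mc : measurable_fun setT ((fun x => x + c) : measurableTypeR R -> measurableTypeR R).
  by apply: measurable_funD => //; exact: measurable_cst.
transitivity (\int[leb]_a G (a + c)%R)%E.
  apply: eq_integral => a _; rewrite /G.
  (* The tail of T over the first coordinate a; it carries the slice at a into the slice at a +
     c. *)
  pose T' v := rsubmx (T (cons_rV (a, v)) : 'rV[R]_(1 + n)).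
  rewrite -[RHS](IH T').
  - congr (lebesgue_measure_rV R n _); apply/seteqP.
    have E v : T (cons_rV (a, v)) = cons_rV (a + c, T' v).
      rewrite -[LHS]cons_rVK; congr (cons_rV (_, _)).
      have := sT ord0 (cons_rV (a, v)) 0; rewrite cons_rV0 mxE subr0 -/c => <-//.
      by rewrite addrC subrK.
    by split=> v /=; rewrite E.
  - apply: measurable_fun_rV => i.
    rewrite (_ : (fun _ => _) = (fun x : 'rV[R]_n.+1 => x ord0 (rshift 1 i : 'I_(1 + n))) \o
       (T \o (@cons_rV R n \o pair a))); last by apply/funext => v; rewrite /= mxE.
    apply: measurableT_comp; first exact: measurable_coord_rV.
    apply: measurableT_comp => //.
    by apply: measurableT_comp; [exact: measurable_cons_rV|exact: measurable_pair1].
  - move=> i v v' vv'; rewrite !mxE.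
    have := sT (rshift 1 i : 'I_(1 + n)) (cons_rV (a, v)) (cons_rV (a, v')).
    rewrite !cons_rVS; apply=> j.
    case: (split_ordP (j : 'I_(1 + n))) => k ->.
      by rewrite (ord1 k) (_ : lshift n ord0 = ord0)//; [rewrite !cons_rV0|exact: val_inj].
    by rewrite /= ltn_add2l => ki; rewrite !cons_rVS; exact: vv'.
  - rewrite -[X in measurable X]setTI.
    rewrite (_ : [set v | _] = (@cons_rV R n \o pair (a + c)) @^-1` A)//.
    by apply: measurableT_comp; [exact: measurable_cons_rV|exact: measurable_pair1|..].
pose f : {mfun measurableTypeR R >-> measurableTypeR R} :=
  HB.pack ((fun x => x + c) : measurableTypeR R -> measurableTypeR R)
    (isMeasurableFun.Build _ _ _ _ _ mc).
transitivity (\int[pushforward leb f]_a G a)%E.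
  by rewrite ge0_integral_pushforward.
apply: eq_measure_integral => B mB _.
exact: lebesgue_measure_translation.
Qed.

Lemma lebesgue_measure_cube {n} (a b : R) : a <= b ->
  lebesgue_measure_rV R n [set x | forall i, x ord0 i \in `[a, b]] = ((b - a) ^+ n)%:E.
Proof.
move=> ab; elim: n => [|n IH].
  rewrite /= diracE expr0 mem_set// => i; by case: i.
have mB m : measurable [set x : 'rV[R]_m | forall i, x ord0 i \in `[a, b]].
  apply: (@measurable_rV_box m (fun i => `[a, b]%classic)) => i.
  exact: measurable_itv.
rewrite lebesgue_measure_rVS//.
transitivity (\int[leb]_x (((b - a) ^+ n)%:E * (\1_`[a, b]%classic x)%:E))%E.
  apply: eq_integral => x _; rewrite indicE.
  case: (boolP (x \in `[a, b]%classic)) => xab.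
    rewrite mule1 -IH; congr (lebesgue_measure_rV R n _).
    apply/seteqP; split=> v /= H i.
      by have := H (rshift 1 i : 'I_(1 + n)); rewrite cons_rVS.
    case: (split_ordP (i : 'I_(1 + n))) => k ->; last by rewrite cons_rVS.
    rewrite (ord1 k) (_ : lshift n ord0 = ord0); last exact: val_inj.
    by rewrite cons_rV0; move: xab; rewrite inE.
  rewrite mule0 (_ : [set v | _] = set0) ?measure0//.
  apply/seteqP; split=> v //= H.
  move/negP: xab; apply; rewrite inE /=.
  by have := H ord0; rewrite cons_rV0.
rewrite ge0_integralZl//.
- rewrite integral_indic// setIT [X in (_ * X)%E](@lebesgue_measure_itv R `[a, b]) /= lte_fin.
  case: ifPn => [_|]; first by rewrite -EFinD -EFinM -exprSr.
  rewrite -leNgt => ba; have -> : b = a by apply/eqP; rewrite eq_le ab ba.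
  by rewrite mule0 subrr expr0n.
- by apply/measurable_EFinP; exact: measurable_indic.
- by rewrite lee_fin exprn_ge0// subr_ge0.
Qed.

Lemma lebesgue_measure_bounded {n} (A : set 'rV[R]_n) M : measurable A ->
  (forall x, A x -> `|x| <= M) -> (lebesgue_measure_rV R n A < +oo)%E.
Proof.
move=> mA HA; have [->|/set0P[x0 Ax0]] := eqVneq A set0; first by rewrite measure0.
have M0 : - M <= M by have := le_trans (normr_ge0 _) (HA _ Ax0); lra.
apply: (@le_lt_trans _ _ (lebesgue_measure_rV R n [set x | forall i, x ord0 i \in `[(- M), M]])).
  apply: le_measure; rewrite ?inE//.
    by apply: (@measurable_rV_box n (fun i => `[- M, M]%classic)) => i; exact: measurable_itv.
  move=> x Ax i /=; rewrite in_itv /= -ler_norml.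
  exact: le_trans (norm_coord_le _ _) (HA _ Ax).
by rewrite lebesgue_measure_cube// ltry.
Qed.

End rV_measure.

(** * Integrals depending on a parameter *)

Section parametric.
Context {R : realType}.

Lemma is_derive_line_at {V W : normedModType R} (f : V -> W) v x (h : R) l :
  is_derive (h *: v + x) v f l ->
  is_derive h 1 (fun s => f (s *: v + x)) l.
Proof.
move=> /is_derive_line H; apply/is_derive_line.
rewrite (_ : (fun _ => _) = (fun s => f (s *: v + (h *: v + x))))//.
by apply/funext => s; rewrite [_%:A]mulr1 scalerDl addrA.
Qed.

(** Dominated convergence speaks of sequences, so continuity in a parameter is tested on sequences.
    If it failed, a bad point could be chosen within 1/(n+1) of x for every n. *)
Lemma continuous_seq {V : normedModType R} (g : V -> R) x :
  (forall u : nat -> V, (forall n, `|x - u n| < n.+1%:R^-1) ->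
     g (u n) @[n --> \oo] --> g x) ->
  {for x, continuous g}.
Proof.
move=> H; apply: contrapT => nc.
have [e e0 He] : exists2 e, 0 < e & forall d, 0 < d -> exists y, `|x - y| < d /\ e <= `|g x - g y|.
  apply: contrapT => nH; apply: nc; apply/cvgrPdist_lt => e e0.
  apply: contrapT => nN; apply: nH; exists e => // d d0.
  apply: contrapT => nE; apply: nN; apply/nbhs_ballP; exists d => //= y.
  rewrite -ball_normE /= => xy; rewrite ltNge; apply/negP => ge.
  by apply: nE; exists y.
have d0 n : 0 < n.+1%:R^-1 :> R by rewrite invr_gt0.
have [u Hu] := choice (fun n => He _ (d0 n)).
have /cvgrPdist_lt/(_ e e0) := H u (fun n => (Hu n).1).
move=> [N _ /(_ N (leqnn N))] /=.
by rewrite ltNge (Hu N).2.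
Qed.

Lemma bounded_on_ball {n} (g : 'rV[R]_n -> R) M : continuous g ->
  exists2 B, 0 <= B & forall x, `|x| <= M -> `|g x| <= B.
Proof.
move=> cg.
have cK : compact [set x : 'rV[R]_n | `|x| <= M].
  apply: bounded_closed_compact.
    by exists M; split=> [|y My x /= xM]; [exact: num_real|exact: le_trans xM (ltW My)].
  rewrite (_ : mkset _ = (fun x : 'rV[R]_n => `|x|) @^-1` [set t | t <= M])//.
  apply: closed_comp; last exact: closed_le.
  by move=> x _; exact: norm_continuous.
have cg' : {within [set x : 'rV[R]_n | `|x| <= M], continuous g}.
  exact: continuous_subspaceT.
have [B [_ HB]] := compact_bounded (continuous_compact cg' cK).
exists (`|B| + 1) => [|x xM]; first by rewrite addr_ge0.
have := HB (`|B| + 1); rewrite (le_lt_trans (ler_norm B)) ?ltrDl// => /(_ isT).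
by apply; exists x.
Qed.

Lemma Rintegral_dominated_cvg d (T : measurableType d) (mu : {measure set T -> \bar R})
    (D : set T) (fn : nat -> T -> R) (f g : T -> R) :
  measurable D ->
  (forall n, measurable_fun D (fn n)) -> measurable_fun D f ->
  {ae mu, forall x, D x -> fn n x @[n --> \oo] --> f x} ->
  mu.-integrable D (EFin \o g) ->
  {ae mu, forall x n, D x -> `|fn n x| <= g x} ->
  mu.-integrable D (EFin \o f) /\
  (\int[mu]_(x in D) fn n x) @[n --> \oo] --> \int[mu]_(x in D) f x.
Proof.
move=> mD mfn mf cf ig fg.
have [||||if_ _ cvgf] := @dominated_convergence _ _ _ mu D mD
    (fun n => EFin \o fn n) (EFin \o f) (EFin \o g) _ _ _ ig.
- by move=> n; exact/measurable_EFinP.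
- exact/measurable_EFinP.
- apply: filterS cf => x H Dx; apply: cvg_EFin; [exact: nearW|exact: H].
- by apply: filterS fg => x H n Dx /=; rewrite lee_fin; exact: H.
split=> //; apply: fine_cvg; rewrite fineK; first exact: cvgf.
exact: integrable_fin_num.
Qed.

Lemma is_derive_Rintegral d (Y : measurableType d) (mu : {measure set Y -> \bar R})
    (F dF : R -> Y -> R) (g : Y -> R) :
  (forall t, mu.-integrable setT (EFin \o F t)) ->
  (forall t y, is_derive t (1 : R) (F ^~ y) (dF t y)) ->
  (forall y, 0 <= g y) -> mu.-integrable setT (EFin \o g) ->
  (forall t y, `|t| <= 1 -> `|dF t y| <= g y) ->
  is_derive (0 : R) 1 (fun t => \int[mu]_y F t y) (\int[mu]_y dF 0 y).
Proof.
move=> IF DF g0 Ig gub.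
have E t y : partial1of2 F t y = dF t y by rewrite partial1of2E; case: (DF t y).
have I0 : `]-1, 1[%classic (0 : R) by rewrite /= in_itv /= ltrN10 ltr01.
have D t y : derivable (F ^~ y) t 1 by case: (DF t y).
have Gub t y : `]-1, 1[%classic t -> setT y -> `|partial1of2 F t y| <= g y.
  rewrite /= in_itv /= => /andP[h1 h2] _; rewrite E; apply: gub.
  by rewrite ler_norml !ltW.
apply: DeriveDef.
  exact: (@derivable_under_integral _ _ _ mu F setT measurableT 0 _ _ I0
    (fun h _ => IF h) (fun h z _ _ => D h z) _ g0 Ig Gub).
rewrite -derive1E (@differentiation_under_integral _ _ _ mu F setT measurableT 0 _ _ I0
    (fun h _ => IF h) (fun h z _ _ => D h z) _ g0 Ig Gub).
by apply: eq_Rintegral => z _; rewrite E.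
Qed.

Lemma integrable_bounded_support {n} (f : 'rV[R]_n -> R) M : continuous f ->
  (forall x, M < `|x| -> f x = 0) ->
  (lebesgue_measure_rV R n).-integrable setT (EFin \o f).
Proof.
move=> cf f0; have [B B0 HB] := bounded_on_ball f M cf.
have mB : measurable [set x : 'rV[R]_n | `|x| <= M].
  rewrite -[X in measurable X]setCK; apply: measurableC; apply: open_measurable_rV.
  rewrite (_ : ~` _ = (fun x : 'rV[R]_n => `|x|) @^-1` [set t | M < t]).
    apply: open_comp; last exact: open_gt.
    by move=> x _; exact: norm_continuous.
  by apply/seteqP; split=> x /=; rewrite ltNge; move/negP.
have mf : measurable_fun setT f by exact: continuous_measurable_rV.
apply: (@le_integrable _ _ _ _ _ measurableT _
   (fun x => (B * \1_[set x : 'rV[R]_n | `|x| <= M] x)%:E)).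
- exact/measurable_EFinP.
- move=> x _ /=; rewrite lee_fin indicE; case: (boolP (x \in _)) => [|]; rewrite ?mulr1 ?mulr0.
    by rewrite inE /= (ger0_norm B0); exact: HB.
  by rewrite notin_setE /= => /negP; rewrite -ltNge => /f0 ->; rewrite normr0.
- rewrite (_ : (fun _ => _) = (fun x => B%:E * (\1_[set x : 'rV[R]_n | `|x| <= M] x)%:E)%E)//.
  apply: integrableZl => //; apply/integrableP; split.
    by apply/measurable_EFinP; exact: measurable_indic.
  under eq_integral do rewrite gee0_abs ?lee_fin//.
  by rewrite integral_indic// setIT; apply: (lebesgue_measure_bounded _ M).
Qed.

Lemma norm_row_mx_le {l m} (x : 'rV[R]_l) (z : 'rV[R]_m) r :
  `|x| <= r -> `|z| <= r -> `|row_mx x z| <= r.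
Proof.
move=> xr zr; apply: norm_rV_le; first exact: le_trans xr.
move=> i; case: (split_ordP i) => j ->; rewrite ?row_mxEl ?row_mxEr.
  exact: le_trans (norm_coord_le _ _) xr.
exact: le_trans (norm_coord_le _ _) zr.
Qed.

Lemma continuous_row_mxr {l m} (x : 'rV[R]_l) :
  continuous (fun z : 'rV[R]_m => row_mx x z).
Proof.
move=> z; apply/(@cvg_rVP _ _ _ (nbhs z)) => i; case: (split_ordP i) => j ->.
  under eq_fun do rewrite row_mxEl.
  by rewrite row_mxEl; exact: cst_continuous.
under eq_fun do rewrite row_mxEr.
by rewrite row_mxEr; exact: coord_continuous.
Qed.

Section fixed_weight.
Context {l m : nat} (f : 'rV[R]_m -> R) (M : R).
Hypotheses (cf : continuous f) (f0 : forall z, M < `|z| -> f z = 0).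
Local Notation mu := (lebesgue_measure_rV R m).

Lemma continuous_kernel (K : 'rV[R]_(l + m) -> R) x : continuous K ->
  continuous (fun z => K (row_mx x z) * f z).
Proof.
move=> cK z; apply: continuous_at_mul; last exact: cf.
apply: (@continuous_comp _ _ _ (row_mx x) K); last exact: cK.
exact: continuous_row_mxr.
Qed.

Lemma integrable_kernel (K : 'rV[R]_(l + m) -> R) x : continuous K ->
  mu.-integrable setT (EFin \o (fun z => K (row_mx x z) * f z)).
Proof.
move=> cK; apply: (integrable_bounded_support _ M); first exact: continuous_kernel.
by move=> z /f0 ->; rewrite mulr0.
Qed.

(** The weight f confines z to a ball, so K is only evaluated on a bounded set as long as x stays
    within distance 1 of x0. The result is one majorant B |f| for all those x, as dominated
    convergence and differentiation under the integral demand. *)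
Lemma kernel_bound (K : 'rV[R]_(l + m) -> R) x0 : continuous K ->
  exists2 B, 0 <= B & forall x z, `|x - x0| <= 1 -> `|K (row_mx x z) * f z| <= B * `|f z|.
Proof.
move=> cK; have [B B0 HB] := bounded_on_ball K (Num.max (`|x0| + 1) M) cK.
exists B => // x z xx0; rewrite normrM.
have [zM|/f0 ->] := leP `|z| M; last by rewrite normr0 !mulr0.
apply: ler_wpM2r => //; apply: HB; apply: norm_row_mx_le; rewrite le_max.
  apply/orP; left; rewrite -lerBlDl; apply: le_trans xx0.
  exact: lerB_dist.
by rewrite zM orbT.
Qed.

Lemma integrable_weight B : mu.-integrable setT (EFin \o (fun z => B * `|f z|)).
Proof.
apply: (integrable_bounded_support (fun z => B * `|f z|) M); last first.
  by move=> z /f0 ->; rewrite normr0 mulr0.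
have cn : continuous (fun z => `|f z|).
  by move=> z; apply: (@continuous_comp _ _ _ f (fun t : R => `|t|));
     [exact: cf|exact: norm_continuous].
move=> z.
exact: (continuous_at_mul (fun=> B) (fun z => `|f z|) z (@cst_continuous _ _ B z) (cn z)).
Qed.

Lemma continuous_param_integral (K : 'rV[R]_(l + m) -> R) : continuous K ->
  continuous (fun x => \int[mu]_z (K (row_mx x z) * f z)).
Proof.
move=> cK x; apply: continuous_seq => u ux.
have [B B0 HB] := kernel_bound K x cK.
have [|||||_ H] := @Rintegral_dominated_cvg _ _ mu setT
  (fun n z => K (row_mx (u n) z) * f z) (fun z => K (row_mx x z) * f z)
  (fun z => B * `|f z|) measurableT.
- by move=> n; apply: continuous_measurable_rV; exact: continuous_kernel.
- by apply: continuous_measurable_rV; exact: continuous_kernel.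
- apply: aeW => z _; apply: cvgMr_tmp.
  apply: (@cvg_comp _ _ _ (fun n => row_mx (u n) z) K); last exact: cK.
  apply/cvg_rVP => i; case: (split_ordP i) => j ->.
    under eq_fun do rewrite row_mxEl.
    rewrite row_mxEl.
    suff : u n @[n --> \oo] --> x by move/cvg_rVP; exact.
    apply/cvgrPdist_lt => e e0.
    have [N _ HN] := near_infty_natSinv_lt (PosNum e0).
    by exists N => // n Nn /=; apply: lt_trans (ux n) (HN _ Nn).
  under eq_fun do rewrite row_mxEr.
  by rewrite row_mxEr; exact: cvg_cst.
- exact: integrable_weight.
- apply: aeW => z n _; apply: HB; rewrite distrC (le_trans (ltW (ux n)))//.
  by rewrite invf_le1// ler1n.
exact: H.
Qed.

Lemma is_derive_param_integral (K : 'rV[R]_(l + m) -> R) i x :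
  continuous K -> (forall x, derivable K x (evec R (lshift m i))) ->
  continuous (fun x => 'D_(evec R (lshift m i)) K x) ->
  is_derive x (evec R i) (fun x => \int[mu]_z (K (row_mx x z) * f z))
    (\int[mu]_z ('D_(evec R (lshift m i)) K (row_mx x z) * f z)).
Proof.
move=> cK dK cdK; apply/is_derive_line.
have [B B0 HB] := kernel_bound (fun x => 'D_(evec R (lshift m i)) K x) x cdK.
have row_line (h : R) z : row_mx (h *: evec R i + x) z = h *: evec R (lshift m i) + row_mx x z.
  apply/rowP => j; case: (split_ordP j) => k ->.
    rewrite row_mxEl [LHS]mxE [RHS]mxE row_mxEl; congr (_ + _).
    by rewrite !mxE (inj_eq (@lshift_inj _ _)).
  by rewrite row_mxEr [RHS]mxE row_mxEr !mxE eq_rlshift andbF mulr0 add0r.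
have dKh (h : R) z : is_derive h 1 (fun h => K (row_mx (h *: evec R i + x) z) * f z)
    ('D_(evec R (lshift m i)) K (row_mx (h *: evec R i + x) z) * f z).
  have D : is_derive h 1 (fun h => K (row_mx (h *: evec R i + x) z))
    ('D_(evec R (lshift m i)) K (row_mx (h *: evec R i + x) z)).
    rewrite (_ : (fun _ => _) = (fun h => K (h *: evec R (lshift m i) + row_mx x z))).
      by apply: is_derive_line_at; rewrite row_line; exact: derivableP.
    by apply/funext => s; rewrite row_line.
  by apply: is_derive_eq; rewrite scaler0 add0r mulrC.
pose F (h : R) z := K (row_mx (h *: evec R i + x) z) * f z.
have IF h : mu.-integrable setT (EFin \o F h) by exact: integrable_kernel.
have IG : mu.-integrable setT (EFin \o (fun z => B * `|f z|)).
  exact: integrable_weight.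
have G0 z : 0 <= B * `|f z| by rewrite mulr_ge0.
rewrite (_ : (fun z => _) =
   (fun z => 'D_(evec R (lshift m i)) K (row_mx (0 *: evec R i + x) z) * f z)).
  apply: (@is_derive_Rintegral _ _ _ F _ (fun z => B * `|f z|)) => // h z h1.
  apply: HB; rewrite addrK normrZ; apply: (@le_trans _ _ (1 * 1)); last by rewrite mulr1.
  apply: ler_pM => //; apply: norm_rV_le => // j; rewrite mxE eqxx /=.
  by case: eqP => _; rewrite ?normr1 ?normr0.
by apply/funext => z; rewrite scale0r add0r.
Qed.

(** A derivative in x falls on the kernel and leaves an integral of the same form with a partial
    derivative of K, so the induction on k runs over all kernels with f fixed. *)
Lemma Ck_param_integral k (K : 'rV[R]_(l + m) -> R) : Ck k setT K ->
  Ck k setT (fun x => \int[mu]_z (K (row_mx x z) * f z)).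
Proof.
elim: k K => [|k IH] K CK.
  by split=> // x _; apply: continuous_param_integral; exact: (Ck_continuous _ _ CK).
refine (@CkSP _ _ _ _ (fun i x =>
  \int[mu]_z ('D_(evec R (lshift m i)) K (row_mx x z) * f z)) _ _ _).
- by apply: continuous_param_integral; exact: (Ck_continuous _ _ CK).
- move=> i x; apply: is_derive_param_integral.
  + exact: (Ck_continuous _ _ CK).
  + by move=> y; exact: (Ck_derivable _ _ _ _ CK).
  + exact: (Ck_continuous _ _ (Ck_derive _ _ _ CK)).
- move=> i; apply: (IH (fun y => 'D_(evec R (lshift m i)) K y)).
  exact: (Ck_derive _ _ _ CK).
Qed.

End fixed_weight.
End parametric.

(** * Smooth bump functions *)

Section bump.
Context {R : realType}.

(** Every monomial satisfies s^i <= i! e^s, a single term of the exponential series; this is the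
    origin of the factorials in the constant. *)
Lemma horner_mul_expRN_bounded (P : {poly R}) :
  exists2 C, 0 <= C & forall s, 0 < s -> `|P.[s]| * expR (- s) <= C.
Proof.
exists (\sum_(i < size P) `|P`_i| * i`!%:R) => [|s s0].
  by apply: sumr_ge0 => i _; rewrite mulr_ge0.
rewrite horner_coef expRN ler_pdivrMr ?expR_gt0// mulr_suml.
apply: le_trans (ler_norm_sum _ _ _) _; apply: ler_sum => i _.
rewrite normrM -mulrA ler_wpM2l// normrX (ger0_norm (ltW s0)) mulrC.
rewrite -ler_pdivrMr ?ltr0n ?fact_gt0//.
case: (nat_of_ord i) => [|k]; first by rewrite expr0 fact0 divr1 -expR0 ler_expR ltW.
by apply: le_trans (expR_ge1Dxn k (ltW s0)); rewrite lerDr.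
Qed.

(** The classical flat function is the case P = 1. The polynomial factor makes the family closed
    under differentiation. *)
Definition flat_exp (P : {poly R}) (t : R) : R :=
  if 0 < t then P.[t^-1] * expR (- t^-1) else 0.

(** Meant for the point 0 where two one-sided formulas meet, for [flat_exp], [pos_powR] and [ramp]:
    the difference quotient is at most w(h), which tends to 0. *)
Lemma is_derive_small (f w : R -> R) x :
  (forall h, `|f (x + h) - f x| <= `|h| * w h) -> w h @[h --> nbhs (0 : R)] --> (0 : R) ->
  is_derive x 1 f 0.
Proof.
move=> H w0.
have L : h^-1 *: (f (h *: 1 + x) - f x) @[h --> 0^'] --> (0 : R).
  apply/cvgrPdist_lt => e e0; near=> h.
  have h0 : h != 0 by near: h; exact: nbhs_dnbhs_neq.
  rewrite sub0r normrN normrZ normfV [_%:A]mulr1 (addrC h x) ltr_pdivrMl ?normr_gt0//.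
  apply: le_lt_trans (H h) _; rewrite ltr_pM2l ?normr_gt0// (le_lt_trans (ler_norm _))//.
  near: h; apply: (@nbhs_dnbhs _ (0 : R)).
  by have /cvgrPdist_lt/(_ e e0) := w0; apply: filterS => h; rewrite sub0r normrN.
apply: DeriveDef; first by apply/cvg_ex; exists 0.
exact/cvg_lim.
Unshelve. all: by end_near. Qed.

Lemma is_derive_quadratic (f : R -> R) x C :
  (forall h, `|f (x + h) - f x| <= C * h ^+ 2) -> is_derive x 1 f 0.
Proof.
move=> H; apply: (@is_derive_small _ (fun h => C * `|h|)) => [h|].
  by apply: le_trans (H h) _; rewrite -real_normK ?num_real// expr2 mulrCA.
rewrite -[X in _ --> X](mulr0 C); apply: cvgMl_tmp.
by rewrite -[X in _ --> X](@normr0 _ R); exact: norm_continuous.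
Qed.

Lemma is_derive_flat_exp (P : {poly R}) (t : R) :
  is_derive t 1 (flat_exp P) (flat_exp ('X^2 * (P - P^`())) t).
Proof.
have [t0|t0|->] := ltgtP t 0.
- rewrite {2}/flat_exp ltNge (ltW t0) /=.
  apply: (@near_eq_is_derive _ _ _ (cst 0)).
  near=> s; rewrite /flat_exp /= ifF//; apply/negbTE; rewrite -leNgt ltW//.
  by near: s; exact: lt_nbhsl.
- rewrite {2}/flat_exp t0.
  suff H : is_derive t 1 (fun s => P.[s^-1] * expR (- s^-1))
      (('X^2 * (P - P^`())).[t^-1] * expR (- t^-1)).
    apply: near_eq_is_derive H.
    near=> s; rewrite /flat_exp /= ifT//.
    by near: s; exact: lt_nbhsr.
  have tn0 : t != 0 by rewrite gt_eqF.
  have D1 : is_derive t 1 (fun s : R => s^-1) (- t^-2 *: 1).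
    by apply: (@is_deriveV _ id) => //; exact: is_derive_id.
  have D2 : is_derive t 1 (fun s : R => P.[s^-1]) ((P^`()).[t^-1] * (- t^-2 *: 1)).
    by apply: (@is_derive1_comp _ (horner P) (fun s => s^-1)).
  have D3 : is_derive t 1 (fun s : R => expR (- s^-1)) (expR (- t^-1) * - (- t^-2 *: 1)).
    apply: (@is_derive1_comp _ expR (fun s => - s^-1)).
  apply: is_derive_eq.
  rewrite /GRing.scale /= !hornerE -!exprVn; set a := t^-1.
  change ((P.[a] * expR (- a)) * (- - a ^+ 2) + (expR (- a) * P^`().[a]) * (- a ^+ 2) =
    a ^+ 2 * (P.[a] - P^`().[a]) * expR (- a)).
  ring.
- rewrite {2}/flat_exp ltxx.
  (* The bound for X^2 P at s = 1/h reads |P(1/h)| e^(-1/h) <= C h^2, so the derivative at 0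
     vanishes. *)
  have [C C0 HC] := horner_mul_expRN_bounded ('X^2 * P).
  apply: (@is_derive_quadratic _ _ C) => h; rewrite /flat_exp add0r ltxx subr0.
  case: ifPn => h0; last by rewrite normr0 mulr_ge0// sqr_ge0.
  have := HC h^-1; rewrite invr_gt0 => /(_ h0).
  rewrite hornerM hornerXn normrM normrX normfV (gtr0_norm h0) exprVn.
  rewrite normrM [`|expR _|]ger0_norm ?expR_ge0// -mulrA.
  by rewrite ler_pdivrMl ?exprn_gt0// (mulrC C).
Unshelve. all: by end_near. Qed.

Lemma smooth_flat_exp {m} (phi : 'rV[R]_m -> R) : (forall k, Ck k setT phi) ->
  forall k, Ck k setT (fun x => flat_exp 1 (phi x)).
Proof.
move=> Cp k.
pose D (P : {poly R}) := 'X^2 * (P - P^`()).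
suff H : forall j, Ck k setT (fun x => flat_exp (iter j D 1) (phi x)) by exact: (H 0%N).
apply: (@Ck_comp1 R m k (fun j => flat_exp (iter j D 1)) phi).
  by move=> j x; exact: is_derive_flat_exp.
exact: Cp.
Qed.

(** Built on the squared Euclidean norm, which is a polynomial, while the norm of row vectors is a
    sup norm. It is not normalised; [mollify] divides by its integral. *)
Definition smooth_bump {m} (r : R) (x : 'rV[R]_m) : R :=
  flat_exp 1 (r ^+ 2 - \sum_i x ord0 i ^+ 2).

Lemma bump_smooth {m} r k : Ck k setT (@smooth_bump m r).
Proof.
apply: smooth_flat_exp => {}k; apply: Ck_add; first exact: Ck_cst.
rewrite (_ : (fun _ => _) = (fun x : 'rV[R]_m => (-1) * \sum_i x ord0 i * x ord0 i)).
  apply: Ck_mul; first exact: Ck_cst.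
  by apply: Ck_sum => i; apply: Ck_mul; exact: Ck_coord.
by apply/funext => x; rewrite mulN1r; congr (- _); apply: eq_bigr => i _; rewrite expr2.
Qed.

Lemma bump_ge0 {m} r (x : 'rV[R]_m) : 0 <= smooth_bump r x.
Proof. by rewrite /smooth_bump /flat_exp; case: ifP => // _; rewrite hornerE mul1r expR_ge0. Qed.

Lemma bump_support {m} r (x : 'rV[R]_m) : 0 < r -> smooth_bump r x != 0 -> `|x| < r.
Proof.
move=> r0; rewrite /smooth_bump /flat_exp; case: ifPn => [|_]; last by rewrite eqxx.
rewrite subr_gt0 => H _.
suff : `|x| <= Num.sqrt (\sum_i x ord0 i ^+ 2).
  move=> /le_lt_trans; apply; rewrite -(ger0_norm (ltW r0)) -sqrtr_sqr.
  by rewrite ltr_sqrt ?exprn_gt0.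
apply: norm_rV_le => [|i]; first exact: sqrtr_ge0.
rewrite -sqrtr_sqr; apply: ler_wsqrtr.
by rewrite (bigD1 i)//= lerDl; apply: sumr_ge0 => j _; exact: sqr_ge0.
Qed.

Lemma bump_integral_gt0 {m} r : 0 < r ->
  0 < \int[lebesgue_measure_rV R m]_x smooth_bump r x.
Proof.
move=> r0; have cb := Ck_continuous _ _ (@bump_smooth m r 0).
have ib : (lebesgue_measure_rV R m).-integrable setT (EFin \o smooth_bump r).
  apply: (integrable_bounded_support _ r) => // x rx.
  apply/eqP; apply: contraTT rx => /(bump_support _ _ r0).
  by rewrite -leNgt => /ltW.
rewrite lt_neqAle Rintegral_ge0 ?andbT; last by move=> x _; exact: bump_ge0.
apply/eqP => E.
have E0 : (\int[lebesgue_measure_rV R m]_x `|(smooth_bump r x)%:E| = 0)%E.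
  under eq_integral do rewrite gee0_abs ?lee_fin ?bump_ge0//.
  by rewrite -[LHS]fineK; [rewrite -[RHS]/(0%:E) E|exact: integrable_fin_num].
have mb : measurable_fun setT (smooth_bump r : 'rV[R]_m -> R) by exact: continuous_measurable_rV.
have /ae_eq_integral_abs := E0; move=> /(_ measurableT).
case; first exact/measurable_EFinP.
move=> N [mN N0 HN].
(* The cube [0, d]^m lies inside the open Euclidean ball of radius r because m < (m+1)^2. The bump
   is positive on this cube, so the cube would be a null set, yet its measure is d^m > 0. *)
pose d := r / m.+1%:R.
have d0 : 0 < d by rewrite divr_gt0.
have /negP := gt_eqF (exprn_gt0 m d0); apply.
rewrite -[d]subr0 -eqe -lebesgue_measure_cube ?ltW// eq_le measure_ge0 andbT.
apply: (@le_trans _ _ (lebesgue_measure_rV R m N)); last by rewrite N0.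
apply: le_measure; rewrite ?inE//.
  by apply: (@measurable_rV_box _ m (fun i => `[0, d]%classic)) => i; exact: measurable_itv.
move=> x /= Hx; apply: HN => /= /(_ I) [].
apply/eqP; rewrite /smooth_bump /flat_exp ifT ?hornerE ?mul1r ?gt_eqF ?expR_gt0// subr_gt0.
apply: (@le_lt_trans _ _ (\sum_(i < m) d ^+ 2)).
  apply: ler_sum => i _; have := Hx i; rewrite in_itv /= => /andP[x0 xd].
  by rewrite ler_pXn2r ?nnegrE// ltW.
rewrite sumr_const card_ord -[_ *+ m]mulr_natl /d expr_div_n mulrCA.
rewrite gtr_pMr ?exprn_gt0// ltr_pdivrMr ?exprn_gt0// mul1r -natrX ltr_nat.
by rewrite expnS expn1 (leq_trans (ltnSn m))// leq_pmulr.
Qed.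

End bump.

(** * The group law in coordinates *)

Lemma reshape_index_mono (s : seq nat) i j : (i <= j)%N ->
  (reshape_index s i <= reshape_index s j)%N.
Proof.
rewrite /reshape_index; elim: s i j => [|a s IH] i j ij //=.
rewrite !subn_eq0; case: (ltnP i a) => // ai.
rewrite (ltnNge j a) (leq_trans ai ij) /= ltnS !subSn ?(leq_trans ai ij)//.
by apply: IH; exact: leq_sub2r.
Qed.

Lemma cvg0_harmonic_bound {R : realType} (f : nat -> R) (B : R) :
  (forall k, `|f k| <= k.+1%:R^-1 * B) -> f k @[k --> \oo] --> (0 : R).
Proof.
move=> H; have h : (k.+1%:R^-1 : R) * B @[k --> \oo] --> (0 : R).
  by rewrite -[X in _ --> X](mul0r B); apply: cvgMr_tmp; exact: cvg_harmonic.
apply: norm_cvg0; apply: (squeeze_cvgr _ (cvg_cst _) h).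
by near=> k; rewrite normr_ge0 H.
Unshelve. all: by end_near. Qed.

Lemma Rintegral_measure_preserving d (X : measurableType d) (R : realType)
    (mu : {measure set X -> \bar R}) (phi : X -> X) (f : X -> R) :
  measurable_fun setT phi ->
  (forall A, measurable A -> mu (phi @^-1` A) = mu A) ->
  mu.-integrable setT (EFin \o f) ->
  \int[mu]_x f (phi x) = \int[mu]_x f x.
Proof.
move=> mphi mp intf.
pose T : {mfun X >-> X} := HB.pack phi (isMeasurableFun.Build _ _ _ _ _ mphi).
have Em A : measurable A -> A `<=` setT -> mu A = pushforward mu T A.
  by move=> mA _; rewrite /pushforward mp.
have /integrableP[mf fi] := intf.
have intfT : mu.-integrable setT ((EFin \o f) \o T).
  apply/integrableP; split; first exact: measurableT_comp.
  apply: le_lt_trans fi; rewrite [leRHS](@eq_measure_integral _ _ _ setT (pushforward mu T))//.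
  by rewrite [leRHS]ge0_integral_pushforward//; exact: measurableT_comp.
rewrite /Rintegral; congr fine.
by rewrite [RHS](@eq_measure_integral _ _ _ setT (pushforward mu T))// [RHS]integral_pushforward.
Qed.

Section group_structure.
Context {R : realType} {n : nat} (G : stratified_group R n).
Local Notation V := 'rV[R]_n.+1.
Local Notation op := (sg_op G).
Local Notation mu := (lebesgue_measure_rV R n.+1).

Definition op_coord (i : 'I_n.+1) (z : 'rV[R]_(n.+1 + n.+1)) : R :=
  op (lsubmx z) (rsubmx z) ord0 i.

Lemma op_coord_smooth i k : Ck k setT (op_coord i).
Proof. exact: sg_op_smooth. Qed.

Lemma op_coordE i x y : op_coord i (row_mx x y) = op x y ord0 i.
Proof. by rewrite /op_coord row_mxKl row_mxKr. Qed.

Lemma Ck_row_mx {l m1 m2} k (phi : 'rV[R]_l -> 'rV[R]_m1) (psi : 'rV[R]_l -> 'rV[R]_m2) :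
  (forall i, Ck k setT (fun x => phi x ord0 i)) ->
  (forall i, Ck k setT (fun x => psi x ord0 i)) ->
  forall i, Ck k setT (fun x => row_mx (phi x) (psi x) ord0 i).
Proof.
move=> Cphi Cpsi i; case: (split_ordP i) => j ->.
  by under eq_fun do rewrite row_mxEl; exact: Cphi.
by under eq_fun do rewrite row_mxEr; exact: Cpsi.
Qed.

Lemma Ck_op {l} k (phi psi : 'rV[R]_l -> V) :
  (forall i, Ck k setT (fun x => phi x ord0 i)) ->
  (forall i, Ck k setT (fun x => psi x ord0 i)) ->
  forall i, Ck k setT (fun x => op (phi x) (psi x) ord0 i).
Proof.
move=> Cphi Cpsi i.
rewrite (_ : (fun _ => _) = op_coord i \o (fun x => row_mx (phi x) (psi x))).
  by apply: Ck_comp; [exact: op_coord_smooth|exact: Ck_row_mx].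
by apply/funext => x; rewrite /= op_coordE.
Qed.

Lemma Ck_rV_continuous {l m} (phi : 'rV[R]_l -> 'rV[R]_m) :
  (forall i, Ck 0 setT (fun x => phi x ord0 i)) -> continuous phi.
Proof.
move=> C x; apply/(@cvg_rVP _ _ _ (nbhs x)) => i.
exact: (Ck_continuous _ _ (C i)).
Qed.

Lemma op_continuousl y : continuous (fun x => op x y).
Proof.
apply: Ck_rV_continuous; apply: Ck_op => i; [exact: Ck_coord|exact: Ck_cst].
Qed.

Local Notation deg i := (reshape_index (sg_strata G) (nat_of_ord (i : 'I_n.+1))).+1.

Lemma op_coord_dilation lam i (z : 'rV[R]_(n.+1 + n.+1)) : 0 < lam ->
  op_coord i (row_mx (dilation (sg_strata G) lam (lsubmx z))
                     (dilation (sg_strata G) lam (rsubmx z))) =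
  lam ^+ deg i * op_coord i z.
Proof. by move=> l0; rewrite op_coordE -sg_dilation// mxE. Qed.

Local Notation dilate2 lam z := (row_mx (dilation (sg_strata G) lam (lsubmx z))
                     (dilation (sg_strata G) lam (rsubmx z))).

(** Derivative of the homogeneity relation [op_coord_dilation] along coordinate j of the left
    factor; the chain rule contributes lam^(deg j). *)
Lemma derive_op_coord_dilation lam i j (z : 'rV[R]_(n.+1 + n.+1)) : 0 < lam ->
  lam ^+ deg j * 'D_(evec R (lshift n.+1 j)) (op_coord i) (dilate2 lam z) =
  lam ^+ deg i * 'D_(evec R (lshift n.+1 j)) (op_coord i) z.
Proof.
move=> l0; set e := evec R _.
have D y : is_derive y e (op_coord i) ('D_e (op_coord i) y).
  by apply: derivableP; exact: (Ck_derivable _ _ _ _ (op_coord_smooth i 1)).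
have /is_derive_line D1 := D z.
have D2 : is_derive (0 : R) 1 (fun t => lam ^+ deg i * op_coord i (t *: e + z))
    (lam ^+ deg i * 'D_e (op_coord i) z).
  exact: (@is_deriveZ _ _ _ _ (lam ^+ deg i)).
have D3 : is_derive (0 : R) 1 (fun t => op_coord i ((lam ^+ deg j * t) *: e + dilate2 lam z))
    ('D_e (op_coord i) (dilate2 lam z) * lam ^+ deg j).
  have H : is_derive (lam ^+ deg j * 0) 1 (fun t => op_coord i (t *: e + dilate2 lam z))
     ('D_e (op_coord i) (dilate2 lam z)).
    by apply: is_derive_line_at; rewrite mulr0 scale0r add0r.
  apply: (@is_derive1_comp _ (fun t => op_coord i (t *: e + dilate2 lam z))
     (fun t => lam ^+ deg j * t)).
  by apply: is_derive_eq; rewrite ?scaler0 ?addr0 [_ *: 1]mulr1.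
have E : (fun t => op_coord i ((lam ^+ deg j * t) *: e + dilate2 lam z)) =
         (fun t => lam ^+ deg i * op_coord i (t *: e + z)).
  apply/funext => t; rewrite -op_coord_dilation//; congr op_coord.
  apply/rowP => k; case: (split_ordP k) => {}k ->.
    rewrite mxE !row_mxEl !mxE eqxx /= (inj_eq (@lshift_inj _ _)) mulrDr; congr (_ + _).
    by have [->|] := eqVneq k j; rewrite ?mulr1 ?mulr0 ?mulr0.
  by rewrite mxE !row_mxEr !mxE eqxx /= eq_rlshift !mulr0 !add0r.
rewrite E in D3.
by rewrite mulrC -(@derive_val _ _ _ _ _ _ _ D3) (@derive_val _ _ _ _ _ _ _ D2).
Qed.

(* Homogeneity makes the derivative at z equal to lam^(deg j - deg i) times its
   value at the dilated point, which tends to 0 with lam. *)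
Lemma derive_op_coordl (i j : 'I_n.+1) z : (i <= j)%N ->
  'D_(evec R (lshift n.+1 j)) (op_coord i) z = (i == j)%:R.
Proof.
move=> ij; set e := evec R _.
have dij : (deg i <= deg j)%N by rewrite ltnS reshape_index_mono.
pose D := fun z => 'D_e (op_coord i) z.
have cD : continuous D by exact: (Ck_continuous _ _ (Ck_derive _ _ _ (op_coord_smooth i 1))).
have E lam y : 0 < lam -> D y = lam ^+ (deg j - deg i) * D (dilate2 lam y).
  move=> l0; have := derive_op_coord_dilation lam i j y l0.
  rewrite -{1}(subnK dij) exprD -mulrA mulrCA => /mulfI -> //.
  by rewrite expf_neq0// gt_eqF.
have cvg0 y : dilate2 (k.+1%:R^-1 : R) y @[k --> \oo] --> (0 : 'rV[R]_(n.+1 + n.+1)).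
  apply/cvg_rVP => k; rewrite mxE; apply: (@cvg0_harmonic_bound _ _ `|y|) => p.
  have l1 : p.+1%:R^-1 <= 1 :> R by rewrite invf_le1// ler1n.
  case: (split_ordP k) => {}k ->.
    rewrite row_mxEl !mxE exprS -mulrA normrM ger0_norm// ler_wpM2l// normrM.
    apply: (@le_trans _ _ (1 * `|y ord0 (lshift n.+1 k)|)).
      by rewrite ler_wpM2r// ger0_norm ?exprn_ge0// exprn_ile1.
    by rewrite mul1r norm_coord_le.
  rewrite row_mxEr !mxE exprS -mulrA normrM ger0_norm// ler_wpM2l// normrM.
  apply: (@le_trans _ _ (1 * `|y ord0 (rshift n.+1 k)|)).
    by rewrite ler_wpM2r// ger0_norm ?exprn_ge0// exprn_ile1.
  by rewrite mul1r norm_coord_le.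
have H y : D y = 0 ^+ (deg j - deg i) * D 0.
  have H1 : D (dilate2 (k.+1%:R^-1 : R) y) @[k --> \oo] --> D 0.
    by apply: (@cvg_comp _ _ _ _ D); [exact: cvg0|exact: cD].
  have H2 : (k.+1%:R^-1 : R) ^+ (deg j - deg i) @[k --> \oo] --> (0 : R) ^+ (deg j - deg i).
    apply: (@cvg_comp _ _ _ (fun k : nat => k.+1%:R^-1) (fun t => t ^+ (deg j - deg i))).
      exact: cvg_harmonic.
    exact: exprn_continuous.
  have H3 : (fun k : nat => D y) @ \oo --> 0 ^+ (deg j - deg i) * D 0.
    rewrite (_ : (fun _ => D y) =
      (fun k : nat => k.+1%:R^-1 ^+ (deg j - deg i) * D (dilate2 (k.+1%:R^-1 : R) y))).
      exact: cvgM.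
    by apply/funext => k; apply: E.
  rewrite -(cvg_lim (@Rhausdorff R) H3).
  by apply/esym/cvg_lim => //; exact: cvg_cst.
rewrite -/(D z) H.
(* If deg i < deg j the power of 0 vanishes, and i = j is impossible. If the degrees agree, 0^0 = 1
   and the derivative is everywhere its value at the origin, which is computed from x o 0 = x. *)
have [ltd|] := ltnP (deg i) (deg j).
  rewrite expr0n subn_eq0 leqNgt ltd mul0r; have [eij|//] := eqVneq i j.
  by rewrite eij ltnn in ltd.
move=> led; rewrite (_ : (_ - _)%N = 0%N); last by apply/eqP; rewrite subn_eq0.
rewrite expr0 mul1r; apply: derive_val.
apply/is_derive_line; rewrite (_ : (fun _ => _) = (fun h => h * (i == j)%:R)).
  by apply: is_derive_eq; rewrite ?scaler0 ?add0r [_ *: 1]mulr1.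
apply/funext => h; rewrite addr0.
rewrite (_ : h *: e = row_mx (h *: evec R j) 0); last first.
  apply/rowP => k; case: (split_ordP k) => {}k ->.
    by rewrite row_mxEl !mxE eqxx /= (inj_eq (@lshift_inj _ _)).
  by rewrite row_mxEr !mxE eqxx /= eq_rlshift mulr0.
by rewrite op_coordE sg_opx0 !mxE eqxx.
Qed.

(** The function g(w) = (w o y)_i - w_i has zero partial derivatives in all coordinates from i on,
    by [derive_op_coordl]. Passing from x to x' one coordinate at a time, the coordinates before i
    do not move and the later ones leave g unchanged. *)
Lemma op_triangular (i : 'I_n.+1) (x x' y : V) :
  (forall j : 'I_n.+1, (j < i)%N -> x ord0 j = x' ord0 j) ->
  op x y ord0 i - x ord0 i = op x' y ord0 i - x' ord0 i.
Proof.
move=> xx'.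
pose g (w : V) := op w y ord0 i - w ord0 i.
have dg (j : 'I_n.+1) (w : V) : (i <= j)%N -> is_derive w (evec R j) g 0.
  move=> ij; rewrite /g.
  have D1 : is_derive w (evec R j) (fun w => op w y ord0 i) (i == j)%:R.
    apply/is_derive_line; rewrite -(derive_op_coordl i j (row_mx w y) ij).
    have : is_derive (row_mx w y) (evec R (lshift n.+1 j)) (op_coord i)
       ('D_(evec R (lshift n.+1 j)) (op_coord i) (row_mx w y)).
      by apply: derivableP; exact: (Ck_derivable _ _ _ _ (op_coord_smooth i 1)).
    move=> /is_derive_line; congr (is_derive _ _ _ _); apply/funext => h.
    rewrite -op_coordE; congr op_coord.
    apply/rowP => k; case: (split_ordP k) => {}k ->.
      by rewrite mxE !row_mxEl !mxE eqxx /= (inj_eq (@lshift_inj _ _)).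
    by rewrite mxE !row_mxEr !mxE eqxx /= eq_rlshift mulr0 add0r.
  have D2 := is_derive_coord i w (evec R j).
  rewrite mxE eqxx /= in D2.
  by have := is_deriveB D1 D2; rewrite subrr.
have step k : (k <= n.+1)%N -> g (x + truncv k (x' - x)) = g x.
  elim: k => [_|k IH kn].
    by congr g; apply/rowP => j; rewrite !mxE addr0.
  rewrite -IH ?(ltnW kn)// (truncvS _ (Ordinal kn)) addrA.
  set w := x + _; have [ki|ik] := ltnP k i.
    by rewrite !mxE xx'// subrr scale0r addr0.
  have dgk (w' : V) : derivable g w' (evec R (Ordinal kn)).
    by case: (dg (Ordinal kn) w' ik).
  have [s _ E] := MVT_coord g (Ordinal kn) dgk w ((x' - x) ord0 (Ordinal kn)).
  apply/eqP; rewrite -subr_eq0 E.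
  by rewrite (@derive_val _ _ _ _ _ _ _ (dg (Ordinal kn) _ ik)) mulr0.
have := step _ (leqnn _); rewrite (_ : x + _ = x'); first exact: esym.
by apply/rowP => j; rewrite !mxE ltn_ord addrC subrK.
Qed.

Lemma measurable_op_coordl y : measurable_fun setT (fun x => op x y).
Proof.
apply: measurable_fun_rV => i; apply: continuous_measurable_rV.
by move=> x; have /(@cvg_rVP _ _ _ (nbhs x)) := op_continuousl y x; exact.
Qed.

Lemma measure_op_right y (A : set V) : measurable A ->
  mu ((fun x => op x y) @^-1` A) = mu A.
Proof.
move=> mA; apply: measure_shear => //; first exact: measurable_op_coordl.
by move=> i x x'; exact: op_triangular.
Qed.

Lemma Rintegral_op_right y (f : V -> R) : mu.-integrable setT (EFin \o f) ->
  \int[mu]_x f (op x y) = \int[mu]_x f x.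
Proof.
apply: (@Rintegral_measure_preserving _ _ _ mu (fun x => op x y)).
  exact: measurable_op_coordl.
exact: measure_op_right.
Qed.

End group_structure.

(** * Left invariant fields and their integral curves *)

Section lie_derivatives.
Context {R : realType} {n : nat} (G : stratified_group R n).
Local Notation V := 'rV[R]_n.+1.
Local Notation op := (sg_op G).
Local Notation X k := (left_invariant_field (sg_op G) k).

Lemma is_derive_op_curve x (c : R -> V) (t : R) dc i : is_derive t 1 c dc ->
  is_derive t 1 (fun s => op x (c s) ord0 i)
    (\sum_j (row_mx (0 : V) dc) ord0 j * 'D_(evec R j) (op_coord G i) (row_mx x (c t))).
Proof.
move=> dct.
have D : is_derive t 1 (fun s => row_mx x (c s)) (row_mx (0 : V) dc).
  apply/is_derive_rVP => j; case: (split_ordP j) => k ->.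
    rewrite (_ : (fun _ => _) = cst (x ord0 k)); last by apply/funext => s; rewrite row_mxEl.
    by rewrite row_mxEl mxE; exact: is_derive_cst.
  rewrite (_ : (fun _ => _) = (fun s => c s ord0 k)); last by apply/funext => s; rewrite row_mxEr.
  by rewrite row_mxEr; move: k; apply/is_derive_rVP.
have C1 := op_coord_smooth G i 1.
have := is_derive_comp_curve (op_coord G i) _ t _
  (fun j y => Ck_derivable _ _ j y C1) (fun j => Ck_continuous _ _ (Ck_derive _ _ j C1)) D.
by congr (is_derive _ _ _ _); apply/funext => s; rewrite /= op_coordE.
Qed.

Lemma is_derive_left_field k z :
  is_derive (0 : R) 1 (fun s => op z (s *: evec R k)) (X k z).
Proof.
have dop : derivable (op z) 0 (evec R k).
  apply/derivable_mxP => i j; rewrite (ord1 i).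
  have C1 : Ck 1 setT (fun y => op z y ord0 j).
    by apply: Ck_op => l; [exact: Ck_cst|exact: Ck_coord].
  exact: (Ck_derivable _ _ _ _ C1).
have /is_derive_line := derivableP dop.
by congr (is_derive _ _ _ _); apply/funext => s; rewrite addr0.
Qed.

(** Along s e_k the i-th coordinates of x o (s e_k) and x' o (s e_k) differ by a constant, by
    [op_triangular], so their derivatives at s = 0 agree. *)
Lemma left_field_triangular k (i : 'I_n.+1) (x x' : V) :
  (forall j : 'I_n.+1, (j < i)%N -> x ord0 j = x' ord0 j) ->
  X k x ord0 i = X k x' ord0 i.
Proof.
move=> xx'.
have /is_derive_rVP/(_ i) D := is_derive_left_field k x.
have /is_derive_rVP/(_ i) D' := is_derive_left_field k x'.
have E : (fun s => op x (s *: evec R k) ord0 i) =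
   (fun s => op x' (s *: evec R k) ord0 i + cst (x ord0 i - x' ord0 i) s).
  apply/funext => s; have := op_triangular G i x x' (s *: evec R k) xx'.
  by rewrite /=; lra.
rewrite E in D; rewrite -(@derive_val _ _ _ _ _ _ _ D).
have D2 := is_deriveD D' (is_derive_cst (x ord0 i - x' ord0 i) (0:R) 1).
by rewrite (@derive_val _ _ _ _ _ _ _ D2) addr0.
Qed.

(** Left invariance of the field: the sum is the differential of left translation by x, applied to
    the field at z. It comes from differentiating the associativity law (x o z) o (s e_k) = x o (z o
    (s e_k)). *)
Lemma left_field_op k x z i : X k (op x z) ord0 i =
  \sum_j (row_mx (0 : V) (X k z)) ord0 j * 'D_(evec R j) (op_coord G i) (row_mx x z).
Proof.
have /is_derive_rVP/(_ i) D := is_derive_left_field k (op x z).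
have := is_derive_op_curve x _ 0 _ i (is_derive_left_field k z).
rewrite scale0r sg_opx0 => D2.
rewrite -(@derive_val _ _ _ _ _ _ _ D) -(@derive_val _ _ _ _ _ _ _ D2).
by congr ('D__ _ _); apply/funext => s; rewrite sg_opA.
Qed.

Lemma integral_curve_op k x (c : R -> V) : integral_curve (X k) c ->
  integral_curve (X k) (fun t => op x (c t)).
Proof.
move=> cI t; apply/is_derive_rVP => i; rewrite left_field_op.
by apply: is_derive_op_curve; exact: cI.
Qed.

Lemma integral_curve_shift k (c : R -> V) s : integral_curve (X k) c ->
  integral_curve (X k) (fun t => c (t + s)).
Proof.
move=> cI t; apply/is_derive_rVP => i.
have /is_derive_rVP/(_ i) D := cI (t + s).
have D1 : is_derive t 1 (fun t : R => t + s) 1.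
  by apply: is_derive_eq; rewrite addr0.
have := @is_derive1_comp _ (fun t => c t ord0 i) (fun t => t + s) t _ _ D D1.
by rewrite mulr1.
Qed.

(* The i-th component of the field depends only on the coordinates before i, so
   the coordinates of an integral curve are determined one after the other. *)
Lemma integral_curve_unique k (c c' : R -> V) :
  integral_curve (X k) c -> integral_curve (X k) c' -> c 0 = c' 0 -> c = c'.
Proof.
move=> cI cI' c0.
suff H m (i : 'I_n.+1) : (i < m)%N -> forall t, c t ord0 i = c' t ord0 i.
  by apply/funext => t; apply/rowP => i; exact: (H n.+1).
elim: m i => // m IH i im t.
have D s : is_derive s (1 : R) (fun s => c s ord0 i - c' s ord0 i) 0.
  have /is_derive_rVP/(_ i) D1 := cI s.
  have /is_derive_rVP/(_ i) D2 := cI' s.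
  have := is_deriveB D1 D2.
  rewrite (left_field_triangular k i (c s) (c' s)) ?subrr// => j ji.
  by apply: IH; rewrite (leq_trans ji).
have := is_derive_0_is_cst t 0 D.
by rewrite c0 subrr => /eqP; rewrite subr_eq0 => /eqP.
Qed.

Section along_curve.
Context (k : 'I_n.+1) (gam : R -> V).
Hypotheses (gamI : integral_curve (X k) gam) (gam0 : gam 0 = 0).

(** By uniqueness the only integral curve starting at x is the left translate of [gam]. The
    existential over curves thus becomes an ordinary derivative along an explicit curve. *)
Lemma is_lie_deriveP f x l :
  is_lie_derive (X k) f x l <-> is_derive (0 : R) 1 (fun t => f (op x (gam t))) l.
Proof.
have I := integral_curve_op k x gam gamI.
split=> [[c [cI c0 D]]|D]; last by exists (fun t => op x (gam t)); rewrite gam0 sg_opx0.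
have E : c = (fun t => op x (gam t)).
  by apply: (integral_curve_unique k); rewrite // gam0 sg_opx0.
by rewrite E in D.
Qed.

Lemma lie_deriveE f x l : is_lie_derive (X k) f x l -> lie_derive (X k) f x = l.
Proof.
move=> H; rewrite /lie_derive; case: xgetP => [l' _ /= H'|/(_ l)//].
have /is_lie_deriveP D := H; have /is_lie_deriveP D' := H'.
by rewrite -(@derive_val _ _ _ _ _ _ _ D) -(@derive_val _ _ _ _ _ _ _ D').
Qed.

(** The integral curve from [op x (gam t)] is the same curve with time shifted by t, so the
    derivative at time t is the Lie derivative at that point. *)
Lemma is_derive_along f x (t : R) : (forall y, exists l, is_lie_derive (X k) f y l) ->
  is_derive t 1 (fun s => f (op x (gam s))) (lie_derive (X k) f (op x (gam t))).
Proof.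
move=> Hf; have [l Hl] := Hf (op x (gam t)).
rewrite (lie_deriveE _ _ _ Hl).
have [c [cI c0 D]] := Hl.
have E : c = (fun s => op x (gam (s + t))).
  apply: (integral_curve_unique k) => //; last by rewrite add0r.
  exact: (integral_curve_shift k (fun s => op x (gam s)) t (integral_curve_op k x gam gamI)).
rewrite E in D.
have D1 : is_derive t 1 (fun s : R => s - t) 1.
  by apply: is_derive_eq; rewrite subr0.
have D2 : is_derive (t - t) 1 (fun s => f (op x (gam (s + t)))) l by rewrite subrr.
have := @is_derive1_comp _ (fun s => f (op x (gam (s + t)))) (fun s => s - t) t _ _ D2 D1.
by rewrite mulr1; congr (is_derive _ _ _ _); apply/funext => s /=; rewrite subrK.
Qed.

End along_curve.
End lie_derivatives.

(** * Mollification *)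

Section mollification.
Context {R : realType} {n : nat} (G : stratified_group R n).
Local Notation V := 'rV[R]_n.+1.
Local Notation op := (sg_op G).
Local Notation inv := (sg_inv G).
Local Notation mu := (lebesgue_measure_rV R n.+1).
Local Notation N1 := (head 0%N (sg_strata G)).
Context (gam : 'I_N1 -> R -> V).
Hypotheses (gamI : forall k, integral_curve (@hfield R n G k) (gam k))
           (gam0 : forall k, gam k 0 = 0).

Lemma compact_bound {m} (K : set 'rV[R]_m) : compact K ->
  exists2 M, 0 <= M & forall x, K x -> `|x| <= M.
Proof.
move=> /compact_bounded[M [_ H]]; exists (`|M| + 1) => [|x Kx]; first by rewrite addr_ge0.
by apply: H Kx; rewrite (le_lt_trans (ler_norm M))// ltrDl.
Qed.

Lemma compact_bounded_fun {m} (K : set 'rV[R]_m) (f : 'rV[R]_m -> R) : compact K ->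
  continuous f -> (forall x, ~ K x -> f x = 0) ->
  exists2 B, 0 <= B & forall x, `|f x| <= B.
Proof.
move=> cK cf f0; have [M M0 HM] := compact_bound K cK.
have [B B0 HB] := bounded_on_ball f M cf; exists B => // x.
by have [Kx|/f0 ->] := pselect (K x); [exact/HB/HM|rewrite normr0].
Qed.

(** Global form of [C1c], free of Omega: regularity holds on the whole space, as needed for averages
    over translates that may leave Omega. *)
Definition horizontal_C1c (K : set V) (f : V -> R) : Prop :=
  [/\ compact K, continuous f,
      forall k x, exists l, is_lie_derive (@hfield R n G k) f x l,
      forall k, continuous (lie_derive (@hfield R n G k) f)
    & forall x, ~ K x -> f x = 0 /\ forall k, lie_derive (@hfield R n G k) f x = 0].

Lemma open_setC_compact {m} (K : set 'rV[R]_m) x : compact K -> ~ K x -> \forall y \near x, ~ K y.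
Proof.
move=> cK Kx; apply: (@open_nbhs_nbhs _ x (~` K)); split=> //.
by apply: closed_openC; apply: compact_closed => //; exact: norm_hausdorff.
Qed.

(** Off K the function vanishes on a neighbourhood because K is closed. An integral curve starting
    there remains off K for small times, so all Lie derivatives are 0 and nothing is lost across the
    boundary of Omega. *)
Lemma C1c_horizontal Omega f : C1c G Omega f ->
  exists2 K, K `<=` Omega & horizontal_C1c K f.
Proof.
case=> [[K [cK KO f0]] cf lf clf]; exists K => //.
have Z k x : ~ K x -> is_lie_derive (@hfield R n G k) f x 0.
  move=> Kx; apply/(is_lie_deriveP G (inord k) (gam k) (gamI k) (gam0 k)).
  apply: (@near_eq_is_derive _ _ _ (cst 0)).
  have cg : {for 0, continuous (fun t => op x (gam k t))}.
    apply: (@differentiable_continuous _ _ _ (0 : R)); apply/derivable1_diffP.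
    by case: (integral_curve_op G _ x _ (gamI k) 0).
  have H0 : \forall t \near (0 : R), ~ K (op x (gam k t)).
    have Hn : \forall y \near op x (gam k 0), ~ K y.
      by rewrite gam0 sg_opx0; exact: open_setC_compact.
    exact: (cg [set y | ~ K y] Hn).
  by apply: (filterS _ H0) => t /= /f0 ->.
have Z' k x : ~ K x -> lie_derive (@hfield R n G k) f x = 0.
  by move=> /(Z k); exact: (lie_deriveE G (inord k) (gam k) (gamI k) (gam0 k)).
have near0 (g : V -> R) x : (forall y, ~ K y -> g y = 0) -> ~ K x -> {for x, continuous g}.
  move=> g0 Kx; change (g y @[y --> x] --> g x); rewrite (g0 x Kx).
  have : \forall y \near x, cst 0 y = g y.
    by apply: (filterS _ (open_setC_compact K x cK Kx)) => y /g0 ->.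
  by move=> /near_eq_cvg/cvg_trans; apply; exact: cvg_cst.
split=> //.
- by move=> x; have [/KO/cf//|] := pselect (K x); exact: near0.
- by move=> k x; have [/KO/(lf k)//|/(Z k)] := pselect (K x); exists 0.
- move=> k x; have [/KO|] := pselect (K x); last by apply: near0 => y; exact: Z'.
  move=> /(clf k); rewrite (_ : (fun y => hgrad G f y ord0 k) = lie_derive (@hfield R n G k) f)//.
  by apply/funext => y; rewrite mxE.
- by move=> x Kx; split=> [|k]; [exact: f0|exact: Z'].
Qed.

Definition mollify (r : R) (f : V -> R) (x : V) : R :=
  (\int[mu]_y smooth_bump r y)^-1 * \int[mu]_y (smooth_bump r y * f (op y x)).

Lemma continuous_bump {m} r : continuous (@smooth_bump R m r).
Proof. exact: (Ck_continuous _ _ (bump_smooth r 0)). Qed.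

Lemma bump_eq0 {m} r (x : 'rV[R]_m) : 0 < r -> r < `|x| -> smooth_bump r x = 0.
Proof.
move=> r0 rx; apply/eqP; apply: contraTT rx => /(bump_support _ _ r0).
by rewrite -leNgt => /ltW.
Qed.

Lemma continuous_bump_mul r (f : V -> R) x : continuous f ->
  continuous (fun y => smooth_bump r y * f (op y x)).
Proof.
move=> cf y; apply: (continuous_at_mul (smooth_bump r) (fun y => f (op y x))).
  exact: continuous_bump.
apply: (@continuous_comp _ _ _ (fun y => op y x) f); last exact: cf.
exact: op_continuousl.
Qed.

Lemma integrable_bump_mul r (f : V -> R) x : 0 < r -> continuous f ->
  mu.-integrable setT (EFin \o (fun y => smooth_bump r y * f (op y x))).
Proof.
move=> r0 cf; apply: (integrable_bounded_support _ r); first exact: continuous_bump_mul.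
by move=> y ry; rewrite bump_eq0// mul0r.
Qed.

Lemma integrable_bump r : 0 < r -> mu.-integrable setT (EFin \o smooth_bump r).
Proof.
by move=> r0; apply: (integrable_bounded_support _ r) => [|y ry];
  [exact: continuous_bump|exact: bump_eq0].
Qed.

(** The weights have total mass one, so a bound on the support of the bump passes to the average.
    With a = 0 it gives the uniform bound, with a = f x the convergence. *)
Lemma mollify_close r (f : V -> R) x (a e : R) : 0 < r -> continuous f ->
  (forall y, `|y| < r -> `|f (op y x) - a| <= e) -> `|mollify r f x - a| <= e.
Proof.
move=> r0 cf H.
have I0 := @bump_integral_gt0 R n.+1 r r0; set I := \int[mu]_y smooth_bump r y in I0 *.
have -> : mollify r f x - a = I^-1 * \int[mu]_y (smooth_bump r y * (f (op y x) - a)).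
  rewrite /mollify -/I (_ : (fun y => smooth_bump r y * (f (op y x) - a)) =
     (fun y => smooth_bump r y * f (op y x) - a * smooth_bump r y)); last first.
    by apply/funext => y; rewrite mulrBr (mulrC a).
  rewrite RintegralB//; [|exact: integrable_bump_mul|]; last first.
    rewrite /comp; under eq_fun do rewrite EFinM.
    by apply: integrableZl => //; exact: integrable_bump.
  rewrite RintegralZl//; last exact: integrable_bump.
  by rewrite -/I mulrBr (mulrC a) mulKf// gt_eqF.
rewrite normrM normfV (gtr0_norm I0) ler_pdivrMl//.
have cfa : continuous (fun z => f z - a).
  by move=> z; apply: (continuous_at_add f (fun=> - a)); [exact: cf|exact: cst_continuous].
have intfa := integrable_bump_mul r (fun z => f z - a) x r0 cfa.
apply: le_trans (le_normr_Rintegral _ intfa) _ => //.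
rewrite /I mulrC -RintegralZl//; last exact: integrable_bump.
apply: le_Rintegral => //.
- rewrite (_ : EFin \o _ = abse \o (EFin \o (fun y => smooth_bump r y * (f (op y x) - a))))//.
  exact: (@integrable_abse _ _ _ mu).
- rewrite /comp; under eq_fun do rewrite EFinM.
  by apply: integrableZl => //; exact: integrable_bump.
- move=> y _; rewrite normrM ger0_norm ?bump_ge0//.
  have [->|b0] := eqVneq (smooth_bump r y) 0; first by rewrite mul0r mulr0.
  by rewrite mulrC ler_wpM2r ?bump_ge0//; apply: H; exact: bump_support.
Qed.

Lemma mollify_bound r (f : V -> R) x B : 0 < r -> continuous f ->
  (forall y, `|f y| <= B) -> `|mollify r f x| <= B.
Proof.
move=> r0 cf H; rewrite -[mollify _ _ _]subr0; apply: mollify_close => // y _.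
by rewrite subr0.
Qed.

Lemma mollify_cvg (f : V -> R) x : continuous f ->
  mollify (k.+1%:R^-1 : R) f x @[k --> \oo] --> f x.
Proof.
move=> cf; apply/cvgrPdist_le => e e0.
have cfx : {for 0, continuous (fun y => f (op y x))}.
  apply: (@continuous_comp _ _ _ (fun y => op y x) f); last exact: cf.
  exact: op_continuousl.
have /cvgrPdist_le/(_ e e0) := cfx; rewrite sg_op0x => /nbhs_ballP[d /= d0 Hd].
have [N _ HN] := near_infty_natSinv_lt (PosNum d0).
exists N => // k Nk /=; rewrite distrC; apply: mollify_close => // y yk.
rewrite distrC; apply: Hd; rewrite -ball_normE /= sub0r normrN.
by apply: lt_trans yk (HN _ Nk).
Qed.

(* Substituting z = y o x turns the average into an integral against the smooth
   kernel (x, z) |-> smooth_bump r (z o x^-1), with f no longer moving. *)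
Lemma mollify_smooth r K f : 0 < r -> compact K -> continuous f ->
  (forall x, ~ K x -> f x = 0) -> smooth_on setT (mollify r f).
Proof.
move=> r0 cK cf f0 k; have [M M0 HM] := compact_bound K cK.
pose Kr (w : 'rV[R]_(n.+1 + n.+1)) := smooth_bump r (op (rsubmx w) (inv (lsubmx w))).
have cKr j : Ck j setT Kr.
  apply: (@Ck_comp _ _ _ j (smooth_bump r) (fun w => op (rsubmx w) (inv (lsubmx w)))).
    exact: bump_smooth.
  apply: Ck_op => i.
    by under eq_fun do rewrite mxE; exact: Ck_coord.
  apply: (@Ck_comp _ _ _ j (fun x => inv x ord0 i) (fun w => lsubmx w)).
    exact: sg_inv_smooth.
  by move=> {}i; under eq_fun do rewrite mxE; exact: Ck_coord.
apply: Ck_mul; first exact: Ck_cst.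
have f0' z : M < `|z| -> f z = 0.
  by move=> Mz; apply: f0 => /HM; rewrite leNgt Mz.
have := Ck_param_integral f M cf f0' k Kr (cKr k).
congr Ck; apply/funext => x.
rewrite -(Rintegral_op_right G x (fun z => Kr (row_mx x z) * f z)).
  apply: eq_Rintegral => y _; rewrite /Kr row_mxKl row_mxKr -sg_opA sg_opxV sg_opx0//.
apply: (integrable_bounded_support _ M) => [|z Mz]; last by rewrite f0' ?mulr0.
apply: (continuous_kernel f cf).
exact: (Ck_continuous _ _ (cKr 0%N)).
Qed.

(* Left translations carry integral curves of a left invariant field to integral
   curves, so the field passes through the average over left translates. *)
Lemma is_lie_derive_mollify r K f k x : 0 < r -> horizontal_C1c K f ->
  is_lie_derive (@hfield R n G k) (mollify r f) x (mollify r (lie_derive (@hfield R n G k) f) x).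
Proof.
move=> r0 [cK cf lf clf f0].
apply/(is_lie_deriveP G (inord k) (gam k) (gamI k) (gam0 k)).
have [B B0 HB] := compact_bounded_fun K _ cK (clf k) (fun x Kx => (f0 x Kx).2 k).
pose F (t : R) y := smooth_bump r y * f (op y (op x (gam k t))).
have IF t : mu.-integrable setT (EFin \o F t) by exact: integrable_bump_mul.
have dF (t : R) y : is_derive t 1 (F ^~ y)
    (smooth_bump r y * lie_derive (@hfield R n G k) f (op y (op x (gam k t)))).
  have D : is_derive t 1 (fun t => f (op y (op x (gam k t))))
     (lie_derive (@hfield R n G k) f (op y (op x (gam k t)))).
    have E : (fun s => f (op y (op x (gam k s)))) = (fun s => f (op (op y x) (gam k s))).
      by apply/funext => s; rewrite sg_opA.
    rewrite E sg_opA.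
    exact: (is_derive_along G (inord k) (gam k) (gamI k) (gam0 k) f (op y x) t (lf k)).
  exact: (@is_deriveZ _ _ _ _ (smooth_bump r y)).
have D : is_derive (0 : R) 1 (fun t => \int[mu]_y F t y)
    (\int[mu]_y (smooth_bump r y * lie_derive (@hfield R n G k) f (op y (op x (gam k 0))))).
  apply: (@is_derive_Rintegral _ _ _ _ F _ (fun y => B * smooth_bump r y)) => //.
  - by move=> y; rewrite mulr_ge0// bump_ge0.
  - rewrite /comp; under eq_fun do rewrite EFinM.
    by apply: integrableZl => //; exact: integrable_bump.
  - move=> t y _; rewrite normrM ger0_norm ?bump_ge0// mulrC.
    by rewrite ler_wpM2r ?bump_ge0.
rewrite gam0 sg_opx0 in D.
exact: (@is_deriveZ _ _ _ _ (\int[mu]_y smooth_bump r y)^-1).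
Qed.

(** If y o x lies in K then x = y^-1 o z with z in K, so K' is the image of a compact set of pairs
    (y, z) under [Phi]. It lies in Omega for small radius: the pairs with |y| <= 1 and [Phi] outside
    Omega form a compact set on which |y| has a positive minimum, since y = 0 would give a point of
    K. Half of that minimum is a safe radius. *)
Lemma mollify_support Omega K : open Omega -> compact K -> K `<=` Omega ->
  exists r0 (K' : set V), [/\ 0 < r0, compact K', K' `<=` Omega &
    forall r f x, 0 < r -> r <= r0 -> (forall z, ~ K z -> f z = 0) ->
      ~ K' x -> mollify r f x = 0].
Proof.
move=> oO cK KO; have [M M0 HM] := compact_bound K cK.
pose Phi (w : 'rV[R]_(n.+1 + n.+1)) := op (inv (lsubmx w)) (rsubmx w).
have cPhi : continuous Phi.
  apply: Ck_rV_continuous; apply: Ck_op => i.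
    apply: (@Ck_comp _ _ _ 0 (fun x => inv x ord0 i) (fun w => lsubmx w)).
      exact: sg_inv_smooth.
    by move=> {}i; under eq_fun do rewrite mxE; exact: Ck_coord.
  by under eq_fun do rewrite mxE; exact: Ck_coord.
have clsub : continuous (fun w : 'rV[R]_(n.+1 + n.+1) => lsubmx w).
  by apply: Ck_rV_continuous => i; under eq_fun do rewrite mxE; exact: Ck_coord.
have crsub : continuous (fun w : 'rV[R]_(n.+1 + n.+1) => rsubmx w).
  by apply: Ck_rV_continuous => i; under eq_fun do rewrite mxE; exact: Ck_coord.
have cnl : continuous (fun w : 'rV[R]_(n.+1 + n.+1) => `|lsubmx w|).
  by move=> w; apply: continuous_comp; [exact: clsub|exact: norm_continuous].
have clK : closed K by apply: compact_closed => //; exact: norm_hausdorff.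
have cS r : compact [set w : 'rV[R]_(n.+1 + n.+1) | `|lsubmx w| <= r /\ K (rsubmx w)].
  apply: bounded_closed_compact.
    exists (Num.max r M); split=> [|y My w /= [wr Kw]]; first exact: num_real.
    rewrite -(hsubmxK w); apply: norm_row_mx_le.
      by apply: le_trans wr (le_trans _ (ltW My)); rewrite le_max lexx.
    by apply: le_trans (HM _ Kw) (le_trans _ (ltW My)); rewrite le_max lexx orbT.
  apply: (@closedI _ ((fun w : 'rV[R]_(n.+1 + n.+1) => `|lsubmx w|) @^-1` [set t | t <= r])
    ((fun w : 'rV[R]_(n.+1 + n.+1) => rsubmx w) @^-1` K)); apply: closed_comp => //.
have [r0 r00 Hr0] : exists2 r0, 0 < r0 &
    forall w : 'rV[R]_(n.+1 + n.+1), `|lsubmx w| <= r0 -> K (rsubmx w) -> Omega (Phi w).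
  pose A := [set w : 'rV[R]_(n.+1 + n.+1) | `|lsubmx w| <= 1 /\ K (rsubmx w)] `&`
    (Phi @^-1` (~` Omega)).
  have cA : compact A.
    apply: compact_closedI; first exact: cS.
    by apply: closed_comp; [move=> w _; exact: cPhi|exact: open_closedC].
  have [A0|nA] := pselect (A !=set0); last first.
    exists 1 => // w w1 Kw; apply: contrapT => nO; apply: nA; by exists w.
  have [w0] := EVT_min_rV A0 cA (continuous_subspaceT cnl).
  rewrite inE => -[[w1 Kw] nO] Hmin.
  have m0 : 0 < `|lsubmx w0|.
    rewrite normr_gt0; apply/eqP => l0; apply: nO; rewrite /Phi l0.
    have -> : inv 0 = 0 by rewrite -[LHS](sg_opx0 G) sg_opVx.
    by rewrite sg_op0x; exact: KO.
  exists (Num.min 1 (`|lsubmx w0| / 2)); first by rewrite lt_min ltr01 divr_gt0.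
  move=> w; rewrite le_min => /andP[w1' wh] Kw'; apply: contrapT => nO'.
  have : w \in A by rewrite inE.
  move=> /Hmin /le_trans /(_ wh); rewrite leNgt => /negP; apply.
  by rewrite ltr_pdivrMr// ltr_pMr// ltr1n.
exists r0, (Phi @` [set w : 'rV[R]_(n.+1 + n.+1) | `|lsubmx w| <= r0 /\ K (rsubmx w)]); split=> //.
- by apply: continuous_compact => //; exact: continuous_subspaceT.
- by move=> _ [w [w1 w2] <-]; exact: Hr0.
- move=> r f x r0' rr0 f0 Kx; rewrite /mollify.
  rewrite (_ : (fun y => smooth_bump r y * f (op y x)) = fun=> 0).
    by rewrite Rintegral_cst// mul0r mulr0.
  apply/funext => y; have [->|b0] := eqVneq (smooth_bump r y) 0; first by rewrite mul0r.
  rewrite f0 ?mulr0// => Kyx; apply: Kx; exists (row_mx y (op y x)).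
    rewrite /= row_mxKl row_mxKr; split=> //.
    by apply: le_trans rr0; apply: ltW; exact: bump_support.
  by rewrite /Phi row_mxKl row_mxKr sg_opA sg_opVx sg_op0x.
Qed.

(** Bounded pointwise convergence of the functions and of their horizontal gradients is what
    dominated convergence needs to extend the weak equation from smooth test functions to [C1c]. The
    gradient bounds hold because the field passes through the average. *)
Lemma C1c_smooth_approx Omega f : open Omega -> C1c G Omega f ->
  exists (K : set V) (B : R) (phi : nat -> V -> R),
    [/\ compact K /\ K `<=` Omega,
        forall j, Cooc Omega (phi j) /\ forall k, continuous (fun x => hgrad G (phi j) x ord0 k),
        forall j x, ~ K x -> phi j x = 0,
        forall j x, `|phi j x| <= B /\ forall k, `|hgrad G (phi j) x ord0 k| <= B
      & forall x, (phi j x @[j --> \oo] --> f x) /\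
          forall k, hgrad G (phi j) x ord0 k @[j --> \oo] --> hgrad G f x ord0 k].
Proof.
move=> oO fC; have [K KO hf] := C1c_horizontal Omega f fC.
have [cK cf lf clf f0] := hf.
have [r0 [K' [r00 cK' K'O HK']]] := mollify_support Omega K oO cK KO.
have [N _ HN] := near_infty_natSinv_lt (PosNum r00).
(* The shift by N keeps every radius below r0, so one compact set K' serves the whole sequence. *)
pose r j : R := (j + N).+1%:R^-1.
have r_gt0 j : 0 < r j by rewrite invr_gt0.
have r_le j : r j <= r0 by apply/ltW/HN => /=; exact: leq_addl.
have [B0 B00 HB0] := compact_bounded_fun K f cK cf (fun x Kx => (f0 x Kx).1).
have /choice[Bk HBk] k : exists B, 0 <= B /\ forall x, `|lie_derive (@hfield R n G k) f x| <= B.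
  have [B ? ?] := compact_bounded_fun K _ cK (clf k) (fun x Kx => (f0 x Kx).2 k).
  by exists B.
have B_ge k : Bk k <= B0 + \sum_k Bk k.
  rewrite (bigD1 k)//= addrCA lerDl addr_ge0//.
  by apply: sumr_ge0 => j _; exact: (HBk j).1.
have hgradE j x k : hgrad G (mollify (r j) f) x ord0 k =
    mollify (r j) (lie_derive (@hfield R n G k) f) x.
  rewrite mxE; apply: (lie_deriveE G (inord k) (gam k) (gamI k) (gam0 k)).
  exact: is_lie_derive_mollify hf.
have f0' x : ~ K x -> f x = 0 by move=> /f0[].
have shift_cvg (g : V -> R) x : continuous g -> mollify (r j) g x @[j --> \oo] --> g x.
  by move=> cg; have := mollify_cvg g x cg; rewrite -(cvg_shiftn N).
exists K', (B0 + \sum_k Bk k), (fun j => mollify (r j) f); split=> //.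
- move=> j; split=> [|k].
    split; last exact: (mollify_smooth _ K).
    by exists K'; split=> // x; exact: HK'.
  under eq_fun do rewrite hgradE.
  apply: (Ck_continuous 0); apply: (mollify_smooth _ K) => //.
  by move=> x /f0[].
- by move=> j x; exact: HK'.
- move=> j x; split=> [|k].
    apply: mollify_bound => // y; apply: le_trans (HB0 y) _; rewrite lerDl.
    by apply: sumr_ge0 => k _; exact: (HBk k).1.
  rewrite hgradE; apply: mollify_bound => // y.
  exact: le_trans ((HBk k).2 y) (B_ge k).
- move=> x; split=> [|k]; first exact: shift_cvg.
  under eq_fun do rewrite hgradE.
  by rewrite mxE; exact: shift_cvg.
Qed.

End mollification.

(** * Powers and truncations *)

Section real_functions.
Context {R : realType}.

Lemma continuous_at_inv {T : topologicalType} (f : T -> R) x : f x != 0 ->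
  {for x, continuous f} -> {for x, continuous (fun y => (f y)^-1)}.
Proof. by move=> n0 cf; exact: (@cvgV _ _ (nbhs x) _ f). Qed.

Definition pos_powR (r t : R) : R := (Num.max t 0) `^ r.

Lemma pos_powR_ge0 r t : 0 <= pos_powR r t. Proof. exact: powR_ge0. Qed.

Lemma pos_powR_le r t : 0 <= r -> pos_powR r t <= `|t| `^ r.
Proof.
move=> r0; apply: ge0_ler_powR => //; rewrite ?nnegrE ?le_max ?lexx ?orbT//.
by rewrite ge_max ler_norm normr_ge0.
Qed.

Lemma pos_powR_npos r t : r != 0 -> t <= 0 -> pos_powR r t = 0.
Proof. by move=> r0 t0; rewrite /pos_powR max_r// powR0. Qed.

Lemma pos_powR_pos r t : 0 <= t -> pos_powR r t = t `^ r.
Proof. by move=> t0; rewrite /pos_powR max_l. Qed.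

Lemma cvg_norm_powR0 r : 0 < r -> `|t| `^ r @[t --> nbhs (0 : R)] --> (0 : R).
Proof.
move=> r0; apply/cvgrPdist_lt => e e0.
have d0 : 0 < e `^ r^-1 by rewrite powR_gt0.
have := @nbhs0_lt R R _ d0; apply: filterS => t td.
rewrite sub0r normrN ger0_norm ?powR_ge0//.
have -> : e = (e `^ r^-1) `^ r by rewrite -powRrM mulVf ?gt_eqF// powRr1// ltW.
by apply: gt0_ltr_powR => //; rewrite ?nnegrE ?powR_ge0.
Qed.

Lemma near_pos_powR_gt0 (r t : R) : 0 < t -> \forall s \near t, s `^ r = pos_powR r s.
Proof.
move=> t0; near=> s; rewrite pos_powR_pos// ltW//.
by near: s; exact: lt_nbhsr.
Unshelve. all: by end_near. Qed.

Lemma near_pos_powR_lt0 (r t : R) : r != 0 -> t < 0 -> \forall s \near t, cst 0 s = pos_powR r s.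
Proof.
move=> r0 t0; near=> s; rewrite pos_powR_npos// ltW//.
by near: s; exact: lt_nbhsl.
Unshelve. all: by end_near. Qed.

Lemma continuous_pos_powR r : 0 < r -> continuous (pos_powR r).
Proof.
move=> r0 t; have rn0 : r != 0 by rewrite gt_eqF.
change (pos_powR r s @[s --> t] --> pos_powR r t).
have [t0|t0|->] := ltgtP t 0.
- rewrite pos_powR_npos// ?ltW//.
  by apply: cvg_trans (near_eq_cvg (near_pos_powR_lt0 r t rn0 t0)) _; exact: cvg_cst.
- rewrite pos_powR_pos ?ltW//.
  apply: cvg_trans (near_eq_cvg (near_pos_powR_gt0 r t t0)) _.
  apply/(@differentiable_continuous _ _ _ t)/derivable1_diffP.
  by case: (is_derive1_powR r t0).
- rewrite pos_powR_npos//.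
  apply: (squeeze_cvgr _ (cvg_cst _) (cvg_norm_powR0 r r0)).
  by apply: nearW => s; rewrite pos_powR_ge0 pos_powR_le// ltW.
Qed.

(** At 0 the increment is at most |h| |h|^(p-1), and p > 1 makes the second factor tend to 0. *)
Lemma is_derive_pos_powR p (t : R) : 1 < p ->
  is_derive t 1 (pos_powR p) (p * pos_powR (p - 1) t).
Proof.
move=> p1; have pn0 : p != 0 by rewrite gt_eqF// (lt_trans ltr01).
have p10 : p - 1 != 0 by rewrite gt_eqF// subr_gt0.
have [t0|t0|->] := ltgtP t 0.
- rewrite pos_powR_npos// ?ltW// mulr0.
  by apply: near_eq_is_derive (near_pos_powR_lt0 p t pn0 t0) _.
- rewrite pos_powR_pos ?ltW//.
  by apply: near_eq_is_derive (near_pos_powR_gt0 p t t0) _; exact: is_derive1_powR.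
- rewrite pos_powR_npos// mulr0.
  apply: (@is_derive_small _ _ (fun h => `|h| `^ (p - 1))); last first.
    by apply: cvg_norm_powR0; rewrite subr_gt0.
  move=> h; rewrite add0r (pos_powR_npos p 0)// subr0 ger0_norm ?pos_powR_ge0//.
  rewrite mulr_powRB1// ?(lt_trans ltr01)//.
  by apply: pos_powR_le; rewrite ltW// (lt_trans ltr01).
Qed.

(** This is |t|^p ([abs_powRE]), split into two one-sided powers so that it is visibly C^1; the next
    function is its derivative p |t|^(p-2) t, written without a negative exponent when p < 2. *)
Definition abs_powR (p t : R) : R := pos_powR p t + pos_powR p (- t).
Definition dabs_powR (p t : R) : R := p * (pos_powR (p - 1) t - pos_powR (p - 1) (- t)).

Lemma abs_powRE p t : p != 0 -> abs_powR p t = `|t| `^ p.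
Proof.
move=> p0; rewrite /abs_powR; have [t0|t0] := leP 0 t.
  by rewrite pos_powR_pos// pos_powR_npos ?oppr_le0// addr0 ger0_norm.
by rewrite pos_powR_npos ?(ltW t0)// pos_powR_pos ?oppr_ge0 ?(ltW t0)// add0r ltr0_norm.
Qed.

Lemma norm_dabs_powR p t : 1 < p -> `|dabs_powR p t| = p * `|t| `^ (p - 1).
Proof.
move=> p1; have p10 : p - 1 != 0 by rewrite gt_eqF// subr_gt0.
rewrite /dabs_powR normrM gtr0_norm ?(lt_trans ltr01)//; congr (_ * _).
have [t0|t0] := leP 0 t.
  by rewrite pos_powR_pos// pos_powR_npos ?oppr_le0// subr0 (ger0_norm t0) ger0_norm ?powR_ge0.
rewrite pos_powR_npos ?(ltW t0)// pos_powR_pos ?oppr_ge0 ?(ltW t0)// sub0r normrN.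
by rewrite (ltr0_norm t0) ger0_norm ?powR_ge0.
Qed.

Lemma is_derive_abs_powR p (t : R) : 1 < p -> is_derive t 1 (abs_powR p) (dabs_powR p t).
Proof.
move=> p1; have D1 := is_derive_pos_powR p t p1.
have D2 : is_derive t 1 (fun s => pos_powR p (- s)) ((p * pos_powR (p - 1) (- t)) * -1).
  apply: (@is_derive1_comp _ (pos_powR p) -%R); exact: is_derive_pos_powR.
have := is_deriveD D1 D2; congr (is_derive _ _ _ _).
by rewrite /dabs_powR mulrBr mulrN1.
Qed.

Lemma continuous_dabs_powR p : 1 < p -> continuous (dabs_powR p).
Proof.
move=> p1 t; have p10 : 0 < p - 1 by rewrite subr_gt0.
have c1 : continuous (fun s => pos_powR (p - 1) (- s)).
  move=> s; apply: (@continuous_comp _ _ _ -%R (pos_powR (p - 1))); first exact: oppr_continuous.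
  exact: continuous_pos_powR.
have c2 := continuousB (continuous_pos_powR _ p10 t) (c1 t).
exact: (continuous_at_mul (fun=> p) _ t (@cst_continuous _ _ (p : R) t) c2).
Qed.

(* C^1, equal to t + e for t >= 0, and bounded below by e / 2, so that the negative
   values of the functions approximating u >= 0 do no harm. *)
Definition ramp (e t : R) : R := e + t / (1 + 2 * Num.max (- t) 0 / e).
Definition dramp (e t : R) : R := (1 + 2 * Num.max (- t) 0 / e) ^- 2.

Lemma ramp_pos e t : 0 <= t -> ramp e t = t + e.
Proof. by move=> t0; rewrite /ramp max_r ?oppr_le0// mulr0 mul0r addr0 divr1 addrC. Qed.

Lemma dramp_pos e t : 0 <= t -> dramp e t = 1.
Proof. by move=> t0; rewrite /dramp max_r ?oppr_le0// mulr0 mul0r addr0 expr1n invr1. Qed.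

Lemma ramp_den_ge1 (e t : R) : 0 < e -> 1 <= 1 + 2 * Num.max (- t) 0 / e.
Proof.
move=> e0; rewrite lerDl divr_ge0 ?(ltW e0)// mulr_ge0//.
by rewrite le_max lexx orbT.
Qed.

Lemma dramp_ge0_le1 e t : 0 < e -> 0 <= dramp e t <= 1.
Proof.
move=> e0; have D1 := ramp_den_ge1 e t e0.
rewrite /dramp invr_ge0 exprn_ge0 ?(le_trans ler01)//= invf_le1 ?exprn_gt0 ?(lt_le_trans ltr01)//.
by rewrite exprn_ege1.
Qed.

(** For t < 0 the fraction equals - |t| e / (e + 2 |t|), which is above - e / 2: this is the role of
    the 2 in the denominator. *)
Lemma ramp_ge e t : 0 < e -> e / 2 <= ramp e t.
Proof.
move=> e0; have D1 := ramp_den_ge1 e t e0.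
have D0 := lt_le_trans ltr01 D1.
rewrite /ramp; set D := 1 + _ in D1 D0 *.
suff : - (e / 2) <= t / D by lra.
rewrite ler_pdivlMr// /D.
have M : - t <= Num.max (- t) 0 by rewrite le_max lexx.
rewrite mulrDr mulr1.
have -> : - (e / 2) * (2 * Num.max (- t) 0 / e) = - Num.max (- t) 0.
  by field; rewrite gt_eqF.
lra.
Qed.

Lemma continuous_ramp_den (e : R) : continuous (fun t : R => 1 + 2 * Num.max (- t) 0 / e).
Proof.
move=> t.
have c1 : {for t, continuous (fun t : R => Num.max (- t) 0)}.
  apply: (@continuous_max R _ (fun t : R => - t) (fun=> 0)).
    exact: oppr_continuous.
  exact: cst_continuous.
have c2 := continuous_at_mul (fun=> 2) _ t (@cst_continuous _ _ (2 : R) t) c1.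
have c3 := continuous_at_mul _ (fun=> e^-1) t c2 (@cst_continuous _ _ (e^-1 : R) t).
exact: (continuous_at_add (fun=> 1) _ t (@cst_continuous _ _ (1 : R) t) c3).
Qed.

Lemma continuous_dramp e : 0 < e -> continuous (dramp e).
Proof.
move=> e0 t; have c := continuous_ramp_den e t.
have c2 := continuous_at_mul _ _ t c c.
have n0 : (1 + 2 * Num.max (- t) 0 / e) * (1 + 2 * Num.max (- t) 0 / e) != 0.
  by rewrite mulf_neq0// gt_eqF// (lt_le_trans ltr01)// ramp_den_ge1.
exact: (continuous_at_inv _ t n0 c2).
Qed.

Lemma is_derive_ramp e (t : R) : 0 < e -> is_derive t 1 (ramp e) (dramp e t).
Proof.
move=> e0.
have [t0|t0|->] := ltgtP t 0.
- have den0 : 1 - 2 * t / e != 0.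
    by rewrite gt_eqF// -mulNr -mulrN ltr_pwDl// divr_ge0 ?(ltW e0)// mulr_ge0// oppr_ge0 ltW.
  suff D : is_derive t 1 (fun s => e + s * (1 - (2 / e) * s)^-1) (dramp e t).
    apply: near_eq_is_derive D; near=> s; rewrite /ramp max_l; last first.
      by rewrite oppr_ge0 ltW//; near: s; exact: lt_nbhsl.
    by congr (_ + _ / _); field; rewrite gt_eqF.
  have den0' : 1 - (2 / e) * t != 0 by rewrite mulrAC.
  have D1 : is_derive t 1 (fun s => 1 - (2 / e) * s) (- (2 / e)).
    by apply: is_derive_eq; rewrite add0r mul1r [_%:A]mulr1.
  have D2 := @is_deriveV _ (fun s => 1 - (2 / e) * s) _ _ _ den0' D1.
  have D3 := is_deriveM (is_derive_id t (1 : R)) D2.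
  have D4 := is_deriveD (is_derive_cst e t (1 : R)) D3.
  apply: is_derive_eq.
  rewrite /dramp max_l ?oppr_ge0 ?ltW//.
  have ed : e - 2 * t != 0 by rewrite gt_eqF// subr_gt0 (lt_trans _ e0)// pmulr_rlt0.
  rewrite /GRing.scale /=; field.
  by rewrite mulrN ed gt_eqF.
- rewrite dramp_pos ?(ltW t0)//.
  have D : is_derive t 1 (fun s => s + e) 1 by apply: is_derive_eq; rewrite addr0.
  apply: near_eq_is_derive D; near=> s; rewrite ramp_pos// ltW//.
  by near: s; exact: lt_nbhsr.
- rewrite dramp_pos//.
  (* The difference is 0 for s >= 0 and (2/e) s^2 / (1 - 2 s / e) for s < 0, hence quadratically
     small. *)
  have D : is_derive (0 : R) 1 (fun s => ramp e s - (s + e)) 0.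
    apply: (@is_derive_quadratic _ _ _ (2 / e)) => h; rewrite !add0r (ramp_pos e 0)//
      add0r subrr subr0.
    have [h0|h0] := leP 0 h.
      by rewrite ramp_pos// subrr normr0 mulr_ge0 ?sqr_ge0// divr_ge0// ltW.
    rewrite /ramp max_l ?oppr_ge0 ?(ltW h0)//.
    have D1 : 1 <= 1 + 2 * - h / e.
      by rewrite lerDl divr_ge0 ?(ltW e0)// mulr_ge0// oppr_ge0 ltW.
    have D0 := lt_le_trans ltr01 D1.
    have q0 : 0 <= 2 / e * h ^+ 2 by rewrite mulr_ge0 ?sqr_ge0// divr_ge0// ltW.
    have -> : e + h / (1 + 2 * - h / e) - (h + e) = 2 / e * h ^+ 2 / (1 + 2 * - h / e).
      have ed : e + 2 * - h != 0.
        by rewrite mulrN gt_eqF// subr_gt0 (lt_trans _ e0)// pmulr_rlt0.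
      by field; rewrite ed gt_eqF.
    by rewrite ger0_norm ?divr_ge0 ?(ltW D0)// ler_pdivrMr// ler_peMr.
  have D1 : is_derive (0 : R) 1 (fun s => s + e) 1 by apply: is_derive_eq; rewrite addr0.
  have := is_deriveD D D1; rewrite add0r; congr (is_derive _ _ _ _).
  by apply/funext => s /=; rewrite subrK.
Unshelve. all: by end_near. Qed.

End real_functions.

(** * The Euclidean norm and the p-flux *)

Section euclidean.
Context {R : realType} {m : nat}.
Implicit Types v w : 'rV[R]_m.

Lemma dotpDr v w w' : dotp v (w + w') = dotp v w + dotp v w'.
Proof. by rewrite /dotp -big_split /=; apply: eq_bigr => i _; rewrite mxE mulrDr. Qed.

Lemma dotpZr v w a : dotp v (a *: w) = a * dotp v w.
Proof. by rewrite /dotp mulr_sumr; apply: eq_bigr => i _; rewrite mxE mulrCA. Qed.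

Lemma dotpC v w : dotp v w = dotp w v.
Proof. by apply: eq_bigr => i _; rewrite mulrC. Qed.

Lemma dotp_ge0 v : 0 <= dotp v v.
Proof. by apply: sumr_ge0 => i _; rewrite -expr2 sqr_ge0. Qed.

Lemma dotp_eq0 v w : dotp v v = 0 -> dotp v w = 0.
Proof.
move=> /eqP; rewrite psumr_eq0 => [/allP H|i _]; last by rewrite -expr2 sqr_ge0.
apply: big1 => i _; have := H i (mem_index_enum i).
by rewrite /= mulf_eq0 orbb => /eqP ->; rewrite mul0r.
Qed.

Lemma enorm_ge0 v : 0 <= enorm v. Proof. exact: sqrtr_ge0. Qed.

Lemma sqr_enorm v : enorm v ^+ 2 = dotp v v.
Proof. by rewrite sqr_sqrtr ?dotp_ge0. Qed.

Lemma dotp_enorm_eq0 v w : enorm v = 0 -> dotp v w = 0.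
Proof. by move=> v0; apply: dotp_eq0; rewrite -sqr_enorm v0 expr0n. Qed.

Lemma cauchy_schwarz v w : `|dotp v w| <= enorm v * enorm w.
Proof.
have [v0|v0] := eqVneq (dotp v v) 0; first by rewrite dotp_eq0// normr0 mulr_ge0// enorm_ge0.
have vp : 0 < dotp v v by rewrite lt_neqAle eq_sym v0 dotp_ge0.
rewrite -sqrtr_sqr /enorm -sqrtrM ?dotp_ge0//; apply: ler_wsqrtr.
(* The minimiser of |w + t v|^2. *)
set t := - (dotp v w / dotp v v).
have := dotp_ge0 (w + t *: v).
rewrite dotpDr dotpZr (dotpC (w + _) w) (dotpC (w + _) v) !dotpDr !dotpZr (dotpC w v).
have -> : dotp w w + t * dotp v w + t * (dotp v w + t * dotp v v) =
   dotp w w - dotp v w ^+ 2 / dotp v v by rewrite /t; field.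
by rewrite subr_ge0 ler_pdivrMr// mulrC.
Qed.

Lemma enormD v w : enorm (v + w) <= enorm v + enorm w.
Proof.
rewrite -(@ler_pXn2r _ 2) ?nnegrE ?addr_ge0 ?enorm_ge0// sqr_enorm dotpDr.
rewrite (dotpC (v + w) v) (dotpC (v + w) w) !dotpDr sqrrD !sqr_enorm (dotpC w v).
have := le_trans (ler_norm _) (cauchy_schwarz v w); lra.
Qed.

Lemma enormN v : enorm (- v) = enorm v.
Proof. by congr Num.sqrt; apply: eq_bigr => i _; rewrite !mxE mulrNN. Qed.

Lemma norm_coord_le_enorm v i : `|v ord0 i| <= enorm v.
Proof.
rewrite -sqrtr_sqr; apply: ler_wsqrtr; rewrite expr2 /dotp (bigD1 i)//= lerDl.
by apply: sumr_ge0 => j _; rewrite -expr2 sqr_ge0.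
Qed.

Lemma enorm_le_sum v : enorm v <= \sum_i `|v ord0 i|.
Proof.
rewrite -[leRHS]ger0_norm ?sumr_ge0// -sqrtr_sqr; apply: ler_wsqrtr.
rewrite expr2 mulr_suml; apply: ler_sum => i _.
apply: le_trans (ler_norm _) _; rewrite normrM ler_wpM2l//.
by rewrite (bigD1 i)//= lerDl sumr_ge0.
Qed.

Lemma cvg_dotp {T : Type} {F : set_system T} {FF : Filter F} (f g : T -> 'rV[R]_m) v w :
  (forall i, f x ord0 i @[x --> F] --> v ord0 i) ->
  (forall i, g x ord0 i @[x --> F] --> w ord0 i) ->
  dotp (f x) (g x) @[x --> F] --> dotp v w.
Proof. by move=> fv gw; apply: cvg_sumR => i; apply: cvgM. Qed.

Lemma cvg_enorm {T : Type} {F : set_system T} {FF : Filter F} (f : T -> 'rV[R]_m) v :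
  (forall i, f x ord0 i @[x --> F] --> v ord0 i) ->
  enorm (f x) @[x --> F] --> enorm v.
Proof.
move=> fv; apply: (@cvg_comp _ _ _ (fun x => dotp (f x) (f x)) Num.sqrt).
  exact: cvg_dotp.
exact: sqrt_continuous.
Qed.

Lemma measurable_dotp d (T : measurableType d) (D : set T) (f g : T -> 'rV[R]_m) :
  (forall i, measurable_fun D (fun x => f x ord0 i)) ->
  (forall i, measurable_fun D (fun x => g x ord0 i)) ->
  measurable_fun D (fun x => dotp (f x) (g x)).
Proof.
by move=> mf mg; apply: measurable_sum => i; apply: measurable_funM.
Qed.

Lemma measurable_enorm d (T : measurableType d) (D : set T) (f : T -> 'rV[R]_m) :
  (forall i, measurable_fun D (fun x => f x ord0 i)) ->
  measurable_fun D (fun x => enorm (f x)).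
Proof.
move=> mf.
apply: (measurableT_comp (continuous_measurable_fun (@sqrt_continuous R))).
exact: measurable_dotp.
Qed.

Definition flux_coef (p : R) v := enorm v `^ (p - 2).

Lemma flux_self p v : 1 < p -> flux_coef p v * dotp v v = enorm v `^ p.
Proof.
move=> p1; have [v0|v0] := eqVneq (enorm v) 0.
  by rewrite v0 dotp_enorm_eq0// mulr0 powR0// gt_eqF// (lt_trans ltr01).
rewrite /flux_coef -sqr_enorm -powR_mulrn ?enorm_ge0// -powRD ?v0 ?implybT//.
by congr (_ `^ _); lra.
Qed.

Lemma flux_le p v w : 1 < p ->
  `|flux_coef p v * dotp v w| <= enorm v `^ (p - 1) * enorm w.
Proof.
move=> p1; have [v0|v0] := eqVneq (enorm v) 0.
  by rewrite dotp_enorm_eq0// mulr0 normr0 mulr_ge0 ?powR_ge0 ?enorm_ge0.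
rewrite normrM ger0_norm ?powR_ge0//.
apply: (@le_trans _ _ (enorm v `^ (p - 2) * (enorm v * enorm w))).
  by rewrite ler_wpM2l ?powR_ge0// cauchy_schwarz.
rewrite mulrA ler_wpM2r ?enorm_ge0// -{2}[enorm v]powRr1 ?enorm_ge0//.
rewrite -powRD ?v0 ?implybT//; have -> : p - 2 + 1 = p - 1 by lra.
by [].
Qed.

End euclidean.

(** * Inequalities between powers, of Young type *)

Section power_inequalities.
Context {R : realType} (p : R) (p1 : 1 < p).
Let p0 : 0 < p. Proof. exact: lt_trans p1. Qed.

Lemma powR_add3_le a b c : 0 <= a -> 0 <= b -> 0 <= c ->
  (a + b + c) `^ p <= 3 `^ p * (a `^ p + b `^ p + c `^ p).
Proof.
move=> a0 b0 c0; pose M := Num.max a (Num.max b c).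
have M0 : 0 <= M by rewrite le_max a0.
have aM : a <= M by rewrite le_max lexx.
have bM : b <= M by rewrite !le_max lexx orbT.
have cM : c <= M by rewrite !le_max lexx !orbT.
apply: (@le_trans _ _ ((3 * M) `^ p)).
  by apply: ge0_ler_powR; rewrite ?nnegrE ?(ltW p0)// ?mulr_ge0 ?addr_ge0//; lra.
rewrite powRM// ler_wpM2l ?powR_ge0//.
have := powR_ge0 a p; have := powR_ge0 b p; have := powR_ge0 c p.
have [->|[->|->]] : M = a \/ M = b \/ M = c; [|lra..].
by rewrite /M; case: (leP b c) => _; case: leP; tauto.
Qed.

Lemma le_add1_powR t : 0 <= t -> t <= 1 + t `^ p.
Proof.
move=> t0; have := powR_ge0 t p; have [t1|/ltW t1] := leP t 1; first by lra.
have := le1r_powR t1 (ltW p1); lra.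
Qed.

(** Crude Young inequality, from comparing a with b; it suffices for majorants, where constants are
    immaterial. *)
Lemma powRB1_mul_le a b : 0 <= a -> 0 <= b -> a `^ (p - 1) * b <= a `^ p + b `^ p.
Proof.
move=> a0 b0; have pp : 0 <= p - 1 by rewrite subr_ge0 ltW.
have [ab|/ltW ba] := leP a b.
  apply: (@le_trans _ _ (b `^ p)); last by rewrite lerDr powR_ge0.
  rewrite -(mulr_powRB1 b0 p0) mulrC ler_wpM2l//.
  by apply: ge0_ler_powR.
apply: (@le_trans _ _ (a `^ p)); last by rewrite lerDl powR_ge0.
by rewrite -(mulr_powRB1 a0 p0) mulrC ler_wpM2r// powR_ge0.
Qed.

(** Young's inequality for b and a^(p-1) with exponents p and p/(p-1), multiplied by p. The
    coefficient p - 1 must be exact, because it cancels in [picone_le]. *)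
Lemma young_powR a b : 0 <= a -> 0 <= b ->
  p * (a `^ (p - 1) * b) <= (p - 1) * a `^ p + b `^ p.
Proof.
move=> a0 b0; have pp : 0 < p - 1 by rewrite subr_gt0.
have q0 : 0 < p / (p - 1) by rewrite divr_gt0.
have pq : p^-1 + (p / (p - 1))^-1 = 1 by rewrite invf_div; field; rewrite gt_eqF.
have := conjugate_powR b0 (powR_ge0 a (p - 1)) p0 q0 pq.
rewrite -powRrM mulrC (_ : (p - 1) * _ = p); last by field; rewrite gt_eqF.
rewrite invf_div -(ler_pM2l p0) => /le_trans; apply.
rewrite le_eqVlt; apply/orP; left; apply/eqP; field; rewrite gt_eqF//.
Qed.

End power_inequalities.

(** * The horizontal Sobolev space *)

Section sobolev.
Context {R : realType} {n : nat} (G : stratified_group R n).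
Local Notation V := 'rV[R]_n.+1.
Local Notation op := (sg_op G).
Local Notation mu := (lebesgue_measure_rV R n.+1).
Local Notation N1 := (head 0%N (sg_strata G)).
Context (gam : 'I_N1 -> R -> V).
Hypotheses (gamI : forall k, integral_curve (@hfield R n G k) (gam k))
           (gam0 : forall k, gam k 0 = 0).
Context (Omega : set V).
Hypotheses (oO : open Omega) (bO : bounded_set Omega).

Let mO : measurable Omega. Proof. exact: open_measurable_rV. Qed.

Let muO : (mu Omega < +oo)%E.
Proof.
have [M [_ HM]] := bO; apply: (lebesgue_measure_bounded _ (`|M| + 1)) => // x Ox.
by apply: HM Ox; rewrite (le_lt_trans (ler_norm M))// ltrDl.
Qed.

Lemma integrable_bounded (f : V -> R) B : measurable_fun Omega f ->
  (forall x, Omega x -> `|f x| <= B) -> mu.-integrable Omega (EFin \o f).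
Proof.
move=> mf HB; apply: measurable_bounded_integrable => //.
exists `|B|; split=> [|M BM x Ox]; first exact: num_real.
by apply: le_trans (HB x Ox) (le_trans (ler_norm B) (ltW BM)).
Qed.

Lemma integrable_cst_domain (a : R) : mu.-integrable Omega (EFin \o (fun=> a)).
Proof. by apply: (integrable_bounded _ `|a|). Qed.

Lemma C1c_is_lie_derive f k x : C1c G Omega f ->
  is_derive (0 : R) 1 (fun t => f (op x (gam k t))) (hgrad G f x ord0 k).
Proof.
move=> fC; have [K _ [_ _ lf _ _]] := C1c_horizontal G gam gamI gam0 Omega f fC.
have := is_derive_along G (inord k) (gam k) (gamI k) (gam0 k) f x 0 (lf k).
by rewrite gam0 sg_opx0 mxE.
Qed.

Lemma C1c_regular f : C1c G Omega f ->
  [/\ continuous f, forall k, continuous (fun x => hgrad G f x ord0 k)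
    & exists2 B, 0 <= B & forall x, `|f x| <= B /\ enorm (hgrad G f x) <= B].
Proof.
move=> fC; have [K _ [cK cf lf clf f0]] := C1c_horizontal G gam gamI gam0 Omega f fC.
split=> // [k|].
  rewrite (_ : (fun x => _) = lie_derive (@hfield R n G k) f)//.
  by apply/funext => x; rewrite mxE.
have [B0 B00 HB0] := compact_bounded_fun K f cK cf (fun x Kx => (f0 x Kx).1).
have /choice[Bk HBk] k : exists B, 0 <= B /\ forall x, `|lie_derive (@hfield R n G k) f x| <= B.
  have [B ? ?] := compact_bounded_fun K _ cK (clf k) (fun x Kx => (f0 x Kx).2 k).
  by exists B.
have S0 : 0 <= \sum_k Bk k by apply: sumr_ge0 => k _; exact: (HBk k).1.
exists (B0 + \sum_k Bk k) => [|x]; first by rewrite addr_ge0.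
split; first by apply: le_trans (HB0 x) _; rewrite lerDl.
apply: le_trans (enorm_le_sum _) _; rewrite -[leLHS]add0r lerD//.
by apply: ler_sum => k _; rewrite mxE; exact: (HBk k).2.
Qed.

Lemma C1c_measurable f : C1c G Omega f ->
  measurable_fun Omega f /\ forall k, measurable_fun Omega (fun x => hgrad G f x ord0 k).
Proof.
move=> /C1c_regular[cf clf _].
by split=> [|k]; apply: measurable_funTS; exact: continuous_measurable_rV.
Qed.

Lemma continuous_of_derive (P P' : R -> R) :
  (forall t : R, is_derive t 1 P (P' t)) -> continuous P.
Proof.
by move=> dP t; apply/differentiable_continuous/derivable1_diffP; case: (dP t).
Qed.

(** Made for the Picone test functions |psi|^p (phi_j + e)^(1-p) in their ramp version. The support
    comes from f alone, so P(0) = 0 is demanded and Q is free at 0. *)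
Lemma C1c_mul_comp f g (P P' Q Q' : R -> R) : C1c G Omega f -> C1c G Omega g ->
  (forall t : R, is_derive t 1 P (P' t)) -> continuous P' -> P 0 = 0 ->
  (forall t : R, is_derive t 1 Q (Q' t)) -> continuous Q' ->
  C1c G Omega (fun x => P (f x) * Q (g x)) /\
  forall x, hgrad G (fun x => P (f x) * Q (g x)) x =
    (P' (f x) * Q (g x)) *: hgrad G f x + (P (f x) * Q' (g x)) *: hgrad G g x.
Proof.
move=> fC gC dP cP' P0 dQ cQ'.
have [cf chf _] := C1c_regular f fC; have [cg chg _] := C1c_regular g gC.
have cP := continuous_of_derive P P' dP; have cQ := continuous_of_derive Q Q' dQ.
have cc (h : R -> R) (u : V -> R) x : continuous h -> continuous u ->
    {for x, continuous (fun y => h (u y))}.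
  by move=> ch cu; apply: (@continuous_comp _ _ _ u h); [exact: cu|exact: ch].
have D k x : is_lie_derive (@hfield R n G k) (fun x => P (f x) * Q (g x)) x
   ((P' (f x) * Q (g x)) * hgrad G f x ord0 k + (P (f x) * Q' (g x)) * hgrad G g x ord0 k).
  apply/(is_lie_deriveP G (inord k) (gam k) (gamI k) (gam0 k)).
  have Df := C1c_is_lie_derive f k x fC; have Dg := C1c_is_lie_derive g k x gC.
  have x0 : op x (gam k 0) = x by rewrite gam0 sg_opx0.
  have DP : is_derive (f (op x (gam k 0))) 1 P (P' (f x)) by rewrite x0.
  have DQ : is_derive (g (op x (gam k 0))) 1 Q (Q' (g x)) by rewrite x0.
  have D1 := @is_derive1_comp _ P (fun t => f (op x (gam k t))) 0 _ _ DP Df.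
  have D2 := @is_derive1_comp _ Q (fun t => g (op x (gam k t))) 0 _ _ DQ Dg.
  have := is_deriveM D1 D2; rewrite /= x0; congr (is_derive _ _ _ _).
  rewrite /GRing.scale /=; ring.
have E x : hgrad G (fun x => P (f x) * Q (g x)) x =
    (P' (f x) * Q (g x)) *: hgrad G f x + (P (f x) * Q' (g x)) *: hgrad G g x.
  apply/rowP => k; rewrite mxE.
  by rewrite (lie_deriveE G (inord k) (gam k) (gamI k) (gam0 k) _ _ _ (D k x)) [RHS]mxE !mxE.
split=> //; split.
- have [[K [cK KO f0]] _ _ _] := fC; exists K; split=> // x /f0 ->.
  by rewrite P0 mul0r.
- move=> x _.
  exact: (continuous_at_mul (fun y => P (f y)) (fun y => Q (g y)) x
    (cc P f x cP cf) (cc Q g x cQ cg)).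
- by move=> k x _; eexists; exact: D.
- move=> k x _.
  have -> : (fun y => hgrad G (fun x => P (f x) * Q (g x)) y ord0 k) =
     (fun y => (P' (f y) * Q (g y)) * hgrad G f y ord0 k +
     (P (f y) * Q' (g y)) * hgrad G g y ord0 k).
    by apply/funext => y; rewrite E [LHS]mxE; congr (_ + _); rewrite [LHS]mxE.
  have c1 := continuous_at_mul _ _ x
    (continuous_at_mul _ _ x (cc P' f x cP' cf) (cc Q g x cQ cg)) (chf k x).
  have c2 := continuous_at_mul _ _ x
    (continuous_at_mul _ _ x (cc P f x cP cf) (cc Q' g x cQ' cg)) (chg k x).
  exact: (continuous_at_add _ _ x c1 c2).
Qed.

End sobolev.

Lemma measurable_fun_powR d (T : measurableType d) (R : realType) (D : set T) (f : T -> R) p :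
  measurable_fun D f -> measurable_fun D (fun x => f x `^ p).
Proof. by move=> mf; exact: (measurableT_comp (measurable_powR p) mf). Qed.

(** The bounds e / 2^(m+1) add up to e, so the series of the w_m is integrable and finite almost
    everywhere. Its sum dominates every term, and convergence of the series sends the terms to 0. *)
Lemma summable_dominated d (T : measurableType d) (R : realType)
    (mu : {measure set T -> \bar R}) (D : set T) (w : nat -> T -> R) (e : R) :
  measurable D -> 0 <= e ->
  (forall m, measurable_fun D (w m)) -> (forall m x, D x -> 0 <= w m x) ->
  (forall m, (\int[mu]_(x in D) (w m x)%:E <= (e / (2 ^ m.+1)%:R)%:E)%E) ->
  exists2 S : T -> R, mu.-integrable D (EFin \o S) &
    {ae mu, forall x, D x -> (forall m, w m x <= S x) /\ w m x @[m --> \oo] --> (0 : R)}.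
Proof.
move=> mD e0 mw w0 Iw.
pose W x := (\sum_(m <oo) (w m x)%:E)%E.
have mwE m : measurable_fun D (fun x => (w m x)%:E) by exact/measurable_EFinP.
have W0 x : D x -> (0 <= W x)%E.
  by move=> Dx; apply: nneseries_ge0 => m _ _; rewrite lee_fin w0.
have mW : measurable_fun D W.
  apply: (@ge0_emeasurable_sum _ _ _ D (fun m x => (w m x)%:E) xpredT) => // m x Dx _.
  by rewrite lee_fin w0.
have IW : mu.-integrable D W.
  apply/integrableP; split => //.
  rewrite (eq_integral W); last by move=> x /[!inE] Dx; rewrite gee0_abs// W0.
  rewrite integral_nneseries//.
  apply: (@le_lt_trans _ _ e%:E); last exact: ltry.
  apply: le_trans (epsilon_trick0 xpredT e0); apply: lee_nneseries => m //.
  by move=> _ _; apply: integral_ge0 => x Dx; rewrite lee_fin w0.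
exists (fine \o W).
  apply: le_integrable IW => //.
    by apply/measurable_EFinP; apply: measurableT_comp.
  by move=> x Dx /=; have := W0 x Dx; case: (W x) => [r _|_|] //=; rewrite leey.
have := integrable_ae mD IW; apply: filterS => x Wfin Dx; have {}Wfin := Wfin Dx.
have le_part m : \sum_(0 <= i < m) w i x <= fine (W x).
  rewrite -lee_fin fineK// -sumEFin; apply: nneseries_lim_ge => i _ _.
  by rewrite lee_fin w0.
split=> [m|].
  apply: le_trans (le_part m.+1) => /=; rewrite big_nat_recr//= lerDr.
  by apply: sumr_ge0 => i _; exact: w0.
apply: cvg_series_cvg_0; apply: nondecreasing_is_cvgn.
  by apply/nondecreasing_seqP => m; rewrite /series /= big_nat_recr//= lerDl w0.
by exists (fine (W x)) => _ [m _ <-]; exact: le_part.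
Qed.

Lemma cvge0_near_lt (R : realType) (a : nat -> \bar R) (e : R) : 0 < e ->
  a @ \oo --> 0%E -> \forall j \near \oo, (a j < e%:E)%E.
Proof.
move=> e0 /fine_cvgP[fa /cvgrPdist_lt/(_ e e0)].
apply: filterS2 fa => j fin; rewrite sub0r normrN => lt.
by rewrite -[a j]fineK// lte_fin (le_lt_trans (ler_norm _)).
Qed.

(** * Dominated almost everywhere approximation in the Sobolev space *)

Section riesz_fischer.
Context {R : realType} {n : nat} (G : stratified_group R n).
Local Notation V := 'rV[R]_n.+1.
Local Notation mu := (lebesgue_measure_rV R n.+1).
Local Notation N1 := (head 0%N (sg_strata G)).
Context (gam : 'I_N1 -> R -> V).
Hypotheses (gamI : forall k, integral_curve (@hfield R n G k) (gam k))
           (gam0 : forall k, gam k 0 = 0).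
Context (Omega : set V) (oO : open Omega) (bO : bounded_set Omega).
Context (p : R) (p1 : 1 < p).

Let p0 : 0 < p. Proof. exact: lt_trans p1. Qed.

(** The form in which approximation by [C1c] is used from here on: a single S controls the p-th
    powers of all approximants, of the limit, and of all gradients. *)
Definition dominated_approx u (Du : V -> 'rV[R]_N1) (phi : nat -> V -> R) (S : V -> R) :=
  [/\ forall j, C1c G Omega (phi j),
      mu.-integrable Omega (EFin \o S)
    & {ae mu, forall x, Omega x ->
       [/\ phi j x @[j --> \oo] --> u x,
           forall k, hgrad G (phi j) x ord0 k @[j --> \oo] --> Du x ord0 k,
           forall j, `|phi j x| `^ p <= S x /\ enorm (hgrad G (phi j) x) `^ p <= S x
         & `|u x| `^ p <= S x /\ enorm (Du x) `^ p <= S x] }].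

Lemma cvg_powR_dist (a : nat -> R) (b : R) (w : nat -> R) :
  (forall j, `|a j - b| `^ p <= w j) -> w j @[j --> \oo] --> (0 : R) ->
  a j @[j --> \oo] --> b.
Proof.
move=> H w0; apply/cvgrPdist_lt => e e0.
have ep : 0 < e `^ p by rewrite powR_gt0.
have /cvgrPdist_lt/(_ _ ep) := w0; apply: filterS => j.
rewrite sub0r normrN => wj; rewrite distrC ltNge; apply/negP => le.
have := le_lt_trans (le_trans (H j) (ler_norm _)) wj; rewrite ltNge => /negP; apply.
by apply: ge0_ler_powR => //; rewrite ?nnegrE//; exact: ltW.
Qed.

(* Along a fast subsequence the p-th powers of the errors are summable in L^1; their
   sum yields S. *)
Lemma sobolev0_dominated (u : V -> R) (Du : V -> 'rV[R]_N1) : sobolev0_grad p Omega u Du ->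
  exists phi S, dominated_approx u Du phi S.
Proof.
case=> mu_meas mDu [phi [phiC _ cphi chphi]].
have mO := open_measurable_rV Omega oO.
pose w j x := `|phi j x - u x| `^ p + enorm (hgrad G (phi j) x - Du x) `^ p.
have mw1 j : measurable_fun Omega (fun x => (`|phi j x - u x| `^ p)%:E).
  have [mp _] := C1c_measurable G gam gamI gam0 Omega (phi j) (phiC j).
  apply/measurable_EFinP; apply: measurable_fun_powR.
  by apply: measurableT_comp => //; exact: measurable_funB.
have mw2 j : measurable_fun Omega (fun x => (enorm (hgrad G (phi j) x - Du x) `^ p)%:E).
  have [_ mhp] := C1c_measurable G gam gamI gam0 Omega (phi j) (phiC j).
  apply/measurable_EFinP; apply: measurable_fun_powR.
  apply: measurable_enorm => k.
  rewrite (_ : (fun _ => _) = (fun x => hgrad G (phi j) x ord0 k - Du x ord0 k)); last first.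
    by apply/funext => x; rewrite !mxE.
  exact: measurable_funB.
(* The 2 leaves room for two errors of size 1/2^(m+1), one for the function and one for the
   gradient. *)
have sub m : exists j, (\int[mu]_(x in Omega) (w j x)%:E <= (2 / (2 ^ m.+1)%:R)%:E)%E.
  have e0 : 0 < ((2 ^ m.+1)%:R^-1 : R) by rewrite invr_gt0 ltr0n expn_gt0.
  have [j [j1 j2]] := filter_ex
    (filterI (cvge0_near_lt R _ _ e0 cphi) (cvge0_near_lt R _ _ e0 chphi)).
  exists j; rewrite /w; under eq_integral do rewrite EFinD.
  rewrite ge0_integralD//=.
  - rewrite mulr2n mulrDl !mul1r EFinD; apply: leeD; exact: ltW.
  - by move=> x _; rewrite lee_fin powR_ge0.
have [s Hs] := choice sub.
have w0 j x : 0 <= w j x by rewrite /w addr_ge0 ?powR_ge0.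
have mw j : measurable_fun Omega (w j).
  by apply: measurable_funD; apply/measurable_EFinP; [exact: mw1|exact: mw2].
have [S0 iS0 aeS0] := summable_dominated _ _ R mu Omega (fun m => w (s m)) 2 mO (ler0n R 2)
  (fun m => mw (s m)) (fun m x _ => w0 (s m) x) Hs.
have [_ _ [B B0 HB]] := C1c_regular G gam gamI gam0 Omega (phi (s 0%N)) (phiC (s 0%N)).
(* From phi_j = (phi_j - u) - (phi_0 - u) + phi_0 along the subsequence and [powR_add3_le]: the
   first two powers are at most S0, and the third at most B^p, since phi_0 is bounded. Neither u nor
   [Du] is assumed to have an integrable p-th power. *)
exists (fun m => phi (s m)), (fun x => 3 `^ p * (2 * S0 x + B `^ p)); split=> //.
  rewrite (_ : _ \o _ = (fun x => (3 `^ p)%:E * ((2%:E * (EFin \o S0) x) + (B `^ p)%:E))%E).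
    apply: integrableZl => //; apply: integrableD => //; first exact: integrableZl.
    exact: (integrable_cst_domain Omega oO bO).
  by apply/funext => x /=; rewrite EFinM EFinD EFinM.
apply: filterS aeS0 => x H Ox; have {H}[wS wc] := H Ox.
have S0x : 0 <= S0 x := le_trans (w0 (s 0%N) x) (wS 0%N).
have w1 j : `|phi j x - u x| `^ p <= w j x by rewrite /w lerDl powR_ge0.
have w2 j : enorm (hgrad G (phi j) x - Du x) `^ p <= w j x by rewrite /w lerDr powR_ge0.
have [HB1 HB2] := HB x.
have Bp a : 0 <= a -> a <= B -> a `^ p <= B `^ p.
  by move=> a0 aB; apply: ge0_ler_powR; rewrite ?nnegrE ?(ltW p0).
have fin (a b c : R) t1 t2 t : 0 <= a -> 0 <= b -> 0 <= c -> t <= a + b + c -> 0 <= t ->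
    a `^ p <= t1 -> b `^ p <= t2 -> c <= B -> t1 <= S0 x -> t2 <= S0 x ->
    t `^ p <= 3 `^ p * (2 * S0 x + B `^ p).
  move=> a0 b0 c0 tabc t0 at1 bt2 cB t1S t2S.
  apply: (@le_trans _ _ ((a + b + c) `^ p)).
    by apply: ge0_ler_powR; rewrite ?nnegrE ?(ltW p0)// !addr_ge0.
  apply: le_trans (powR_add3_le p p1 a b c a0 b0 c0) _.
  by rewrite ler_wpM2l ?powR_ge0//; have := Bp c c0 cB; lra.
have z0 : (0 : R) `^ p = 0 by rewrite powR0// gt_eqF.
split.
- refine (cvg_powR_dist (fun m => phi (s m) x) (u x) (fun m => w (s m) x) _ wc).
  by move=> m; exact: w1.
- move=> k; refine (cvg_powR_dist (fun m => hgrad G (phi (s m)) x ord0 k) _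
    (fun m => w (s m) x) _ wc) => j.
  apply: le_trans (w2 (s j)); apply: ge0_ler_powR; rewrite ?nnegrE ?enorm_ge0 ?(ltW p0)//.
  by have := norm_coord_le_enorm (hgrad G (phi (s j)) x - Du x) k; rewrite !mxE.
- move=> j; split.
  + apply: (fin _ _ _ _ _ _ (normr_ge0 _) (normr_ge0 _) (normr_ge0 _) _ (normr_ge0 _)
      (w1 (s j)) (w1 (s 0%N)) HB1 (wS j) (wS 0%N)).
    have E : phi (s j) x = (phi (s j) x - u x) - (phi (s 0%N) x - u x) + phi (s 0%N) x by ring.
    rewrite {1}E.
    apply: le_trans (ler_normD _ _) _; rewrite lerD2r.
    exact: ler_normB.
  + apply: (fin _ _ _ _ _ _ (enorm_ge0 _) (enorm_ge0 _) (enorm_ge0 _) _ (enorm_ge0 _)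
      (w2 (s j)) (w2 (s 0%N)) HB2 (wS j) (wS 0%N)).
    set a := hgrad G (phi (s j)) x; set b := hgrad G (phi (s 0%N)) x.
    have E : a = (a - Du x) - (b - Du x) + b by rewrite opprB addrA subrK subrK.
    by rewrite {1}E; apply: le_trans (enormD _ _) _; rewrite lerD2r -(enormN (b - _)) enormD.
- split.
  + apply: (fin 0 _ _ 0 _ _ (lexx _) (normr_ge0 _) (normr_ge0 _) _ (normr_ge0 _)
      _ (w1 (s 0%N)) HB1 S0x (wS 0%N)); last by rewrite z0.
    have E : u x = - (phi (s 0%N) x - u x) + phi (s 0%N) x by ring.
    by rewrite {1}E; apply: le_trans (ler_normD _ _) _; rewrite normrN add0r.
  + apply: (fin 0 _ _ 0 _ _ (lexx _) (enorm_ge0 _) (enorm_ge0 _) _ (enorm_ge0 _)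
      _ (w2 (s 0%N)) HB2 S0x (wS 0%N)); last by rewrite z0.
    set b := hgrad G (phi (s 0%N)) x.
    have E : Du x = - (b - Du x) + b by rewrite opprB subrK.
    by rewrite {1}E; apply: le_trans (enormD _ _) _; rewrite enormN add0r.
Qed.

End riesz_fischer.

(** * Picone inequality *)

Section almost_everywhere.
Context d (T : measurableType d) (R : realType) (mu : {measure set T -> \bar R}).
Context (D : set T) (mD : measurable D).

Lemma eq_Rintegral_ae (f g : T -> R) : measurable_fun D f -> measurable_fun D g ->
  {ae mu, forall x, D x -> f x = g x} ->
  \int[mu]_(x in D) f x = \int[mu]_(x in D) g x.
Proof.
move=> mf mg fg; rewrite /Rintegral; congr fine; apply: ae_eq_integral => //.
- exact/measurable_EFinP.
- exact/measurable_EFinP.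
- by apply: filterS fg => x H Dx; rewrite H.
Qed.

Lemma le_Rintegral_ae (f g : T -> R) : mu.-integrable D (EFin \o f) ->
  mu.-integrable D (EFin \o g) -> {ae mu, forall x, D x -> f x <= g x} ->
  \int[mu]_(x in D) f x <= \int[mu]_(x in D) g x.
Proof.
move=> intf intg fg; rewrite -subr_ge0 -RintegralB//.
have mf : measurable_fun D f by apply/measurable_EFinP; case/integrableP: intf.
have mg : measurable_fun D g by apply/measurable_EFinP; case/integrableP: intg.
rewrite (@eq_Rintegral_ae _ (fun x => `|g x - f x|)).
- by apply: Rintegral_ge0.
- exact: measurable_funB.
- by apply: measurableT_comp => //; exact: measurable_funB.
- by apply: filterS fg => x H Dx; rewrite ger0_norm// subr_ge0 H.
Qed.

End almost_everywhere.

Section picone_pointwise.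
Context {R : realType} (p : R) (p1 : 1 < p).
Let p0 : 0 < p. Proof. exact: lt_trans p1. Qed.

Lemma powR_oppM (a b h r : R) : 0 <= a -> 0 <= b -> 0 < h ->
  (a * b / h) `^ r = a `^ r * b `^ r * h `^ (- r).
Proof.
move=> a0 b0 h0; rewrite powRM ?mulr_ge0 ?invr_ge0 ?(ltW h0)// powRM//; congr (_ * _).
by rewrite -powR_inv1 ?(ltW h0)// -powRrM mulN1r.
Qed.

(** Picone's inequality at a point: with v the gradient of u, h = u + e, t = psi and w the gradient
    of psi, the left side is the flux of u against the gradient of |psi|^p h^(1-p). For X = |t| |v|
    / h the first term is at most p X^(p-1) |w|, the second equals - (p-1) X^p, and [young_powR]
    concludes. *)
Lemma picone_le {m} (v w : 'rV[R]_m) (t h : R) : 0 < h ->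
  flux_coef p v * (dabs_powR p t * h `^ (1 - p) * dotp v w +
     abs_powR p t * ((1 - p) * h `^ (- p)) * dotp v v) <= enorm w `^ p.
Proof.
move=> h0; pose X := `|t| * enorm v / h.
have X0 : 0 <= X by rewrite divr_ge0 ?mulr_ge0 ?enorm_ge0// ltW.
have Y := young_powR p p1 X (enorm w) X0 (enorm_ge0 w).
rewrite mulrDr.
have T1 : flux_coef p v * (dabs_powR p t * h `^ (1 - p) * dotp v w) <=
    p * (X `^ (p - 1) * enorm w).
  apply: le_trans (ler_norm _) _.
  rewrite mulrCA normrM normrM norm_dabs_powR// (ger0_norm (powR_ge0 h _)).
  rewrite /X powR_oppM ?enorm_ge0// opprB.
  apply: (@le_trans _ _ (p * `|t| `^ (p - 1) * h `^ (1 - p) * (enorm v `^ (p - 1) * enorm w))).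
    by rewrite ler_wpM2l ?flux_le// !mulr_ge0 ?powR_ge0// ltW.
  by rewrite le_eqVlt; apply/orP; left; apply/eqP; ring.
have T2 : flux_coef p v * (abs_powR p t * ((1 - p) * h `^ (- p)) * dotp v v) =
    - ((p - 1) * X `^ p).
  rewrite mulrCA flux_self// abs_powRE ?gt_eqF// /X powR_oppM ?enorm_ge0//; ring.
rewrite T2; lra.
Qed.

Lemma powR_le_neg (a b r : R) : 0 < b -> b <= a -> r <= 0 -> a `^ r <= b `^ r.
Proof.
move=> b0 ba r0; have a0 := lt_le_trans b0 ba.
rewrite -[r]opprK (powRN a) (powRN b) lef_pV2 ?posrE ?powR_gt0//.
by apply: ge0_ler_powR; rewrite ?nnegrE ?oppr_ge0 ?(ltW a0) ?(ltW b0).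
Qed.

Definition inv_ramp (e t : R) : R := ramp e t `^ (1 - p).
Definition dinv_ramp (e t : R) : R := (1 - p) * ramp e t `^ (- p) * dramp e t.

Lemma ramp_gt0 (e t : R) : 0 < e -> 0 < ramp e t.
Proof. by move=> e0; apply: lt_le_trans (ramp_ge e t e0); rewrite divr_gt0. Qed.

Lemma is_derive_ramp_powR (e r t : R) : 0 < e ->
  is_derive t 1 (fun s => ramp e s `^ r) (r * ramp e t `^ (r - 1) * dramp e t).
Proof.
move=> e0.
have D1 := is_derive1_powR r (ramp_gt0 e t e0).
exact: (@is_derive1_comp _ (fun s => s `^ r) (ramp e) t _ _ D1 (is_derive_ramp e t e0)).
Qed.

Lemma is_derive_inv_ramp (e t : R) : 0 < e ->
  is_derive t 1 (inv_ramp e) (dinv_ramp e t).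
Proof.
move=> e0; have := is_derive_ramp_powR e (1 - p) t e0.
by rewrite /dinv_ramp (_ : 1 - p - 1 = - p); last by lra.
Qed.

Lemma continuous_dinv_ramp e : 0 < e -> continuous (dinv_ramp e).
Proof.
move=> e0 t.
have c1 : {for t, continuous (fun s => ramp e s `^ (- p))}.
  apply/(@differentiable_continuous _ _ _ t)/derivable1_diffP.
  by case: (is_derive_ramp_powR e (- p) t e0).
have c2 := continuous_at_mul (fun=> 1 - p) _ t (@cst_continuous _ _ (1 - p : R) t) c1.
exact: (continuous_at_mul _ _ t c2 (continuous_dramp e e0 t)).
Qed.

Lemma inv_ramp_le e t : 0 < e -> 0 <= inv_ramp e t <= (e / 2) `^ (1 - p).
Proof.
move=> e0; rewrite powR_ge0 /=; apply: powR_le_neg; first by rewrite divr_gt0.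
  exact: ramp_ge.
by rewrite subr_le0 ltW.
Qed.

Lemma norm_dinv_ramp_le e t : 0 < e -> `|dinv_ramp e t| <= (p - 1) * (e / 2) `^ (- p).
Proof.
move=> e0; have /andP[d0 d1] := dramp_ge0_le1 e t e0.
rewrite !normrM (ger0_norm d0) distrC (ger0_norm (powR_ge0 _ _)) gtr0_norm ?subr_gt0//.
apply: (@le_trans _ _ ((p - 1) * (e / 2) `^ (- p) * 1)); last by rewrite mulr1.
have pm : 0 <= p - 1 by rewrite subr_ge0 ltW.
apply: ler_pM => //; first by rewrite mulr_ge0// powR_ge0.
rewrite ler_wpM2l//; apply: powR_le_neg; first by rewrite divr_gt0.
  exact: ramp_ge.
by rewrite oppr_le0 ltW.
Qed.

End picone_pointwise.

Lemma cvg_eq_lim {R : realType} (a b : nat -> R) (l l' : R) : (forall j, a j = b j) ->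
  a j @[j --> \oo] --> l -> b j @[j --> \oo] --> l' -> l = l'.
Proof.
move=> /funext -> bl bl'.
by rewrite -(cvg_lim (@Rhausdorff R) bl) -(cvg_lim (@Rhausdorff R) bl').
Qed.

Lemma norm_add_mul3_le {R : realType} (a i c b d h a' i' c' b' d' h' : R) :
  `|a| <= a' -> `|i| <= i' -> `|c| <= c' -> `|b| <= b' -> `|d| <= d' -> `|h| <= h' ->
  `|a * i * c + b * d * h| <= a' * i' * c' + b' * d' * h'.
Proof.
move=> ha hi hc hb hd hh; apply: le_trans (ler_normD _ _) _; rewrite !normrM.
by apply: lerD; apply: ler_pM => //; rewrite ?mulr_ge0//; apply: ler_pM.
Qed.

Section picone.
Context {R : realType} {n : nat} (G : stratified_group R n).
Local Notation V := 'rV[R]_n.+1.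
Local Notation mu := (lebesgue_measure_rV R n.+1).
Local Notation N1 := (head 0%N (sg_strata G)).
Context (gam : 'I_N1 -> R -> V).
Hypotheses (gamI : forall k, integral_curve (@hfield R n G k) (gam k))
           (gam0 : forall k, gam k 0 = 0).
Context (Omega : set V) (oO : open Omega) (bO : bounded_set Omega).
Context (p : R) (p1 : 1 < p).

Let p0 : 0 < p. Proof. exact: lt_trans p1. Qed.
Let mO : measurable Omega. Proof. exact: open_measurable_rV. Qed.

Definition flux (Du : V -> 'rV[R]_N1) (phi : V -> R) (x : V) : R :=
  flux_coef p (Du x) * dotp (Du x) (hgrad G phi x).

Section solution.
Context (u f : V -> R) (Du : V -> 'rV[R]_N1) (phi : nat -> V -> R) (S : V -> R) (M : R).
Hypotheses (mu_meas : measurable_fun Omega u) (mf : measurable_fun Omega f)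
  (mDu : forall k, measurable_fun Omega (fun x => Du x ord0 k))
  (uapprox : dominated_approx G Omega p u Du phi S)
  (fM : {ae mu, forall x, Omega x -> `|f x| <= M})
  (weak : forall psi, Cooc Omega psi ->
    \int[mu]_(x in Omega) flux Du psi x = \int[mu]_(x in Omega) (f x * psi x)).

Let phiC j : C1c G Omega (phi j). Proof. by case: uapprox. Qed.
Let iS : mu.-integrable Omega (EFin \o S). Proof. by case: uapprox. Qed.
Let aeS : {ae mu, forall x, Omega x ->
       [/\ phi j x @[j --> \oo] --> u x,
           forall k, hgrad G (phi j) x ord0 k @[j --> \oo] --> Du x ord0 k,
           forall j, `|phi j x| `^ p <= S x /\ enorm (hgrad G (phi j) x) `^ p <= S x
         & `|u x| `^ p <= S x /\ enorm (Du x) `^ p <= S x] }.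
Proof. by case: uapprox. Qed.

(** The majorants for a solution are all cast in this form, possibly with a = 0; the constant term
    is integrable since Omega is bounded. *)
Lemma integrable_affine (a b : R) : mu.-integrable Omega (EFin \o (fun x => a * S x + b)).
Proof.
rewrite (_ : _ \o _ = (fun x => a%:E * (EFin \o S) x + b%:E)%E); last first.
  by apply/funext => x /=; rewrite EFinD EFinM.
apply: integrableD => //; first exact: integrableZl.
exact: (integrable_cst_domain Omega oO bO).
Qed.

Lemma measurable_flux psi :
  (forall k, measurable_fun Omega (fun x => hgrad G psi x ord0 k)) ->
  measurable_fun Omega (flux Du psi).
Proof.
move=> mpsi; apply: measurable_funM; last exact: measurable_dotp.
by apply: measurable_fun_powR; exact: measurable_enorm.
Qed.

(** The mollified test functions have uniformly bounded values and gradients. On the left the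
    majorant is |Du|^(p-1) C <= S + C^p, on the right M B. *)
Lemma weak_C1c psi : C1c G Omega psi ->
  \int[mu]_(x in Omega) flux Du psi x = \int[mu]_(x in Omega) (f x * psi x).
Proof.
move=> psiC.
have [K [B [psi_ [_ psiCoo _ HB psi_cvg]]]] :=
  C1c_smooth_approx G gam gamI gam0 Omega psi oO psiC.
have [mpsi mhpsi] := C1c_measurable G gam gamI gam0 Omega psi psiC.
have B0 : 0 <= B by apply: le_trans (normr_ge0 _) (HB 0%N 0).1.
pose C := \sum_(k < N1) B.
have C0 : 0 <= C by apply: sumr_ge0.
have HC j x : enorm (hgrad G (psi_ j) x) <= C.
  by apply: le_trans (enorm_le_sum _) _; apply: ler_sum => k _; exact: (HB j x).2.
have mpsi_ j : measurable_fun Omega (psi_ j).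
  apply: measurable_funTS; apply: continuous_measurable_rV.
  exact: (Ck_continuous 0 _ ((psiCoo j).1.2 0%N)).
have mhpsi_ j k : measurable_fun Omega (fun x => hgrad G (psi_ j) x ord0 k).
  by apply: measurable_funTS; apply: continuous_measurable_rV; exact: (psiCoo j).2.
have [||||| _ L] := @Rintegral_dominated_cvg R _ _ mu Omega
  (fun j => flux Du (psi_ j)) (flux Du psi) (fun x => 1 * S x + C `^ p) mO.
- by move=> j; exact: measurable_flux.
- exact: measurable_flux.
- apply: aeW => x Ox; apply: cvgMl_tmp; apply: cvg_dotp => k; first exact: cvg_cst.
  exact: (psi_cvg x).2.
- exact: integrable_affine.
- apply: filterS aeS => x H j Ox; have [_ _ _ [_ DuS]] := H Ox.
  apply: le_trans (flux_le p _ _ p1) _.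
  apply: (@le_trans _ _ (enorm (Du x) `^ (p - 1) * C)).
    by rewrite ler_wpM2l ?powR_ge0.
  by apply: le_trans (powRB1_mul_le p p1 _ _ (enorm_ge0 _) C0) _; rewrite mul1r lerD2r.
have [||||| _ L'] := @Rintegral_dominated_cvg R _ _ mu Omega
  (fun j x => f x * psi_ j x) (fun x => f x * psi x) (fun x => 0 * S x + M * B) mO.
- by move=> j; exact: measurable_funM.
- exact: measurable_funM.
- by apply: aeW => x Ox; apply: cvgMl_tmp; exact: (psi_cvg x).1.
- exact: integrable_affine.
- apply: filterS fM => x H j Ox; rewrite mul0r add0r normrM.
  by apply: ler_pM => //; [exact: H|exact: (HB j x).1].
by apply: cvg_eq_lim L L' => j; exact: (weak _ (psiCoo j).1).
Qed.

(** Testing the equation with its own approximants phi_j turns the flux into |Du|^p in the limit. On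
    the right |f phi_j| <= M (1 + |phi_j|^p) <= M S + M. *)
Lemma energy_identity :
  [/\ mu.-integrable Omega (EFin \o (fun x => enorm (Du x) `^ p)),
      mu.-integrable Omega (EFin \o (fun x => f x * u x))
    & \int[mu]_(x in Omega) (enorm (Du x) `^ p) = \int[mu]_(x in Omega) (f x * u x)].
Proof.
have mphi j := C1c_measurable G gam gamI gam0 Omega (phi j) (phiC j).
have [||||| I L] := @Rintegral_dominated_cvg R _ _ mu Omega
  (fun j => flux Du (phi j)) (fun x => enorm (Du x) `^ p) (fun x => 2 * S x + 0) mO.
- by move=> j; apply: measurable_flux; exact: (mphi j).2.
- by apply: measurable_fun_powR; exact: measurable_enorm.
- apply: filterS aeS => x H Ox; have [_ c _ _] := H Ox.
  rewrite -(flux_self p _ p1); apply: cvgMl_tmp; apply: cvg_dotp => k; first exact: cvg_cst.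
  exact: c.
- exact: integrable_affine.
- apply: filterS aeS => x H j Ox; have [_ _ /(_ j)[_ c1] [_ c2]] := H Ox.
  apply: le_trans (flux_le p _ _ p1) _.
  by apply: le_trans (powRB1_mul_le p p1 _ _ (enorm_ge0 _) (enorm_ge0 _)) _; lra.
have [||||| I' L'] := @Rintegral_dominated_cvg R _ _ mu Omega
  (fun j x => f x * phi j x) (fun x => f x * u x) (fun x => M * S x + M) mO.
- by move=> j; apply: measurable_funM => //; exact: (mphi j).1.
- exact: measurable_funM.
- by apply: filterS aeS => x H Ox; have [c _ _ _] := H Ox; apply: cvgMl_tmp.
- exact: integrable_affine.
- apply: filterS2 fM aeS => x Hf H j Ox; have [_ _ /(_ j)[c _] _] := H Ox.
  rewrite normrM -[X in _ + X]mulr1 -mulrDr; apply: ler_pM => //; first exact: Hf.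
  by apply: le_trans (le_add1_powR p p1 _ (normr_ge0 _)) _; lra.
split=> //.
by apply: cvg_eq_lim L L' => j; exact: weak_C1c.
Qed.

Hypothesis u0 : {ae mu, forall x, Omega x -> 0 <= u x}.

(** The test function |psi|^p [inv_ramp](phi_j) belongs to [C1c]. The limit in j is taken first, and
    [picone_le] is applied to the limit, where the gradient inside the test function and the one in
    the flux coefficient are the same Du. *)
Lemma picone_C1c psi (e : R) : 0 < e -> C1c G Omega psi ->
  \int[mu]_(x in Omega) (f x * (abs_powR p (psi x) * inv_ramp p e (u x))) <=
  \int[mu]_(x in Omega) (enorm (hgrad G psi x) `^ p).
Proof.
move=> e0 psiC.
have [mpsi mhpsi] := C1c_measurable G gam gamI gam0 Omega psi psiC.
have mphi j := C1c_measurable G gam gamI gam0 Omega (phi j) (phiC j).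
have [cpsi _ [B B0 HB]] := C1c_regular G gam gamI gam0 Omega psi psiC.
have P00 : abs_powR p 0 = 0 by rewrite abs_powRE ?gt_eqF// normr0 powR0// gt_eqF.
have mulC j := C1c_mul_comp G gam gamI gam0 Omega psi (phi j) (abs_powR p) (dabs_powR p)
  (inv_ramp p e) (dinv_ramp p e) psiC (phiC j)
  (fun t => is_derive_abs_powR p t p1) (continuous_dabs_powR p p1) P00
  (fun t => is_derive_inv_ramp p e t e0) (continuous_dinv_ramp p e e0).
pose test j x := abs_powR p (psi x) * inv_ramp p e (phi j x).
have testE j x : flux Du (test j) x =
    dabs_powR p (psi x) * inv_ramp p e (phi j x) * flux Du psi x +
    abs_powR p (psi x) * dinv_ramp p e (phi j x) * flux Du (phi j) x.
  by rewrite /flux (mulC j).2 dotpDr !dotpZr; ring.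
(* The limit of [testE]: the formal flux against |psi|^p (u + e)^(1-p), written out because u need
   not be in [C1c]. *)
pose A x := dabs_powR p (psi x) * inv_ramp p e (u x) * flux Du psi x +
    abs_powR p (psi x) * dinv_ramp p e (u x) * (flux_coef p (Du x) * dotp (Du x) (Du x)).
have cinv : continuous (inv_ramp p e).
  by apply: continuous_of_derive => t; exact: (is_derive_inv_ramp p e t e0).
have cabs : continuous (abs_powR p).
  by apply: continuous_of_derive => t; exact: (is_derive_abs_powR p t p1).
have mcomp (h : R -> R) (v : V -> R) : continuous h -> measurable_fun Omega v ->
    measurable_fun Omega (fun x => h (v x)).
  by move=> ch mv; exact: (measurableT_comp (continuous_measurable_fun ch) mv).
pose C1 := (e / 2) `^ (1 - p); pose C2 := (p - 1) * (e / 2) `^ (- p).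
have C20 : 0 <= C2 by rewrite mulr_ge0 ?powR_ge0// subr_ge0 ltW.
have absB x : 0 <= abs_powR p (psi x) <= B `^ p.
  rewrite abs_powRE ?gt_eqF// powR_ge0 /=.
  by apply: ge0_ler_powR; rewrite ?nnegrE ?(ltW p0)//; exact: (HB x).1.
have dabsB x : `|dabs_powR p (psi x)| <= p * B `^ (p - 1).
  rewrite norm_dabs_powR// ler_wpM2l ?(ltW p0)//.
  by apply: ge0_ler_powR; rewrite ?nnegrE ?subr_ge0 ?(ltW p1)//; exact: (HB x).1.
(* The majorant multiplies the bounds p B^(p-1) and B^p for the powers of psi, C1 and C2 for
   [inv_ramp] and its derivative, S + B^p for the flux against psi, and 2 S for the flux against
   phi_j. *)
have [||||| IA L] := @Rintegral_dominated_cvg R _ _ mu Omega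
  (fun j => flux Du (test j)) A
  (fun x => (p * B `^ (p - 1) * C1 + B `^ p * C2 * 2) * S x + p * B `^ (p - 1) * C1 * B `^ p) mO.
- move=> j; apply: measurable_flux.
  exact: (C1c_measurable G gam gamI gam0 Omega _ (mulC j).1).2.
- apply: measurable_funD; apply: measurable_funM.
  + apply: measurable_funM; first exact: (mcomp _ _ (continuous_dabs_powR p p1)).
    exact: mcomp.
  + exact: measurable_flux.
  + apply: measurable_funM; first exact: mcomp.
    exact: (mcomp _ _ (continuous_dinv_ramp p e e0)).
  + apply: measurable_funM; last exact: measurable_dotp.
    by apply: measurable_fun_powR; exact: measurable_enorm.
- apply: filterS aeS => x H Ox; have [c1 c2 _ _] := H Ox.
  under eq_cvg do rewrite testE.
  apply: cvgD; apply: cvgM.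
  + by apply: cvgMl_tmp; apply: (cvg_comp _ (inv_ramp p e) c1); exact: cinv.
  + exact: cvg_cst.
  + by apply: cvgMl_tmp; apply: (cvg_comp _ (dinv_ramp p e) c1); exact: continuous_dinv_ramp.
  + by apply: cvgMl_tmp; apply: cvg_dotp => k; [exact: cvg_cst|exact: c2].
- exact: integrable_affine.
- apply: filterS aeS => x H j Ox; have [_ _ /(_ j)[_ s1] [_ s2]] := H Ox.
  rewrite testE.
  have F1 : `|flux Du psi x| <= S x + B `^ p.
    apply: le_trans (flux_le p _ _ p1) _.
    apply: (@le_trans _ _ (enorm (Du x) `^ (p - 1) * B)).
      by rewrite ler_wpM2l ?powR_ge0//; exact: (HB x).2.
    by apply: le_trans (powRB1_mul_le p p1 _ _ (enorm_ge0 _) B0) _; rewrite lerD2r.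
  have F2 : `|flux Du (phi j) x| <= 2 * S x.
    apply: le_trans (flux_le p _ _ p1) _.
    by apply: le_trans (powRB1_mul_le p p1 _ _ (enorm_ge0 _) (enorm_ge0 _)) _; lra.
  have /andP[i0 i1] := inv_ramp_le p p1 e (phi j x) e0.
  have /andP[a0 a1] := absB x.
  apply: (@le_trans _ _ (p * B `^ (p - 1) * C1 * (S x + B `^ p) + B `^ p * C2 * (2 * S x))).
    by apply: norm_add_mul3_le; rewrite ?(ger0_norm i0) ?(ger0_norm a0)//; exact: norm_dinv_ramp_le.
  by rewrite le_eqVlt; apply/orP; left; apply/eqP; ring.
have [||||| IF L'] := @Rintegral_dominated_cvg R _ _ mu Omega
  (fun j x => f x * test j x) (fun x => f x * (abs_powR p (psi x) * inv_ramp p e (u x)))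
  (fun x => 0 * S x + M * (B `^ p * C1)) mO.
- move=> j; apply: measurable_funM => //; apply: measurable_funM; first exact: mcomp.
  by apply: mcomp => //; exact: (mphi j).1.
- by apply: measurable_funM => //; apply: measurable_funM; exact: mcomp.
- apply: filterS aeS => x H Ox; have [c1 _ _ _] := H Ox.
  apply: cvgMl_tmp; apply: cvgMl_tmp.
  by apply: (cvg_comp _ (inv_ramp p e) c1); exact: cinv.
- exact: integrable_affine.
- apply: filterS fM => x H j Ox; rewrite mul0r add0r normrM.
  have /andP[i0 i1] := inv_ramp_le p p1 e (phi j x) e0.
  have /andP[a0 a1] := absB x.
  apply: ler_pM => //; first exact: H.
  by rewrite ger0_norm ?mulr_ge0//; apply: ler_pM.
have E : \int[mu]_(x in Omega) A x =
    \int[mu]_(x in Omega) (f x * (abs_powR p (psi x) * inv_ramp p e (u x))).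
  by apply: cvg_eq_lim L L' => j; apply: weak_C1c; exact: (mulC j).1.
rewrite -E; apply: le_Rintegral_ae => //.
  apply: (integrable_bounded Omega oO bO _ (B `^ p)).
    by apply: measurable_fun_powR; exact: measurable_enorm.
  move=> x _; rewrite ger0_norm ?powR_ge0//.
  by apply: ge0_ler_powR; rewrite ?nnegrE ?enorm_ge0 ?(ltW p0)//; exact: (HB x).2.
(* Nonnegativity of u enters here, after the limit: [ramp] becomes u + e and its derivative 1. *)
apply: filterS u0 => x H Ox; have ux := H Ox.
rewrite /A /inv_ramp /dinv_ramp ramp_pos// dramp_pos// mulr1.
have h0 : 0 < u x + e by rewrite ltr_wpDl.
have := picone_le p p1 (Du x) (hgrad G psi x) (psi x) _ h0.
by apply: le_trans; rewrite le_eqVlt; apply/orP; left; apply/eqP; rewrite /flux; ring.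
Qed.

End solution.
End picone.

(** * Comparison of two solutions *)

Section comparison.
Context {R : realType} {n : nat} (G : stratified_group R n).
Local Notation V := 'rV[R]_n.+1.
Local Notation mu := (lebesgue_measure_rV R n.+1).
Local Notation N1 := (head 0%N (sg_strata G)).
Context (gam : 'I_N1 -> R -> V).
Hypotheses (gamI : forall k, integral_curve (@hfield R n G k) (gam k))
           (gam0 : forall k, gam k 0 = 0).
Context (Omega : set V) (oO : open Omega) (bO : bounded_set Omega).
Context (p : R) (p1 : 1 < p).

Let p0 : 0 < p. Proof. exact: lt_trans p1. Qed.
Let mO : measurable Omega. Proof. exact: open_measurable_rV. Qed.

Context (u f : V -> R) (Du : V -> 'rV[R]_N1) (phi : nat -> V -> R) (S : V -> R) (M : R).
Hypotheses (mu_meas : measurable_fun Omega u) (mf : measurable_fun Omega f)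
  (mDu : forall k, measurable_fun Omega (fun x => Du x ord0 k))
  (uapprox : dominated_approx G Omega p u Du phi S)
  (fM : {ae mu, forall x, Omega x -> `|f x| <= M})
  (weak : forall psi, Cooc Omega psi ->
    \int[mu]_(x in Omega) flux G p Du psi x = \int[mu]_(x in Omega) (f x * psi x))
  (u0 : {ae mu, forall x, Omega x -> 0 <= u x})
  (f0 : {ae mu, forall x, Omega x -> 0 <= f x}).
Context (v : V -> R) (Dv : V -> 'rV[R]_N1) (chi : nat -> V -> R) (T : V -> R).
Hypotheses (mv : measurable_fun Omega v)
  (mDv : forall k, measurable_fun Omega (fun x => Dv x ord0 k))
  (vapprox : dominated_approx G Omega p v Dv chi T)
  (v0 : {ae mu, forall x, Omega x -> 0 <= v x}).

Let cabs : continuous (abs_powR p).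
Proof. by apply: continuous_of_derive => t; exact: (is_derive_abs_powR p t p1). Qed.

Let mcomp (h : R -> R) (w : V -> R) : continuous h -> measurable_fun Omega w ->
  measurable_fun Omega (fun x => h (w x)).
Proof. by move=> ch mw; exact: (measurableT_comp (continuous_measurable_fun ch) mw). Qed.

(** Here e is still fixed, so [inv_ramp] is at most (e/2)^(1-p) and M (e/2)^(1-p) T dominates as the
    approximants of v replace psi. *)
Lemma picone_sobolev (e : R) : 0 < e ->
  mu.-integrable Omega (EFin \o (fun x => f x * (abs_powR p (v x) * inv_ramp p e (u x)))) /\
  \int[mu]_(x in Omega) (f x * (abs_powR p (v x) * inv_ramp p e (u x))) <=
  \int[mu]_(x in Omega) (enorm (Dv x) `^ p).
Proof.
move=> e0; have [chiC iT aeT] := vapprox.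
have mchi j := C1c_measurable G gam gamI gam0 Omega (chi j) (chiC j).
have cinv : continuous (inv_ramp p e).
  by apply: continuous_of_derive => t; exact: (is_derive_inv_ramp p e t e0).
pose C1 := (e / 2) `^ (1 - p).
have [||||| I L] := @Rintegral_dominated_cvg R _ _ mu Omega
  (fun j x => f x * (abs_powR p (chi j x) * inv_ramp p e (u x)))
  (fun x => f x * (abs_powR p (v x) * inv_ramp p e (u x)))
  (fun x => M * C1 * T x) mO.
- move=> j; apply: measurable_funM => //; apply: measurable_funM; last exact: mcomp.
  by apply: mcomp => //; exact: (mchi j).1.
- by apply: measurable_funM => //; apply: measurable_funM; exact: mcomp.
- apply: filterS aeT => x H Ox; have [c _ _ _] := H Ox.
  by apply: cvgMl_tmp; apply: cvgMr_tmp; apply: (cvg_comp _ (abs_powR p) c); exact: cabs.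
- rewrite (_ : _ \o _ = (fun x => (M * C1)%:E * (EFin \o T) x)%E); first exact: integrableZl.
  by apply/funext => x /=; rewrite EFinM.
- apply: filterS2 fM aeT => x Hf H j Ox; have [_ _ /(_ j)[c _] _] := H Ox.
  have /andP[i0 i1] := inv_ramp_le p p1 e (u x) e0.
  rewrite abs_powRE ?gt_eqF// normrM normrM (ger0_norm i0) (ger0_norm (powR_ge0 _ _)).
  rewrite -mulrA (mulrC C1); apply: ler_pM => //; first exact: mulr_ge0.
    exact: Hf.
  by apply: ler_pM => //; exact: powR_ge0.
have [||||| _ L'] := @Rintegral_dominated_cvg R _ _ mu Omega
  (fun j x => enorm (hgrad G (chi j) x) `^ p) (fun x => enorm (Dv x) `^ p) T mO.
- by move=> j; apply: measurable_fun_powR; apply: measurable_enorm; exact: (mchi j).2.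
- by apply: measurable_fun_powR; exact: measurable_enorm.
- apply: filterS aeT => x H Ox; have [_ c _ _] := H Ox.
  have E (w : 'rV[R]_N1) : enorm w `^ p = abs_powR p (enorm w).
    by rewrite abs_powRE ?gt_eqF// ger0_norm ?enorm_ge0.
  rewrite E; under eq_cvg do rewrite E.
  by apply: (cvg_comp _ (abs_powR p) (cvg_enorm _ _ c)); exact: cabs.
- exact: iT.
- apply: filterS aeT => x H j Ox; have [_ _ /(_ j)[_ c] _] := H Ox.
  by rewrite ger0_norm ?powR_ge0.
split=> //; apply: ler_cvg_to L L' _; apply: nearW => j.
exact: (picone_C1c G gam gamI gam0 Omega oO bO p p1 u f Du phi S M
  mu_meas mf mDu uapprox fM weak u0 _ e e0 (chiC j)).
Qed.

(** The signs of u and f are known almost everywhere only; positive parts make [trunc_quotient]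
    nonnegative and monotone in e at every point, as monotone convergence is applied pointwise. *)
Definition pos_part (h : V -> R) x : R := Num.max (h x) 0.

(* The factor u (u + e)^(-p) replaces (u + e)^(1 - p): it increases to u^(1 - p) where
   u > 0, and to 0 where u = 0, as does the junk value of 1 / u^(p - 1). *)
Definition trunc_quotient (e : R) (x : V) : R :=
  pos_part f x * (`|v x| `^ p * (pos_part u x * (pos_part u x + e) `^ (- p))).

Let pos_part_ge0 h x : 0 <= pos_part h x.
Proof. by rewrite /pos_part le_max lexx orbT. Qed.

Let mpos h : measurable_fun Omega h -> measurable_fun Omega (pos_part h).
Proof. by move=> mh; apply: measurable_maxr. Qed.

Lemma measurable_trunc_quotient e : measurable_fun Omega (trunc_quotient e).
Proof.
apply: measurable_funM; first exact: mpos.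
apply: measurable_funM.
  by apply: measurable_fun_powR; exact: measurableT_comp.
apply: measurable_funM; first exact: mpos.
by apply: measurable_fun_powR; apply: measurable_funD => //; exact: mpos.
Qed.

Lemma trunc_quotient_ge0 e x : 0 <= trunc_quotient e x.
Proof.
by rewrite !mulr_ge0 ?pos_part_ge0 ?powR_ge0.
Qed.

Lemma trunc_quotient_le d e x : 0 < d -> d <= e -> trunc_quotient e x <= trunc_quotient d x.
Proof.
move=> d0 de; rewrite ler_wpM2l ?pos_part_ge0// ler_wpM2l ?powR_ge0// ler_wpM2l ?pos_part_ge0//.
apply: powR_le_neg; first by rewrite ltr_wpDl ?pos_part_ge0.
  by rewrite lerD2l.
by rewrite oppr_le0 ltW.
Qed.

Lemma trunc_quotient_cvg x :
  trunc_quotient (k.+1%:R^-1 : R) x @[k --> \oo] --> trunc_quotient 0 x.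
Proof.
rewrite /trunc_quotient; apply: cvgMl_tmp; apply: cvgMl_tmp.
have [ux0|ux0] := eqVneq (pos_part u x) 0.
  rewrite ux0 mul0r; under eq_cvg do rewrite mul0r; exact: cvg_cst.
have ux : 0 < pos_part u x by rewrite lt_neqAle eq_sym ux0 pos_part_ge0.
apply: cvgMl_tmp; rewrite addr0.
have c : (pos_part u x + k.+1%:R^-1 : R) @[k --> \oo] --> pos_part u x.
  rewrite -[X in _ --> X]addr0; apply: cvgD; [exact: cvg_cst|exact: cvg_harmonic].
apply: (cvg_comp _ (fun t => t `^ (- p)) c).
apply/(@differentiable_continuous _ _ _ (pos_part u x))/derivable1_diffP.
by case: (is_derive1_powR (- p) ux).
Qed.

Lemma trunc_quotient_integral_le (e : R) : 0 < e ->
  (\int[mu]_(x in Omega) (trunc_quotient e x)%:E <=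
  (\int[mu]_(x in Omega) (enorm (Dv x) `^ p))%:E)%E.
Proof.
move=> e0; have [I le] := picone_sobolev e e0.
apply: (@le_trans _ _ (\int[mu]_(x in Omega) (f x * (abs_powR p (v x) * inv_ramp p e (u x))))%:E);
  last by rewrite lee_fin.
rewrite /Rintegral fineK; last exact: integrable_fin_num.
have mg : measurable_fun Omega (fun x => (f x * (abs_powR p (v x) * inv_ramp p e (u x)))%:E).
  by case/integrableP: I.
have le_ae : {ae mu, forall x, Omega x ->
    trunc_quotient e x <= f x * (abs_powR p (v x) * inv_ramp p e (u x))}.
  apply: filterS2 u0 f0 => x Hu Hf Ox.
  rewrite /trunc_quotient /pos_part !max_l ?Hu ?Hf// abs_powRE ?gt_eqF//.
  rewrite ler_wpM2l ?Hf// ler_wpM2l ?powR_ge0// /inv_ramp ramp_pos ?Hu//.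
  have h0 : 0 < u x + e by rewrite ltr_wpDl ?Hu.
  have hn : u x + e != 0 by rewrite gt_eqF.
  (* (u + e)^(1-p) = (u + e) (u + e)^(-p), which is at least u (u + e)^(-p). *)
  rewrite powRD ?hn ?implybT// powRr1 ?(ltW h0)//.
  by rewrite ler_wpM2r ?powR_ge0// lerDl ltW.
have mt : measurable_fun Omega (fun x => (trunc_quotient e x)%:E).
  by apply/measurable_EFinP; exact: measurable_trunc_quotient.
have mabs : measurable_fun Omega
    (fun x => `|(f x * (abs_powR p (v x) * inv_ramp p e (u x)))%:E|)%E.
  exact: measurableT_comp.
(* The integrand is nonnegative only almost everywhere, so its absolute value takes its place in the
   comparison. *)
have E : (\int[mu]_(x in Omega) (f x * (abs_powR p (v x) * inv_ramp p e (u x)))%:E =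
    \int[mu]_(x in Omega) `|(f x * (abs_powR p (v x) * inv_ramp p e (u x)))%:E|)%E.
  apply: ae_eq_integral => //; apply: filterS le_ae => x H Ox; rewrite gee0_abs// lee_fin.
  exact: le_trans (trunc_quotient_ge0 e x) (H Ox).
rewrite E.
apply: ae_ge0_le_integral => //.
- by move=> x _; rewrite lee_fin trunc_quotient_ge0.
- apply: filterS le_ae => x H Ox; rewrite lee_fin.
  exact: le_trans (H Ox) (ler_norm _).
Qed.

(** Monotone convergence along e = 1/(k+1). The bound does not depend on e, so it gives finiteness
    of the limit integral, hence integrability of the singular quotient. *)
Lemma picone_quotient :
  mu.-integrable Omega (EFin \o (fun x => f x / u x `^ (p - 1) * v x `^ p)) /\
  \int[mu]_(x in Omega) (f x / u x `^ (p - 1) * v x `^ p) <=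
  \int[mu]_(x in Omega) (enorm (Dv x) `^ p).
Proof.
set C := \int[mu]_(x in Omega) (enorm (Dv x) `^ p).
pose q x := f x / u x `^ (p - 1) * v x `^ p.
have mt e : measurable_fun Omega (fun x => (trunc_quotient e x)%:E).
  by apply/measurable_EFinP; exact: measurable_trunc_quotient.
have Ile : (\int[mu]_(x in Omega) (trunc_quotient 0 x)%:E <= C%:E)%E.
  have := @monotone_convergence _ _ _ mu Omega mO
    (fun k x => (trunc_quotient (k.+1%:R^-1 : R) x)%:E) (fun k => mt _)
    (fun k x _ => trunc_quotient_ge0 _ x).
  have nd x : Omega x -> {homo (fun k => (trunc_quotient (k.+1%:R^-1 : R) x)%:E) :
      k l / (k <= l)%N >-> (k <= l)%E}.
    move=> _ k l kl; rewrite lee_fin; apply: trunc_quotient_le; first by rewrite invr_gt0.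
    by rewrite lef_pV2 ?posrE// ler_nat.
  move=> /(_ nd); rewrite (eq_integral (fun x => (trunc_quotient 0 x)%:E)); last first.
    move=> x _; apply/cvg_lim => //; apply: cvg_EFin; first exact: nearW.
    exact: trunc_quotient_cvg.
  move=> ->; apply: lime_le.
    apply: ereal_nondecreasing_is_cvgn => k l kl; apply: ge0_le_integral => //.
    - by move=> x _; rewrite lee_fin trunc_quotient_ge0.
    - by move=> x Ox; exact: nd.
  by apply: nearW => k; apply: trunc_quotient_integral_le; rewrite invr_gt0.
have mq : measurable_fun Omega q.
  apply: measurable_funM; last exact: measurable_fun_powR.
  apply: measurable_funM => //.
  rewrite (_ : (fun x => _) = (fun x => (u x `^ (p - 1)) `^ (-1))); last first.
    by apply/funext => x; rewrite powR_inv1// powR_ge0.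
  by do 2 apply: measurable_fun_powR.
have qE : {ae mu, forall x, Omega x -> q x = trunc_quotient 0 x}.
  apply: filterS3 u0 f0 v0 => x Hu Hf Hv Ox.
  rewrite /q /trunc_quotient /pos_part !max_l ?Hu ?Hf// ger0_norm ?Hv// addr0.
  rewrite -mulrA; congr (_ * _); rewrite mulrC; congr (_ * _).
  (* Where u = 0 both sides vanish: the inverse of 0^(p-1) = 0 is 0, and [trunc_quotient] has the
     factor u. *)
  have [->|un0] := eqVneq (u x) 0.
    by rewrite powR0 ?invr0 ?mul0r// gt_eqF// subr_gt0.
  rewrite -powRN opprB -{2}[u x]powRr1 ?Hu// -powRD ?un0 ?implybT//.
have q0 : {ae mu, forall x, Omega x -> (`|(q x)%:E| = (trunc_quotient 0 x)%:E)%E}.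
  by apply: filterS qE => x H Ox; rewrite gee0_abs H// lee_fin trunc_quotient_ge0.
have mqE : measurable_fun Omega (EFin \o q) by exact/measurable_EFinP.
have Iq : mu.-integrable Omega (EFin \o q).
  apply/integrableP; split=> //; apply: (@le_lt_trans _ _ C%:E); last exact: ltry.
  apply: le_trans Ile; rewrite le_eqVlt; apply/orP; left; apply/eqP.
  by apply: ae_eq_integral => //; exact: measurableT_comp.
split=> //.
rewrite -lee_fin /Rintegral fineK; last exact: (integrable_fin_num _ Iq).
apply: le_trans Ile; rewrite le_eqVlt; apply/orP; left; apply/eqP.
apply: ae_eq_integral => //.
by apply: filterS qE => x H Ox /=; rewrite -H.
Qed.

End comparison.

(** * Integral curves through the origin *)

Section existence_of_flows.
Context {R : realType} {n : nat} (G : stratified_group R n).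
Local Notation V := 'rV[R]_n.+1.
Local Notation N1 := (head 0%N (sg_strata G)).

(** An approximant of u has Lie derivatives at x0, and each of these comes with an integral curve
    starting at x0, defined for all times. Left translation by the inverse of x0 moves it to the
    origin. *)
Lemma sobolev0_flows p (Omega : set V) (u : V -> R) x0 : sobolev0 G p Omega u -> Omega x0 ->
  exists2 gam : 'I_N1 -> R -> V,
    forall k, integral_curve (@hfield R n G k) (gam k) & forall k, gam k 0 = 0.
Proof.
move=> [Du [_ _ [phi [phiC _ _ _]]]] Ox0; have [_ _ lie _] := phiC 0%N.
have /choice[gam Hgam] k : exists c, integral_curve (@hfield R n G k) c /\ c 0 = 0.
  have [l [c [cI c0 _]]] := lie k x0 Ox0.
  exists (fun t => sg_op G (sg_inv G x0) (c t)); split; first exact: integral_curve_op.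
  by rewrite c0 sg_opVx.
by exists gam => k; case: (Hgam k).
Qed.

Lemma sobolev_gradP p (Omega : set V) (u : V -> R) : sobolev0 G p Omega u ->
  sobolev0_grad p Omega u (sobolev_grad G p Omega u).
Proof. by move=> su; exact: (xgetPex (fun=> 0) su). Qed.

End existence_of_flows.

Theorem theorem3p6 (R : realType) (n : nat) (G : stratified_group R n)
    (p : R) (Omega : set 'rV[R]_n.+1)
    (g1 g2 : 'rV[R]_n.+1 -> R -> R) (u1 u2 Lu1 Lu2 : 'rV[R]_n.+1 -> R) :
  let mu := lebesgue_measure_rV R n.+1 in
  1 < p ->
  admissible_domain Omega ->
  (forall x rho, Omega x -> 0 < g1 x rho) ->
  (forall x rho, Omega x -> 0 < g2 x rho) ->
  (exists M, forall x rho, Omega x -> g1 x rho <= M) ->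
  (exists M, forall x rho, Omega x -> g2 x rho <= M) ->
  measurable_fun (Omega `*` [set: R]) (fun z => g1 z.1 z.2) ->
  measurable_fun (Omega `*` [set: R]) (fun z => g2 z.1 z.2) ->
  (exists C, forall x rho, Omega x -> 0 < rho ->
     g1 x rho <= C * (rho `^ (p - 1) + 1) /\
     g2 x rho <= C * (rho `^ (p - 1) + 1)) ->
  sobolev0 G p Omega u1 ->
  sobolev0 G p Omega u2 ->
  ~ {ae mu, forall x, Omega x -> u1 x = 0} ->
  ~ {ae mu, forall x, Omega x -> u2 x = 0} ->
  {ae mu, forall x, Omega x -> 0 <= u1 x} ->
  {ae mu, forall x, Omega x -> 0 <= u2 x} ->
  weak_psublaplacian G p Omega u1 Lu1 ->
  weak_psublaplacian G p Omega u2 Lu2 ->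
  {ae mu, forall x, Omega x -> - Lu1 x = g1 x (u1 x)} ->
  {ae mu, forall x, Omega x -> - Lu2 x = g2 x (u2 x)} ->
  (0 <= \int[mu]_(x in Omega)
          ((- Lu1 x / u1 x `^ (p - 1) + Lu2 x / u2 x `^ (p - 1)) *
           (u1 x `^ p - u2 x `^ p))%:E)%E.
Proof.
move=> mu p1 [oO bO _ _] g1_gt0 g2_gt0 [M1 HM1] [M2 HM2] _ _ _ su1 su2 _ _ u1_ge0 u2_ge0.
move=> [[mLu1 _] weak1] [[mLu2 _] weak2] Lu1E Lu2E.
(* A point of Omega is required to obtain the integral curves. *)
have [->|/set0P[x0 Ox0]] := eqVneq Omega set0; first by rewrite integral_set0.
have [gam gamI gam0] := sobolev0_flows G p Omega u1 x0 su1 Ox0.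
have mO : measurable Omega by exact: open_measurable_rV.
have Du1P := sobolev_gradP G p Omega u1 su1; have Du2P := sobolev_gradP G p Omega u2 su2.
set Du1 := sobolev_grad G p Omega u1 in Du1P; set Du2 := sobolev_grad G p Omega u2 in Du2P.
have [mu1 mDu1 _] := Du1P; have [mu2 mDu2 _] := Du2P.
have [phi1 [S1 A1]] := sobolev0_dominated G gam gamI gam0 Omega oO bO p p1 u1 Du1 Du1P.
have [phi2 [S2 A2]] := sobolev0_dominated G gam gamI gam0 Omega oO bO p p1 u2 Du2 Du2P.
pose f1 x := - Lu1 x; pose f2 x := - Lu2 x.
have mf1 : measurable_fun Omega f1 by exact: measurableT_comp.
have mf2 : measurable_fun Omega f2 by exact: measurableT_comp.
have f1M : {ae mu, forall x, Omega x -> `|f1 x| <= M1}.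
  apply: filterS Lu1E => x E Ox; rewrite /f1 E// gtr0_norm; [exact: HM1|exact: g1_gt0].
have f2M : {ae mu, forall x, Omega x -> `|f2 x| <= M2}.
  apply: filterS Lu2E => x E Ox; rewrite /f2 E// gtr0_norm; [exact: HM2|exact: g2_gt0].
have f1_ge0 : {ae mu, forall x, Omega x -> 0 <= f1 x}.
  by apply: filterS Lu1E => x E Ox; rewrite /f1 E// ltW// g1_gt0.
have f2_ge0 : {ae mu, forall x, Omega x -> 0 <= f2 x}.
  by apply: filterS Lu2E => x E Ox; rewrite /f2 E// ltW// g2_gt0.
have W1 psi : Cooc Omega psi ->
    \int[mu]_(x in Omega) flux G p Du1 psi x = \int[mu]_(x in Omega) (f1 x * psi x).
  by move=> psiC; have := weak1 psi psiC; rewrite /Rintegral => <-.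
have W2 psi : Cooc Omega psi ->
    \int[mu]_(x in Omega) flux G p Du2 psi x = \int[mu]_(x in Omega) (f2 x * psi x).
  by move=> psiC; have := weak2 psi psiC; rewrite /Rintegral => <-.
have [_ I1 E1] := energy_identity G gam gamI gam0 Omega oO bO p p1 u1 f1 Du1 phi1 S1 M1
  mu1 mf1 mDu1 A1 f1M W1.
have [_ I2 E2] := energy_identity G gam gamI gam0 Omega oO bO p p1 u2 f2 Du2 phi2 S2 M2
  mu2 mf2 mDu2 A2 f2M W2.
have [J1 Q1] := picone_quotient G gam gamI gam0 Omega oO bO p p1 u1 f1 Du1 phi1 S1 M1
  mu1 mf1 mDu1 A1 f1M W1 u1_ge0 f1_ge0 u2 Du2 phi2 S2 mu2 mDu2 A2 u2_ge0.
have [J2 Q2] := picone_quotient G gam gamI gam0 Omega oO bO p p1 u2 f2 Du2 phi2 S2 M2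
  mu2 mf2 mDu2 A2 f2M W2 u2_ge0 f2_ge0 u1 Du1 phi1 S1 mu1 mDu1 A1 u1_ge0.
pose q1 x := f1 x / u1 x `^ (p - 1) * u2 x `^ p.
pose q2 x := f2 x / u2 x `^ (p - 1) * u1 x `^ p.
have mq (u w : 'rV[R]_n.+1 -> R) : measurable_fun Omega u -> measurable_fun Omega w ->
    measurable_fun Omega (fun x => w x / u x `^ (p - 1)).
  move=> mu_meas mw; apply: measurable_funM => //.
  rewrite (_ : (fun x => _) = (fun x => (u x `^ (p - 1)) `^ (-1))); last first.
    by apply/funext => x; rewrite powR_inv1// powR_ge0.
  by do 2 apply: measurable_fun_powR.
(* The four terms are paired by energy: the integral of f1 u1 is that of |Du1|^p, which bounds the
   integral of q2, Picone for u2 with v = u1; symmetrically for f2 u2 and q1. *)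
have K1 : mu.-integrable Omega (EFin \o (fun x => f1 x * u1 x - q2 x)).
  by rewrite /comp; under eq_fun do rewrite EFinB; exact: integrableB.
have K2 : mu.-integrable Omega (EFin \o (fun x => f2 x * u2 x - q1 x)).
  by rewrite /comp; under eq_fun do rewrite EFinB; exact: integrableB.
have K : mu.-integrable Omega (EFin \o (fun x => (f1 x * u1 x - q2 x) + (f2 x * u2 x - q1 x))).
  by rewrite /comp; under eq_fun do rewrite EFinD; exact: integrableD.
have -> : (\int[mu]_(x in Omega)
      ((- Lu1 x / u1 x `^ (p - 1) + Lu2 x / u2 x `^ (p - 1)) *
       (u1 x `^ p - u2 x `^ p))%:E =
    \int[mu]_(x in Omega) ((f1 x * u1 x - q2 x) + (f2 x * u2 x - q1 x))%:E)%E.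
  apply: ae_eq_integral => //.
  - apply/measurable_EFinP; apply: measurable_funM.
      by apply: measurable_funD; exact: mq.
    by apply: measurable_funB; exact: measurable_fun_powR.
  - by case/integrableP: K.
  (* Also true at a = 0, where the numerator is 0^p = 0. *)
  - have div (a : R) : 0 <= a -> a `^ p / a `^ (p - 1) = a.
      move=> a0; have [->|an0] := eqVneq a 0.
        by rewrite powR0 ?mul0r// gt_eqF// (lt_trans ltr01).
      rewrite -powRB; last by rewrite an0 implybT.
      by rewrite subKr powRr1.
    apply: filterS2 u1_ge0 u2_ge0 => x H1 H2 Ox; congr (_%:E).
    rewrite -[X in (f1 x * X - _) + _](div _ (H1 Ox)).
    rewrite -[X in _ + (f2 x * X - _)](div _ (H2 Ox)) /q1 /q2 /f1 /f2.
    by move: (u1 x `^ p) (u2 x `^ p) (u1 x `^ (p - 1)) (u2 x `^ (p - 1)) => a b c d; ring.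
rewrite -[leRHS]fineK; last exact: (integrable_fin_num _ K).
rewrite lee_fin -/(Rintegral _ _ _) RintegralD// RintegralB// RintegralB//.
apply: addr_ge0; rewrite subr_ge0.
  by rewrite -E1; exact: Q2.
by rewrite -E2; exact: Q1.
Qed.
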